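(* Let $X_t=\mu t+\sigma W_t$ with $\mu\in\mathbb{R}$, $\sigma>0$, let $a>0$, and let $\tau_a^n$ be the $n$-th drawdown time without recovery. For all $\lambda>0$, $n\in\mathbb{N}$ and $x>0$, as measures in $y\in\mathbb{R}$, $$\mathbb{E}\left[e^{-\lambda\tau_a^n};\,M_{\tau_a^n}>x,\,X_{\tau_a^n}\in dy\right]=(c_\lambda)^n e^{-b_\lambda(y+na)}\sum_{m=0}^{n-1}\frac{x(x+ma)^{m-1}\,(y-x+(n-m)a)^{n-1-m}\,1_{\{y-x+(n-m)a\ge 0\}}}{m!\,(n-m-1)!}\,dy.$$
   Context: $X_t=\mu t+\sigma W_t$ ($X_0=0$) with $W$ a standard Brownian motion, $\mu\in\mathbb{R}$, $\sigma>0$; $M_t=\sup_{0\le s\le t}X_s$ is the (global) running maximum; $a>0$ is fixed; $M_{[s,t]}=\sup_{s\le u\le t}X_u$; $\mathbb{N}=\{1,2,\dots\}$; $\inf\emptyset=\infty$. The drawdown times without recovery are defined by $\tau_a^0=0$ and $$\tau_a^n=\inf\{t>\tau_a^{n-1}:\ M_{[\tau_a^{n-1},t]}-X_t\ge a\}.$$ Notation: $\mathbb{E}[Y;U]=\mathbb{E}[Y1_U]$; the $m=0$ factor $x(x+ma)^{m-1}=x\cdot x^{-1}$ equals $1$. Constants: $\beta_\lambda^{\pm}=\dfrac{-\mu\pm\sqrt{\mu^2+2\lambda\sigma^2}}{\sigma^2}$, $b_\lambda=\dfrac{\beta_\lambda^+e^{-\beta_\lambda^-a}-\beta_\lambda^-e^{-\beta_\lambda^+a}}{e^{-\beta_\lambda^-a}-e^{-\beta_\lambda^+a}}$,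 $c_\lambda=\dfrac{\beta_\lambda^+-\beta_\lambda^-}{e^{-\beta_\lambda^-a}-e^{-\beta_\lambda^+a}}$. *)

(* Defs.v *)
From HB Require Import structures.
From mathcomp Require Import all_boot all_order all_algebra.
From mathcomp Require Import all_classical all_reals all_analysis.
Set Implicit Arguments.
Unset Strict Implicit.
Unset Printing Implicit Defensive.
Import Order.TTheory GRing.Theory Num.Theory.
Import numFieldNormedType.Exports.
Local Open Scope classical_set_scope.
Local Open Scope ring_scope.

(* For a finite family the product rule over the whole family gives the rule
   for every subfamily, by taking B i = setT outside it. *)
Definition mutually_independent {R : realType} {d : measure_display}
    {T : measurableType d} (P : probability T R) (n : nat)
    (Y : 'I_n -> T -> R) : Prop :=
  forall B : 'I_n -> set R, (forall i, measurable (B i)) ->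
    P (\bigcap_(i in [set: 'I_n]) (Y i @^-1` B i)) =
    (\prod_(i < n) P (Y i @^-1` B i))%E.

(* Only the times t >= 0 matter; W is indexed by R so that no subtype of
   nonnegative reals is needed. *)
Record brownian_motion {R : realType} {d : measure_display}
    {T : measurableType d} (P : probability T R) (W : R -> {RV P >-> R}) :
    Prop := BrownianMotion {
  bm_start : {ae P, forall w, W 0 w = 0} ;
  bm_continuous :
    {ae P, forall w, {within `[0, +oo[, continuous (fun t : R => W t w)}} ;
  bm_independent_increments : forall (n : nat) (t : nat -> R),
    0 <= t 0%N -> {homo t : i j / (i <= j)%N >-> i <= j} ->
    mutually_independent P (fun i : 'I_n => W (t i.+1) \- W (t i)) ;
  (* normal_prob takes the standard deviation, not the variance *)
  bm_gaussian_increments : forall s t : R, 0 <= s -> s < t ->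
    forall B : set R, measurable B ->
    pushforward P (W t \- W s) B = normal_prob 0 (Num.sqrt (t - s)) B }.

Section paths.
Context {R : realType}.
Implicit Types (f : R -> R) (s t a : R).

Definition running_sup f s t : R := sup [set f u | u in `[s, t]].

(* When the previous time is +oo no t qualifies, and the infimum is +oo. *)
Fixpoint drawdown_time a f (n : nat) : \bar R :=
  if n is k.+1 then
    ereal_inf [set t%:E | t in
      [set t : R | (drawdown_time a f k < t%:E)%E /\
        a <= running_sup f (fine (drawdown_time a f k)) t - f t]]
  else 0%E.

End paths.

Definition drifted {R : realType} {d : measure_display} {T : measurableType d}
    {P : probability T R} (W : R -> {RV P >-> R}) (mu sigma : R) (w : T)
    (t : R) : R := mu * t + sigma * W t w.

Section constants.
Context {R : realType}.
Variables (mu sigma a lambda : R).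

Definition beta_plus : R :=
  (- mu + Num.sqrt (mu ^+ 2 + 2 * lambda * sigma ^+ 2)) / sigma ^+ 2.

Definition beta_minus : R :=
  (- mu - Num.sqrt (mu ^+ 2 + 2 * lambda * sigma ^+ 2)) / sigma ^+ 2.

Definition b_const : R :=
  (beta_plus * expR (- beta_minus * a) - beta_minus * expR (- beta_plus * a)) /
  (expR (- beta_minus * a) - expR (- beta_plus * a)).

Definition c_const : R :=
  (beta_plus - beta_minus) /
  (expR (- beta_minus * a) - expR (- beta_plus * a)).

(* The exponent m - 1 is an integer, so that the m = 0 factor is x * x^-1. *)
Definition drawdown_density (n : nat) (x y : R) : R :=
  c_const ^+ n * expR (- b_const * (y + n%:R * a)) *
  \sum_(m < n)
    (x * (x + m%:R * a) ^ (m%:Z - 1) *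
     (y - x + (n - m)%:R * a) ^+ (n - 1 - m) *
     (0 <= y - x + (n - m)%:R * a)%R%:R) /
    ((m`! * (n - m - 1)`!)%:R).

End constants.

(* Main.v *)
Require Import Defs.
From HB Require Import structures.
From mathcomp Require Import all_boot all_order all_algebra.
From mathcomp Require Import all_classical all_reals all_analysis.
From mathcomp Require Import measurable_realfun.
From mathcomp Require Import zify ring lra.
Set Implicit Arguments.
Unset Strict Implicit.
Unset Printing Implicit Defensive.
Import Order.TTheory GRing.Theory Num.Theory.
Import numFieldNormedType.Exports.
Local Open Scope classical_set_scope.
Local Open Scope ring_scope.

(* Sample X along a grid of mesh h. Its increments are independent and Gaussian,
   so the state formed by the position, the maximum since the last drawdown, the
   global maximum and the number of drawdowns still to come is a Markov chain,
   where a drawdown is declared slightly below level a. Let K be the operator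
   that gives the discounted expectation of G(X, M) at one drawdown. Interpolate
   the iterates of K G by the two Laplace transforms of the exit from the drawdown
   range; up to a small multiple of a Lyapunov function the discounted
   interpolation is both super- and subharmonic for the chain, because to first
   order it does not see the increase of the running maximum. Continuity of the
   paths makes the chain converge to (X, M) at the n-th drawdown time when h goes
   to 0 and then the level goes to a, so that
     E[e^(-lambda tau) G(X_tau, M_tau)] = (K^n G)(0, 0)
   for bounded Lipschitz G, without the strong Markov property.

   After conjugation by e^(-b y) the operator K is, up to the factor c e^(-b a),
     F |-> ((y, m) |-> \int_(v >= y) F (v - a) (max m v) dv).
   Its iterates on f(y) 1_(m > x) are convolutions with powers when m > x. When
   m <= x each maximum reached below x integrates a polynomial in x - y, which
   produces the Abel polynomials x (x + m a)^(m-1) / m!. *)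

(** * The drawdown operator *)

(** The slack in the level is forced: on a grid, a path that falls by exactly [a] shows a slightly
    smaller drop. At level [a - e] a drop by [a] is seen once the mesh is small relative to [e], and
    no drawdown is declared too early once [e] is small, whatever the mesh. Hence an iterated limit,
    mesh first. A step of size at most [e] costs [K * e] per drawdown and [K * e] times each
    increase of the maximum; the Lyapunov function pays for both. A step larger than [e] is charged
    to [expR (- t * e)] times exponential moments of order [t]. With [t = q + 1] and mesh
    [h = t ^- 2] these moments stay bounded, because [t ^ 2 * h = 1], while [expR (- t * e)] drops
    below a small multiple of [e * h]. Fatou's lemma passes only one-sided bounds to the limit, so
    the supermartingale argument is run for the value function and for its opposite, each raised by
    a constant to be nonnegative. Measurability of [tau] is not proved: measurable versions of the
    discount, the position and the maximum are built as limits of the chain, and the event of the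
    theorem is compared with them off a null set. *)

Section exp_bounds.
Context {R : realType}.
Implicit Types t k o : R.

Lemma expR_sub1_le t : expR t - 1 <= t * expR t.
Proof.
have := expR_ge1Dx (- t); rewrite expRN => h.
have e0 := expR_gt0 t.
have : (1 - t) * expR t <= (expR t)^-1 * expR t by rewrite ler_pM2r.
rewrite mulVf ?gt_eqF// => {}h; lra.
Qed.

Lemma normr_expR_sub1_le t : `|expR t - 1| <= `|t| * expR `|t|.
Proof.
have h1 := expR_ge1Dx t; have h2 := expR_sub1_le t.
have e1 : 1 <= expR `|t| by rewrite -expR0 ler_expR.
have [t0|t0] := leP 0 t.
  by rewrite ger0_norm ?subr_ge0 ?(ger0_norm t0)// -expR0 ler_expR.
have : expR t <= 1 by rewrite expR_le1 ltW.
move=> h; rewrite ler0_norm ?subr_le0// (ltr0_norm t0).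
rewrite (ltr0_norm t0) in e1.
have : - t * 1 <= - t * expR (- t) by apply: ler_wpM2l => //; lra.
lra.
Qed.

Lemma normr_expR_sub1B_le t : `|expR t - 1 - t| <= t ^+ 2 * expR `|t|.
Proof.
have h1 := expR_ge1Dx t; have h2 := expR_sub1_le t.
rewrite ger0_norm; last by lra.
apply: (@le_trans _ _ (t * (expR t - 1))); first by lra.
apply: le_trans (ler_norm _) _; rewrite normrM -real_normK ?num_real// expr2 -mulrA.
by apply: ler_wpM2l => //; exact: normr_expR_sub1_le.
Qed.

(** The bound sees the exponent only through [k], so that one constant serves [bp], [bm] and
    [exit_b] below. *)
Lemma normr_expRM_sub1_le t k o : `|t| <= k ->
  `|expR (t * o) - 1| <= k * (`|o| * expR (k * `|o|)).
Proof.
move=> tk; apply: le_trans (normr_expR_sub1_le _) _.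
rewrite normrM -mulrA; apply: ler_pM => //.
by apply: ler_wpM2l => //; rewrite ler_expR ler_wpM2r.
Qed.

Lemma normr_expRM_sub1B_le t k o : `|t| <= k ->
  `|expR (t * o) - 1 - t * o| <= k ^+ 2 * (o ^+ 2 * expR (k * `|o|)).
Proof.
move=> tk; apply: le_trans (normr_expR_sub1B_le _) _.
rewrite normrM exprMn -mulrA; apply: ler_pM.
- exact: sqr_ge0.
- by apply: mulr_ge0; [exact: sqr_ge0|exact: expR_ge0].
- by rewrite -real_normK ?num_real// ler_pXn2r ?nnegrE// (le_trans _ tk).
- by apply: ler_wpM2l; rewrite ?sqr_ge0// ler_expR ler_wpM2r.
Qed.

End exp_bounds.

Section lipschitz.
Context {R : realType}.

Lemma lipschitz_continuous (f : R -> R) (C : R) :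
  (forall x y, `|f x - f y| <= C * `|x - y|) -> continuous f.
Proof.
move=> fC x; apply/(@cvgrPdist_lt _ R^o) => e e0.
have C0 : 0 < `|C| + 1 by rewrite ltr_wpDl.
have := nbhsx_ballx (x : R^o) _ (divr_gt0 e0 C0); apply: filterS => y.
rewrite /ball/= ltr_pdivlMr// => xy.
apply: le_lt_trans (fC _ _) _; apply: le_lt_trans xy.
by rewrite mulrC ler_wpM2l//; have := ler_norm C; lra.
Qed.

End lipschitz.

Section exp_tail.
Context {R : realType}.
Notation mu := (@lebesgue_measure R).
Variable b : R.
Hypothesis b0 : 0 < b.

Lemma continuous_expRNM : continuous (fun v : R => expR (- b * v)).
Proof.
move=> z; apply: continuous_comp; last exact: continuous_expR.
by apply: continuousM => //; exact: cst_continuous.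
Qed.

Lemma is_derive_expRM (k x : R) :
  is_derive x 1 (fun v : R => expR (k * v)) (k * expR (k * x)).
Proof. by apply: trigger_derive; rewrite /GRing.scale/= mulr1 mulrC. Qed.

Lemma integral_expRNM (y : R) :
  (\int[mu]_(v in `[y, +oo[) (expR (- b * v))%:E = (expR (- b * y) / b)%:E)%E.
Proof.
have D (x : R) : is_derive x (1 : R) (fun v : R => - (expR (- b * v) / b)) (expR (- b * x)).
  have -> : (fun v : R => - (expR (- b * v) / b)) =
    (fun v : R => (- b^-1) *: (expR (- b * v))).
    by apply/funext => v; rewrite /GRing.scale/=; ring.
  have h := is_derive_expRM (- b) x.
  apply: is_derive_eq; rewrite /GRing.scale/= mulrA mulrNN mulVf ?mul1r//.
  by rewrite gt_eqF.
have C : continuous (fun v : R => - (expR (- b * v) / b)).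
  by move=> x; apply: differentiable_continuous; apply/derivable1_diffP; have [] := D x.
rewrite (@ge0_continuous_FTC2y _ _ (fun v => - (expR (- b * v) / b)) _ 0)//.
- by rewrite -EFinB sub0r opprK.
- exact/continuous_subspaceT/continuous_expRNM.
- rewrite -oppr0; apply: cvgN; rewrite -(mul0r b^-1); apply: cvgM; last exact: cvg_cst.
  rewrite (_ : (fun x => expR (- b * x)) =
               (fun z => expR (- z)) \o (fun z => b * z)); last first.
    by apply/funext => x /=; rewrite mulNr.
  apply: (@cvg_comp _ _ _ _ _ _ (pinfty_nbhs R)); last exact: cvgr_expR.
  exact: gt0_cvgMry.
- by apply/cvg_at_right_filter; exact: C.
- by move=> x _; rewrite derive1E; have [_ ->] := D x.
Qed.

Lemma integrable_expRNM (y : R) :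
  mu.-integrable `[y, +oo[ (EFin \o (fun v => expR (- b * v))).
Proof.
apply/integrableP; split.
  apply/measurable_EFinP; apply: measurable_funTS.
  by apply: continuous_measurable_fun; exact: continuous_expRNM.
under eq_integral do rewrite /= ger0_norm ?expR_ge0//.
by rewrite integral_expRNM ltry.
Qed.

Lemma Rintegral_expRNM (y : R) :
  \int[mu]_(v in `[y, +oo[) expR (- b * v) = expR (- b * y) / b.
Proof. by rewrite /Rintegral integral_expRNM. Qed.

End exp_tail.

Definition bounded_lipschitz {R : realType} (C : R) (G : R -> R -> R) :=
  (forall y m, `|G y m| <= C) /\
  (forall y y' m m', `|G y m - G y' m'| <= C * (`|y - y'| + `|m - m'|)).

(* With c = c_const and b = b_const this is E[e^(-lambda tau) G(X_tau, M_tau)],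
   tau the first drawdown time, for the process started at y with past maximum m;
   v is the maximum reached before tau, so that X_tau = v - a. *)
Definition drawdown_op {R : realType} (c b a : R) (G : R -> R -> R) (y m : R) :=
  c * expR (b * y) * \int[lebesgue_measure]_(v in `[y, +oo[)
    (expR (- b * v) * G (v - a) (Num.max m v)).

Section drawdown_op.
Context {R : realType}.
Notation mu := (@lebesgue_measure R).
Variables (c b a : R).
Hypotheses (c0 : 0 < c) (b0 : 0 < b).
Implicit Types (G : R -> R -> R).

Lemma dist_maxr (m m' v v' : R) :
  `|Num.max m v - Num.max m' v'| <= `|m - m'| + `|v - v'|.
Proof.
have h1 := ler_norm (m - m'); have := ler_norm (m' - m); rewrite distrC => h2.
have h3 := ler_norm (v - v'); have := ler_norm (v' - v); rewrite distrC => h4.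
by rewrite ler_norml; case: (leP m v); case: (leP m' v') => *; apply/andP; split; lra.
Qed.

Lemma bounded_lipschitz_ge0 C G : bounded_lipschitz C G -> 0 <= C.
Proof. by move=> [h _]; apply: le_trans (h 0 0). Qed.

Lemma continuous_kernel C G m : bounded_lipschitz C G ->
  continuous (fun v => G (v - a) (Num.max m v)).
Proof.
move=> GC; have C0 := bounded_lipschitz_ge0 GC; have [_ h] := GC.
apply: (@lipschitz_continuous _ _ (2 * C)) => v v'.
apply: le_trans (h _ _ _ _) _; rewrite (mulrC 2) -mulrA ler_wpM2l//.
have := dist_maxr m m v v'; rewrite subrr normr0.
have -> : v - a - (v' - a) = v - v' by ring.
lra.
Qed.

Lemma integrable_kernel C G m y : bounded_lipschitz C G ->
  mu.-integrable `[y, +oo[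
    (EFin \o (fun v => expR (- b * v) * G (v - a) (Num.max m v))).
Proof.
move=> GC; have C0 := bounded_lipschitz_ge0 GC; have [h _] := GC.
have cf : continuous (fun v : R => expR (- b * v) * G (v - a) (Num.max m v)).
  by move=> v; exact: (cvgM (@continuous_expRNM R b v) (@continuous_kernel C G m GC v)).
have i : mu.-integrable `[y, +oo[ (fun v => C%:E * (EFin \o (fun v => expR (- b * v))) v)%E.
  by apply: integrableZl => //; exact: integrable_expRNM.
apply: (le_integrable _ _ _ i) => //.
- apply/measurable_EFinP; apply: measurable_funTS.
  by apply: continuous_measurable_fun.
- move=> v _ /=; rewrite lee_fin !normrM (ger0_norm (expR_ge0 _)) (ger0_norm C0).
  by rewrite mulrC ler_wpM2r ?expR_ge0.
Qed.

(** Lack of memory of the exponential weight: the integral beyond [y + o] is that of the operator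
    started at [y + o], up to the factor [expR (- b * o)]. *)
Lemma drawdown_op_split C G m y o : bounded_lipschitz C G -> 0 <= o ->
  drawdown_op c b a G y m =
  c * expR (b * y) * \int[mu]_(v in `[y, y + o])
    (expR (- b * v) * G (v - a) (Num.max m v)) +
  expR (- b * o) * drawdown_op c b a G (y + o) m.
Proof.
move=> GC o0; rewrite /drawdown_op.
have i := integrable_kernel m y GC.
have := @Rintegral_itvB R _ (BLeft y) (BInfty _ false) (y + o) i.
rewrite bnd_simp lerDl => /(_ o0 isT).
rewrite Rintegral_itv_obnd_cbnd; last first.
  by apply: integrableS i => //; apply: subset_itvr; rewrite bnd_simp lerDl.
move=> <-; rewrite (mulrDr b y) expRD mulNr expRN.
by field; rewrite gt_eqF// expR_gt0.
Qed.

Lemma drawdown_op_bound C G y m : bounded_lipschitz C G ->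
  `|drawdown_op c b a G y m| <= c / b * C.
Proof.
move=> GC; have [h _] := GC.
have -> : c / b * C = c * expR (b * y) * (C * (expR (- b * y) / b)).
  by rewrite mulNr expRN; field; rewrite !gt_eqF// expR_gt0.
have ce0 : 0 <= c * expR (b * y) by rewrite mulr_ge0 ?expR_ge0// ltW.
rewrite /drawdown_op normrM (ger0_norm ce0) ler_wpM2l//.
have i := integrable_kernel m y GC.
apply: le_trans (le_normr_Rintegral _ i) _ => //.
rewrite -Rintegral_expRNM// -RintegralZl//; last exact: integrable_expRNM.
apply: le_Rintegral => //.
- exact: (integrable_norm i).
- by apply: (integrableZl _ C (integrable_expRNM b0 y)).
move=> v _; rewrite normrM (ger0_norm (expR_ge0 _)) mulrC.
by rewrite ler_wpM2r ?expR_ge0.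
Qed.

End drawdown_op.

Section drawdown_op_lipschitz.
Context {R : realType}.
Notation mu := (@lebesgue_measure R).
Variables (c b a : R).
Hypotheses (c0 : 0 < c) (b0 : 0 < b).
Implicit Types (G : R -> R -> R).

Lemma bounded_lipschitzW C C' G : C <= C' ->
  bounded_lipschitz C G -> bounded_lipschitz C' G.
Proof.
move=> CC' [h1 h2]; split=> [y m|y y' m m'].
  exact: le_trans (h1 _ _) _.
by apply: le_trans (h2 _ _ _ _) _; rewrite ler_wpM2r// addr_ge0.
Qed.

Lemma continuous_expRN_kernel C G m : bounded_lipschitz C G ->
  continuous (fun v : R => expR (- b * v) * G (v - a) (Num.max m v)).
Proof.
move=> GC v.
exact: (cvgM (@continuous_expRNM R b v) (@continuous_kernel R a C G m GC v)).
Qed.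

Lemma normr_Rintegral_itvcc (k : R -> R) D y o : 0 <= o -> continuous k ->
  (forall v, y <= v <= y + o -> `|k v| <= D) ->
  `|\int[mu]_(v in `[y, y + o]) k v| <= D * o.
Proof.
move=> o0 ck kD.
have i : mu.-integrable `[y, y + o] (EFin \o k).
  apply: continuous_compact_integrable; first exact: segment_compact.
  exact: continuous_subspaceT.
have cD : mu.-integrable `[y, y + o] (EFin \o cst D).
  apply: continuous_compact_integrable; first exact: segment_compact.
  by apply: continuous_subspaceT => x; exact: cst_continuous.
apply: le_trans (le_normr_Rintegral _ i) _ => //.
have -> : D * o = \int[mu]_(v in `[y, y + o]) D.
  rewrite Rintegral_cst// /= lebesgue_measure_itv/= lte_fin ltrDl.
  case: ltP => [_|o0']; first by rewrite -EFinB/= addrAC subrr add0r.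
  by have -> : o = 0 by lra.
by apply: le_Rintegral => //; exact: (integrable_norm i).
Qed.

Lemma Rintegral_expRNM_itv y o : 0 <= o ->
  \int[mu]_(v in `[y, y + o]) expR (- b * v) =
  (expR (- b * y) - expR (- b * (y + o))) / b.
Proof.
move=> o0; have i := integrable_expRNM b0 y.
have := @Rintegral_itvB R _ (BLeft y) (BInfty _ false) (y + o) i.
rewrite bnd_simp lerDl => /(_ o0 isT).
rewrite Rintegral_itv_obnd_cbnd; last first.
  by apply: integrableS i => //; apply: subset_itvr; rewrite bnd_simp lerDl.
by rewrite !Rintegral_expRNM// mulrBl; lra.
Qed.

(** The constant in [y] needs only the bound on [G]: by [drawdown_op_split], a shift by [o] produces
    an integral over length [o] and a factor [expR (- b * o)], each costing at most [c * C * o]. In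
    [m] the constant of [G] is multiplied by [c / b], the mass of the kernel. *)
Lemma drawdown_op_lipschitz C G : bounded_lipschitz C G ->
  bounded_lipschitz ((c / b + 2 * c) * C) (drawdown_op c b a G).
Proof.
move=> GC; have C0 := bounded_lipschitz_ge0 GC; have [h1 h2] := GC.
have cb0 : 0 < c / b by rewrite divr_gt0.
have cC0 : 0 <= c * C by rewrite mulr_ge0// ltW.
have cbC0 : 0 <= c / b * C by rewrite mulr_ge0// ltW.
have hy y o m : 0 <= o ->
    `|drawdown_op c b a G y m - drawdown_op c b a G (y + o) m| <= 2 * c * C * o.
  move=> o0; rewrite (@drawdown_op_split R c b a b0 C G m y o GC o0).
  set I := \int[mu]_(v in _) _; set g := drawdown_op _ _ _ _ _ _.
  have hg : `|g| <= c / b * C by exact: drawdown_op_bound.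
  have hI : `|I| <= C * expR (- b * y) * o.
    apply: normr_Rintegral_itvcc => //; first exact: continuous_expRN_kernel GC.
    move=> v /andP[yv _]; rewrite normrM (ger0_norm (expR_ge0 _)) mulrC.
    apply: ler_pM => //.
    by rewrite ler_expR !mulNr lerN2 ler_pM2l.
  clearbody I g.
  have e1 : expR (- b * o) <= 1 by rewrite expR_le1 mulNr oppr_le0 mulr_ge0// ltW.
  have e2 := expR_ge1Dx (- b * o).
  have -> : c * expR (b * y) * I + expR (- b * o) * g - g =
    c * (expR (b * y) * I) - (1 - expR (- b * o)) * g by ring.
  apply: le_trans (ler_normB _ _) _; rewrite !normrM (ger0_norm (ltW c0)).
  rewrite (ger0_norm (expR_ge0 _)) (ger0_norm (x := 1 - _)); last by lra.
  have A1 : expR (b * y) * `|I| <= C * o.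
    have -> : C * o = expR (b * y) * (C * expR (- b * y) * o).
      by rewrite mulNr expRN; field; rewrite gt_eqF// expR_gt0.
    by rewrite ler_pM2l ?expR_gt0.
  have A2 : (1 - expR (- b * o)) * `|g| <= (b * o) * (c / b * C).
    by apply: ler_pM => //; lra.
  have A3 : (b * o) * (c / b * C) = c * (C * o) by field; rewrite gt_eqF.
  have A4 : c * (expR (b * y) * `|I|) <= c * (C * o) by rewrite ler_pM2l.
  lra.
have hy' y y' m :
    `|drawdown_op c b a G y m - drawdown_op c b a G y' m| <= 2 * c * C * `|y - y'|.
  have [yy'|y'y] := leP y y'.
    have := @hy y (y' - y) m; rewrite subr_ge0 (addrC y) subrK => /(_ yy').
    by rewrite (ler0_norm (x := y - y')) ?subr_le0// opprB.
  have := @hy y' (y - y') m; rewrite subr_ge0 (addrC y') subrK => /(_ (ltW y'y)).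
  by rewrite distrC (ger0_norm (x := y - y')) ?subr_ge0// ltW.
have hm y m m' :
    `|drawdown_op c b a G y m - drawdown_op c b a G y m'| <= c / b * C * `|m - m'|.
  have i := integrable_kernel a b0 m y GC; have i' := integrable_kernel a b0 m' y GC.
  rewrite /drawdown_op -mulrBr -RintegralB//.
  have ce0 : 0 <= c * expR (b * y) by rewrite mulr_ge0 ?expR_ge0// ltW.
  rewrite normrM (ger0_norm ce0).
  have -> : c / b * C * `|m - m'| =
      c * expR (b * y) * ((C * `|m - m'|) * (expR (- b * y) / b)).
    by rewrite mulNr expRN; field; rewrite !gt_eqF// expR_gt0.
  rewrite ler_wpM2l//.
  have ib : mu.-integrable `[y, +oo[ (EFin \o (fun v => expR (- b * v) * G (v - a) (Num.max m v) -
      expR (- b * v) * G (v - a) (Num.max m' v))).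
    by apply: eq_integrable (integrableB _ i i') => // v _ /=; rewrite EFinB.
  apply: le_trans (le_normr_Rintegral _ ib) _ => //.
  rewrite -Rintegral_expRNM// -RintegralZl//; last exact: integrable_expRNM.
  apply: le_Rintegral => //.
  - exact: (integrable_norm ib).
  - by apply: (integrableZl _ (C * `|m - m'|) (integrable_expRNM b0 y)).
  move=> v _; rewrite -mulrBr normrM (ger0_norm (expR_ge0 _)) mulrC.
  rewrite ler_wpM2r ?expR_ge0//; apply: le_trans (h2 _ _ _ _) _.
  rewrite subrr normr0 add0r ler_wpM2l//.
  by have := dist_maxr m m' v v; rewrite subrr normr0 addr0.
split=> [y m|y y' m m'].
  apply: (@le_trans _ _ (c / b * C)); first exact: drawdown_op_bound.
  by rewrite mulrDl lerDl -mulrA mulr_ge0.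
have -> : drawdown_op c b a G y m - drawdown_op c b a G y' m' =
  (drawdown_op c b a G y m - drawdown_op c b a G y' m) +
  (drawdown_op c b a G y' m - drawdown_op c b a G y' m') by ring.
apply: le_trans (ler_normD _ _) _.
apply: le_trans (lerD (hy' _ _ _) (hm _ _ _)) _.
have := normr_ge0 (y - y'); have := normr_ge0 (m - m') => n1 n2.
have := mulr_ge0 cbC0 n2; have := mulr_ge0 cC0 n1; lra.
Qed.

(** For [y <= m] the values of [G] stay within [2 * C * o] of [G (y - a) m] on an interval of length
    [o], so freezing them costs only second order. *)
Lemma drawdown_op_step C G y m o : bounded_lipschitz C G -> 0 <= o -> y <= m ->
  `|c * expR (b * y) * \int[mu]_(v in `[y, y + o])
      (expR (- b * v) * G (v - a) (Num.max m v)) -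
    c / b * (1 - expR (- b * o)) * G (y - a) m| <= 2 * c * C * o ^+ 2.
Proof.
move=> GC o0 ym; have C0 := bounded_lipschitz_ge0 GC; have [h1 h2] := GC.
have -> : c / b * (1 - expR (- b * o)) * G (y - a) m =
  c * expR (b * y) * \int[mu]_(v in `[y, y + o]) (expR (- b * v) * G (y - a) m).
  rewrite RintegralZr//; last first.
    apply: integrableS (integrable_expRNM b0 y) => //; exact: subset_itvl.
  rewrite Rintegral_expRNM_itv// (mulrDr (- b) y) expRD !mulNr !expRN.
  by field; rewrite !gt_eqF// expR_gt0.
have ce0 : 0 <= c * expR (b * y) by rewrite mulr_ge0 ?expR_ge0// ltW.
have ck1 := @continuous_expRN_kernel C G m GC.
have ck2 : continuous (fun v : R => expR (- b * v) * G (y - a) m).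
  by move=> v; exact: (cvgM (@continuous_expRNM R b v) (cvg_cst _)).
have int k : continuous k -> mu.-integrable `[y, y + o] (EFin \o k).
  move=> ck; apply: continuous_compact_integrable; first exact: segment_compact.
  exact: continuous_subspaceT.
rewrite -mulrBr -RintegralB//; [|exact: int|exact: int].
rewrite normrM (ger0_norm ce0).
have -> : 2 * c * C * o ^+ 2 = c * expR (b * y) * ((2 * C * o * expR (- b * y)) * o).
  by rewrite mulNr expRN; field; rewrite !gt_eqF// expR_gt0.
rewrite ler_wpM2l//; apply: normr_Rintegral_itvcc => //.
  by move=> v; exact: (cvgB (ck1 v) (ck2 v)).
move=> v /andP[yv vo]; rewrite -mulrBr normrM (ger0_norm (expR_ge0 _)) mulrC.
apply: ler_pM => //.
  apply: le_trans (h2 _ _ _ _) _.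
  rewrite (_ : 2 * C * o = C * (2 * o)); last by ring.
  rewrite ler_wpM2l//.
  have := dist_maxr m m v y; rewrite subrr normr0 (max_l ym).
  have -> : v - a - (y - a) = v - y by ring.
  by rewrite (ger0_norm (x := v - y)); lra.
by rewrite ler_expR !mulNr lerN2 ler_pM2l.
Qed.

End drawdown_op_lipschitz.

(** * Exit from the drawdown range *)

Section exit_functions.
Context {R : realType}.
Variables (bp bm a : R).

Definition exit_gap := expR (- bm * a) - expR (- bp * a).

(* Laplace transforms of the time at which a process at distance d below its
   running maximum leaves the drawdown range at the drawdown level a,
   respectively at the running maximum. *)
Definition exit_low d := (expR (- bm * d) - expR (- bp * d)) / exit_gap.
Definition exit_high d :=
  (expR (- bm * a) * expR (- bp * d) - expR (- bp * a) * expR (- bm * d)) /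
  exit_gap.

(** [exit_b] is minus the slope of [exit_high] at 0 and [exit_c] is the slope of [exit_low] at 0.
    For the roots [beta_plus] and [beta_minus] they are [b_const] and [c_const]. *)
Definition exit_b :=
  (bp * expR (- bm * a) - bm * expR (- bp * a)) / exit_gap.
Definition exit_c := (bp - bm) / exit_gap.

Hypotheses (bp0 : 0 < bp) (bm0 : bm < 0) (a0 : 0 < a).

Lemma exit_gap_gt0 : 0 < exit_gap.
Proof. by rewrite subr_gt0 ltr_expR !mulNr ltrN2 ltr_pM2r// (lt_trans bm0). Qed.

Lemma exit_b_gt0 : 0 < exit_b.
Proof.
apply: divr_gt0; last exact: exit_gap_gt0.
have := mulr_gt0 bp0 (expR_gt0 (- bm * a)).
have := nmulr_rlt0 (expR (- bp * a)) bm0; rewrite expR_gt0 => h1 h2; lra.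
Qed.

Lemma exit_c_gt0 : 0 < exit_c.
Proof. by rewrite divr_gt0 ?exit_gap_gt0// subr_gt0 (lt_trans bm0). Qed.

Let A := expR (- bm * a) / exit_gap.
Let B := expR (- bp * a) / exit_gap.
(** A common bound for the absolute values of [bp], [bm] and [exit_b]. *)
Definition exit_rate := bp - bm + exit_b.
Local Notation k := exit_rate.

Let A_ge0 : 0 <= A. Proof. by rewrite divr_ge0 ?expR_ge0// ltW// exit_gap_gt0. Qed.
Let B_ge0 : 0 <= B. Proof. by rewrite divr_ge0 ?expR_ge0// ltW// exit_gap_gt0. Qed.
Let AB : A - B = 1.
Proof. by rewrite -mulrBl divff// gt_eqF// exit_gap_gt0. Qed.

Lemma exit_rate_gt0 : 0 < exit_rate.
Proof. by rewrite /exit_rate; have := exit_b_gt0; have := bp0; have := bm0; lra. Qed.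

Let bpk : `|bp| <= k.
Proof.
have h : bp <= k by rewrite /exit_rate; have := exit_b_gt0; have := bp0; have := bm0; lra.
by rewrite gtr0_norm.
Qed.
Let bmk : `|bm| <= k.
Proof.
have h : - bm <= k by rewrite /exit_rate; have := exit_b_gt0; have := bp0; have := bm0; lra.
by rewrite ltr0_norm.
Qed.
Let bk : `|exit_b| <= k.
Proof.
have h : exit_b <= k by rewrite /exit_rate; have := bp0; have := bm0; lra.
by rewrite gtr0_norm ?exit_b_gt0.
Qed.

Lemma exit_highN o : exit_high (- o) = A * expR (bp * o) - B * expR (bm * o).
Proof. by rewrite /exit_high !mulrNN /A /B; ring. Qed.

Lemma exit_lowN o : exit_low (- o) = exit_gap^-1 * (expR (bm * o) - expR (bp * o)).
Proof. by rewrite /exit_low !mulrNN mulrC. Qed.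

(** Constant terms agree because [A - B = 1], first-order terms because
    [exit_b = bp * A - bm * B]. *)
Lemma exit_highN_approx o : 0 <= o ->
  `|expR (exit_b * o) - exit_high (- o)| <=
  (1 + A + B) * k ^+ 2 * (o ^+ 2 * expR (k * o)).
Proof.
move=> o0; rewrite exit_highN; set r := fun t => expR (t * o) - 1 - t * o.
have -> : expR (exit_b * o) - (A * expR (bp * o) - B * expR (bm * o)) =
    r exit_b - A * r bp + B * r bm.
  have hb : exit_b = bp * A - bm * B by rewrite /exit_b /A /B; ring.
  rewrite /r {3}hb; have := AB; have -> : A = B + 1 by rewrite -AB; ring.
  by move=> _; ring.
have := normr_expRM_sub1B_le o bk; have := normr_expRM_sub1B_le o bpk.
have := normr_expRM_sub1B_le o bmk; rewrite (ger0_norm o0) -!/(r _).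
set E := k ^+ 2 * _ => h1 h2 h3.
apply: le_trans (ler_normD _ _) _.
apply: (@le_trans _ _ (E + A * E + B * E)); last by rewrite /E; lra.
rewrite normrM (ger0_norm B_ge0) lerD//; last by rewrite ler_wpM2l.
apply: le_trans (ler_normB _ _) _.
by rewrite normrM (ger0_norm A_ge0) lerD// ler_wpM2l.
Qed.

(** The first-order terms are [exit_c * o] and [- exit_c * o], and cancel. *)
Lemma exit_lowN_approx o : 0 <= o ->
  `|exit_c / exit_b * (expR (exit_b * o) - 1) + exit_low (- o)| <=
  (exit_c / exit_b + 2 / exit_gap) * k ^+ 2 * (o ^+ 2 * expR (k * o)).
Proof.
move=> o0; rewrite exit_lowN; set r := fun t => expR (t * o) - 1 - t * o.
have g0 := exit_gap_gt0; have b0 := exit_b_gt0; have c0 := exit_c_gt0.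
have -> : exit_c / exit_b * (expR (exit_b * o) - 1) +
    exit_gap^-1 * (expR (bm * o) - expR (bp * o)) =
    exit_c / exit_b * r exit_b + exit_gap^-1 * r bm - exit_gap^-1 * r bp.
  have hc : exit_c / exit_b * (exit_b * o) = exit_gap^-1 * bp * o - exit_gap^-1 * bm * o.
    rewrite mulrA divfK; last by rewrite gt_eqF.
    by rewrite /exit_c; ring.
  by rewrite /r !(mulrBr _ _ (_ * o)) hc; ring.
have := normr_expRM_sub1B_le o bk; have := normr_expRM_sub1B_le o bpk.
have := normr_expRM_sub1B_le o bmk; rewrite (ger0_norm o0) -!/(r _).
set E := k ^+ 2 * _ => h1 h2 h3.
have gi : 0 <= exit_gap^-1 by rewrite invr_ge0 ltW.
have cb : 0 <= exit_c / exit_b by rewrite divr_ge0// ltW.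
apply: le_trans (ler_normB _ _) _.
apply: (@le_trans _ _ (exit_c / exit_b * E + exit_gap^-1 * E + exit_gap^-1 * E)).
  rewrite normrM (ger0_norm gi) lerD//; last by rewrite ler_wpM2l.
  apply: le_trans (ler_normD _ _) _.
  by rewrite (normrM (exit_c / _)) (normrM (exit_gap^-1)) (ger0_norm gi) (ger0_norm cb) lerD// ler_wpM2l.
by rewrite /E; lra.
Qed.

(** At the drawdown level [exit_low] is 1 and [exit_high] is 0. Here and in the next lemma [o] is
    the overshoot of a discrete step, of either sign. *)
Lemma exit_low_approx o :
  `|exit_low (a + o) - 1| <= (A + B) * k * (`|o| * expR (k * `|o|)).
Proof.
have -> : exit_low (a + o) - 1 =
    A * (expR ((- bm) * o) - 1) - B * (expR ((- bp) * o) - 1).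
  rewrite /exit_low -[in LHS]AB /A /B !mulrDr !expRD; ring.
have := @normr_expRM_sub1_le R (- bm) k o; rewrite normrN => /(_ bmk) h1.
have := @normr_expRM_sub1_le R (- bp) k o; rewrite normrN => /(_ bpk) h2.
apply: le_trans (ler_normB _ _) _; rewrite (normrM A) (normrM B) (ger0_norm A_ge0) (ger0_norm B_ge0).
have := ler_wpM2l A_ge0 h1; have := ler_wpM2l B_ge0 h2; lra.
Qed.

Lemma exit_high_approx o :
  `|exit_high (a + o)| <= 2 * A * k * (`|o| * expR (k * `|o|)).
Proof.
have -> : exit_high (a + o) = A * expR (- bp * a) *
    ((expR ((- bp) * o) - 1) - (expR ((- bm) * o) - 1)).
  by rewrite /exit_high /A !mulrDr !expRD; ring.
have := @normr_expRM_sub1_le R (- bm) k o; rewrite normrN => /(_ bmk) h1.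
have := @normr_expRM_sub1_le R (- bp) k o; rewrite normrN => /(_ bpk) h2.
have e1 : expR (- bp * a) <= 1 by rewrite expR_le1 mulNr oppr_le0 mulr_ge0// ltW.
have h3 : A * expR (- bp * a) <= A by rewrite ler_piMr.
have Ae : 0 <= A * expR (- bp * a) by rewrite mulr_ge0// expR_ge0.
rewrite (normrM (A * _)) (ger0_norm Ae).
have -> : 2 * A * k * (`|o| * expR (k * `|o|)) =
  A * (k * (`|o| * expR (k * `|o|)) + k * (`|o| * expR (k * `|o|))) by ring.
apply: ler_pM => //; apply: le_trans (ler_normB _ _) _; exact: lerD.
Qed.

Lemma exit_low_bound d : 0 <= d <= a -> `|exit_low d| <= A + B.
Proof.
move=> /andP[d0 da]; rewrite /exit_low normrM.
have g0 := exit_gap_gt0.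
rewrite (ger0_norm (x := _^-1)); last by rewrite invr_ge0 ltW.
rewrite /A /B -mulrDl ler_wpM2r ?invr_ge0 ?(ltW g0)//.
have h1 : expR (- bm * d) <= expR (- bm * a).
  by rewrite ler_expR ler_wpM2l// oppr_ge0 ltW.
have h2 : expR (- bp * d) <= 1 by rewrite expR_le1 mulNr oppr_le0 mulr_ge0// ltW.
have h3 : 1 <= expR (- bm * d).
  by rewrite -expR0 ler_expR mulr_ge0// oppr_ge0 ltW.
have := expR_ge0 (- bp * d); have := expR_ge0 (- bp * a).
by rewrite ger0_norm; lra.
Qed.

Lemma exit_high_bound d : 0 <= d <= a -> `|exit_high d| <= A + B.
Proof.
move=> /andP[d0 da]; rewrite /exit_high normrM.
have g0 := exit_gap_gt0.
rewrite (ger0_norm (x := _^-1)); last by rewrite invr_ge0 ltW.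
rewrite /A /B -mulrDl ler_wpM2r ?invr_ge0 ?(ltW g0)//.
rewrite -!expRD ger0_norm.
  have := expR_ge0 (- bp * a + - bm * d).
  have : expR (- bm * a + - bp * d) <= expR (- bm * a).
    by rewrite ler_expR gerDl mulNr oppr_le0 mulr_ge0// ltW.
  by have := expR_ge0 (- bp * a); lra.
rewrite subr_ge0 ler_expR; have : 0 <= (bp - bm) * (a - d).
  by rewrite mulr_ge0; have := bp0; have := bm0; lra.
lra.
Qed.

Lemma exit_low0 : exit_low 0 = 0.
Proof. by rewrite /exit_low !mulr0 subrr mul0r. Qed.

Lemma exit_high0 : exit_high 0 = 1.
Proof. by rewrite /exit_high !mulr0 expR0 !mulr1 divff// gt_eqF// exit_gap_gt0. Qed.

(* Neumann condition at the running maximum: moving the maximum from y to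
   y + o changes the extended value function only to second order in o. *)
Lemma drawdown_op_up C G : bounded_lipschitz C G ->
  exists2 D, 0 <= D & forall y m o, 0 <= o -> y <= m ->
  `|drawdown_op exit_c exit_b a G (y + o) m - exit_low (- o) * G (y - a) m -
    exit_high (- o) * drawdown_op exit_c exit_b a G y m| <=
  D * (o ^+ 2 * expR (k * o)).
Proof.
move=> GC; have C0 := bounded_lipschitz_ge0 GC; have [h1 h2] := GC.
have g0 := exit_gap_gt0; have b0 := exit_b_gt0; have c0 := exit_c_gt0.
have gi : 0 <= exit_gap^-1 by rewrite invr_ge0 ltW.
have cb : 0 <= exit_c / exit_b by rewrite divr_ge0// ltW.
have k2 : 0 <= k ^+ 2 by rewrite sqr_ge0.
pose D1 := (1 + A + B) * k ^+ 2 * (exit_c / exit_b * C).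
pose D2 := (exit_c / exit_b + 2 / exit_gap) * k ^+ 2 * C.
have D1_ge0 : 0 <= D1.
  rewrite /D1; apply: mulr_ge0; apply: mulr_ge0 => //.
  by apply: addr_ge0 => //; exact: addr_ge0.
have D2_ge0 : 0 <= D2 by rewrite /D2; apply: mulr_ge0 => //; apply: mulr_ge0 => //; apply: addr_ge0 => //; exact: mulr_ge0.
have D3_ge0 : 0 <= 2 * exit_c * C by rewrite mulr_ge0// mulr_ge0// ltW.
exists (D1 + D2 + 2 * exit_c * C) => [|y m o o0 ym]; first by rewrite !addr_ge0.
have hg := drawdown_op_bound a c0 b0 y m GC.
have sp := @drawdown_op_split R exit_c exit_b a b0 C G m y o GC o0.
have st := @drawdown_op_step R exit_c exit_b a c0 b0 C G y m o GC o0 ym.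
move: sp st; set I := _ * \int[_]_(v in _) _.
set g := drawdown_op _ _ _ _ y m in hg *; set g' := drawdown_op _ _ _ _ _ m.
clearbody I g g' => sp st.
(* Inserting [g' = expR (exit_b * o) * (g - I)], from the split at [y + o], leaves three errors:
   those of [exit_highN_approx], [exit_lowN_approx] and [drawdown_op_step]. *)
have -> : g' - exit_low (- o) * G (y - a) m - exit_high (- o) * g =
  (expR (exit_b * o) - exit_high (- o)) * g
  - (exit_c / exit_b * (expR (exit_b * o) - 1) + exit_low (- o)) * G (y - a) m
  - expR (exit_b * o) * (I - exit_c / exit_b * (1 - expR (- exit_b * o)) * G (y - a) m).
  have -> : g' = expR (exit_b * o) * (g - I).
    by rewrite sp mulNr expRN; field; rewrite gt_eqF// expR_gt0.
  by rewrite mulNr expRN; field; rewrite !gt_eqF// expR_gt0.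
have E1 := exit_highN_approx o0; have E2 := exit_lowN_approx o0.
apply: le_trans (ler_normB _ _) _.
set E := o ^+ 2 * _.
have -> : (D1 + D2 + 2 * exit_c * C) * E = D1 * E + D2 * E + 2 * exit_c * C * E by ring.
rewrite lerD//.
  apply: le_trans (ler_normB _ _) _; rewrite lerD// normrM.
    by rewrite /D1 (mulrAC _ (exit_c / exit_b * C) E); apply: ler_pM.
  by rewrite /D2 (mulrAC _ C E); apply: ler_pM.
rewrite normrM (ger0_norm (expR_ge0 _)) mulrC mulrA; apply: ler_pM => //.
by rewrite ler_expR ler_wpM2r// (le_trans (ler_norm _) bk).
Qed.

End exit_functions.

(** * The chain and its value function *)

Section drawdown_op_iter.
Context {R : realType}.
Variables (bp bm a : R).
Hypotheses (bp0 : 0 < bp) (bm0 : bm < 0) (a0 : 0 < a).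
Let c := exit_c bp bm a.
Let b := exit_b bp bm a.
Local Notation k := (exit_rate bp bm a).

(** The integral meets only maxima [v >= y], so it does not matter whether [y] has already been
    entered into [m]. The chain updates both maxima at once, whereas [drawdown_op_up] keeps [m]
    fixed. *)
Lemma drawdown_op_max C G y m : bounded_lipschitz C G ->
  drawdown_op c b a G y (Num.max m y) = drawdown_op c b a G y m.
Proof.
move=> _; rewrite /drawdown_op; congr (_ * _); apply: eq_Rintegral => v.
by rewrite inE/= in_itv/= andbT => yv; rewrite -maxA (max_r yv).
Qed.

Lemma iter_drawdown_op_bounds n C G : bounded_lipschitz C G ->
  exists D, forall j, (j <= n)%N ->
    bounded_lipschitz D (iter j (drawdown_op c b a) G) /\
    forall y m o, 0 <= o -> y <= m ->
      `|iter j.+1 (drawdown_op c b a) G (y + o) m -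
        exit_low bp bm a (- o) * iter j (drawdown_op c b a) G (y - a) m -
        exit_high bp bm a (- o) * iter j.+1 (drawdown_op c b a) G y m| <=
      D * (o ^+ 2 * expR (k * o)).
Proof.
move=> GC.
have bl j : exists C', bounded_lipschitz C' (iter j (drawdown_op c b a) G).
  elim: j => [|j [C' GC']]; first by exists C.
  eexists; apply: drawdown_op_lipschitz GC'.
    exact: exit_c_gt0.
  exact: exit_b_gt0.
elim: n => [|n [D hD]].
  have [D1 D1_ge0 hD1] := drawdown_op_up bp0 bm0 a0 GC.
  have C0 := bounded_lipschitz_ge0 GC.
  exists (C + D1) => j; rewrite leqn0 => /eqP ->; split.
    by apply: bounded_lipschitzW GC; rewrite lerDl.
  move=> y m o o0 ym; apply: le_trans (hD1 _ _ _ o0 ym) _.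
  by rewrite ler_wpM2r ?lerDr// mulr_ge0 ?expR_ge0 ?sqr_ge0.
have [C' GC'] := bl n.+1.
have [D1 D1_ge0 hD1] := drawdown_op_up bp0 bm0 a0 GC'.
have C0 := bounded_lipschitz_ge0 GC'.
have D0 : 0 <= D by have [/bounded_lipschitz_ge0] := hD 0%N (leq0n _).
exists (C' + D1 + D) => j; rewrite leq_eqVlt => /predU1P[->|]; last first.
  rewrite ltnS => /hD[h1 h2]; split.
    by apply: bounded_lipschitzW h1; rewrite lerDr addr_ge0.
  move=> y m o o0 ym; apply: le_trans (h2 _ _ _ o0 ym) _.
  by rewrite ler_wpM2r ?lerDr ?addr_ge0// mulr_ge0 ?expR_ge0 ?sqr_ge0.
split; first by apply: bounded_lipschitzW GC'; rewrite -addrA lerDl addr_ge0.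
move=> y m o o0 ym; apply: le_trans (hD1 _ _ _ o0 ym) _.
rewrite ler_wpM2r ?mulr_ge0 ?expR_ge0 ?sqr_ge0//.
by rewrite addrAC lerDr addr_ge0.
Qed.

End drawdown_op_iter.

Section chain.
Context {R : realType}.

(* ((j, i), (x, (l, m))): j drawdowns still to come, i steps made so far,
   position x, maximum l since the last drawdown, global maximum m.  The state
   is frozen once j = 0. *)
Definition chain_state := ((nat * nat) * (R * (R * R)))%type.

Definition chain_step (a' : R) (s : chain_state) (z : R) : chain_state :=
  let: ((j, i), (x, (l, m))) := s in
  if j is j'.+1 then
    if a' <= Num.max l (x + z) - (x + z) then
      ((j', i.+1), (x + z, (x + z, Num.max m (x + z))))
    else ((j, i.+1), (x + z, (Num.max l (x + z), Num.max m (x + z))))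
  else s.

Definition chain_valid (a' : R) (n : nat) (s : chain_state) : Prop :=
  let: ((j, i), (x, (l, m))) := s in
  [/\ (j <= n)%N, x <= l, l <= m & l - x < a'].

Lemma chain_step_valid a' n s z : 0 < a' ->
  chain_valid a' n s -> chain_valid a' n (chain_step a' s z).
Proof.
move=> a'0; case: s => [[[|j] i] [x [l m]]]//= [jn xl lm lxa].
case: ifPn => h; rewrite /chain_valid; split => //.
- exact: ltnW.
- by rewrite le_max lexx orbT.
- by rewrite subrr.
- by rewrite le_max lexx orbT.
- by rewrite ge_max !le_max lm lexx orbT.
- by rewrite ltNge.
Qed.

End chain.

Section one_step.
Context {R : realType}.
Variables (bp bm a : R).
Hypotheses (bp0 : 0 < bp) (bm0 : bm < 0) (a0 : 0 < a).
Local Notation k := (exit_rate bp bm a).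
Variables (n : nat) (g : nat -> R -> R -> R) (C : R).
Hypothesis gC : forall j, (j <= n)%N -> bounded_lipschitz C (g j).
Hypothesis gmax : forall j y m, (j < n)%N -> g j.+1 y (Num.max m y) = g j.+1 y m.
Hypothesis gup : forall j, (j < n)%N -> forall y m o, 0 <= o -> y <= m ->
  `|g j.+1 (y + o) m - exit_low bp bm a (- o) * g j (y - a) m -
    exit_high bp bm a (- o) * g j.+1 y m| <= C * (o ^+ 2 * expR (k * o)).

(** Also used outside [l - a <= x <= l]: as a function of [x] it combines exponentials of rates [bp]
    and [bm], whose discounted Gaussian means are exact. The discretization error is then only that
    of replacing the value after a step by this formula. *)
Definition chain_value_ext j (x l m : R) :=
  exit_low bp bm a (l - x) * g j (l - a) m +
  exit_high bp bm a (l - x) * g j.+1 l m.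

Definition chain_value (s : chain_state) : R :=
  let: ((j, i), (x, (l, m))) := s in
  if j is j'.+1 then chain_value_ext j' x l m else g 0 x m.

Lemma chain_value_diag j i x m : chain_value ((j, i), (x, (x, m))) = g j x m.
Proof.
case: j => // j; rewrite /= /chain_value_ext subrr exit_low0 exit_high0//.
by rewrite mul0r mul1r add0r.
Qed.

(** The sum of three errors at a declared drawdown: [C] from the Lipschitz bound on [g j], and [C]
    times the constants of [exit_low_approx] and [exit_high_approx]. *)
Let K0 : R := C * (1 + exit_rate bp bm a * (3 * expR (- bm * a) / exit_gap bp bm a
  + expR (- bp * a) / exit_gap bp bm a)).

Let C0 : 0 <= C.
Proof. by have /bounded_lipschitz_ge0 := gC (leq0n n). Qed.

Lemma chain_value_bound a' s : a' <= a -> chain_valid a' n s ->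
  `|chain_value s| <= C + 2 * C * (expR (- bm * a) / exit_gap bp bm a
     + expR (- bp * a) / exit_gap bp bm a).
Proof.
move=> a'a; case: s => [[[|j] i] [x [l m]]] [jn xl lm lxa].
  have [h _] := gC jn; apply: le_trans (h _ _) _; rewrite lerDl.
  have gp := exit_gap_gt0 bp0 bm0 a0.
  by rewrite !mulr_ge0// addr_ge0// divr_ge0 ?expR_ge0 ?(ltW gp).
have d0 : 0 <= l - x <= a by rewrite subr_ge0 xl (ltW (lt_le_trans lxa a'a)).
have [h1 _] := gC (ltnW jn); have [h2 _] := gC jn.
have E1 := exit_low_bound bp0 bm0 a0 d0; have E2 := exit_high_bound bp0 bm0 a0 d0.
rewrite /= /chain_value_ext; set S := _ / _ + _ / _ in E1 E2 *.
apply: le_trans (ler_normD _ _) _.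
rewrite (normrM (exit_low _ _ _ _)) (normrM (exit_high _ _ _ _)).
have A1 : `|exit_low bp bm a (l - x)| * `|g j (l - a) m| <= S * C by exact: ler_pM.
have A2 : `|exit_high bp bm a (l - x)| * `|g j.+1 l m| <= S * C by exact: ler_pM.
have := C0; lra.
Qed.

Let K1 := 2 * (C + K0) * expR k.

(** A step with neither drawdown nor new maximum makes no error. If the step is at most [e], the
    overshoot of a drawdown is at most [e], and the quadratic error of [gup] is at most [e] times
    the increase of the maximum, up to constants. Larger steps go into the last term; in its
    exponent [k] covers the growth of the errors, 1 covers a polynomial factor and [t] buys
    [expR (- t * e)]. *)
Lemma chain_value_step_ex : exists2 K : R, 0 <= K & forall e t j i x l m z,
  0 < e -> e <= 1 -> e <= a -> 0 <= t ->
  chain_valid (a - e) n ((j.+1, i), (x, (l, m))) ->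
  `|chain_value (chain_step (a - e) ((j.+1, i), (x, (l, m))) z) -
    chain_value_ext j (x + z) l m| <=
  K * e * (Num.max 0 (x + z - l) +
           (a - e <= Num.max l (x + z) - (x + z))%R%:R) +
  K * expR (- t * e) * (expR ((k + 1 + t) * z) + expR (- (k + 1 + t) * z)).
Proof.
have k0 : 0 < k by exact: exit_rate_gt0.
have gp := exit_gap_gt0 bp0 bm0 a0.
have A0 : 0 <= expR (- bm * a) / exit_gap bp bm a by rewrite divr_ge0 ?expR_ge0 ?(ltW gp).
have B0 : 0 <= expR (- bp * a) / exit_gap bp bm a by rewrite divr_ge0 ?expR_ge0 ?(ltW gp).
have K0C : C <= K0.
  rewrite /K0 ler_peMr//; rewrite lerDl mulr_ge0 ?(ltW k0)//.
  by rewrite addr_ge0// -mulrA mulr_ge0.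
have K00 : 0 <= K0 by rewrite (le_trans C0).
have ek1 : 1 <= expR k by rewrite -expR0 ler_expR ltW.
have K1_ge0 : 0 <= K1 by rewrite /K1 mulr_ge0 ?expR_ge0// mulr_ge0// addr_ge0.
exists K1 => // e t j i x l m z e0 e1 ea t0 [jn xl lm lxa].
(* Because [|z| > e], the factor [expR (t * (|z| - e))] is at least 1. *)
have expB : e < `|z| -> expR ((k + 1) * `|z|) <=
   expR (- t * e) * (expR ((k + 1 + t) * z) + expR (- (k + 1 + t) * z)).
  move=> ez; apply: (@le_trans _ _ (expR (- t * e) * expR ((k + 1 + t) * `|z|))).
    rewrite -expRD ler_expR; have : 0 <= t * (`|z| - e) by rewrite mulr_ge0//; lra.
    lra.
  rewrite ler_wpM2l ?expR_ge0//; case: (ger0P z) => z0.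
    by rewrite lerDl expR_ge0.
  by rewrite mulrN -mulNr lerDr expR_ge0.
have tail0 : 0 <= expR (- t * e) * (expR ((k + 1 + t) * z) + expR (- (k + 1 + t) * z)).
  by rewrite mulr_ge0 ?expR_ge0// addr_ge0 ?expR_ge0.
rewrite -[X in _ <= _ + X]mulrA; move: tail0 expB; set tail := expR _ * (_ + _).
move=> tail0 expB; rewrite /chain_step; case: ifPn => ph.
- have xzl : x + z < l.
    rewrite ltNge; apply/negP => h; move: ph; rewrite (max_r h) subrr => ph.
    lra.
  rewrite (max_l (ltW xzl)) in ph *; rewrite (max_l (le_trans (ltW xzl) lm)).
  rewrite chain_value_diag (max_l (x := 0)) ?subr_le0 ?(ltW xzl)// add0r mulr1.
  (* The signed overshoot beyond [a]: at least [- e] since the drawdown is declared at [a - e], at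
     most [- e - z] since the previous state had not reached that level. *)
  set o := l - (x + z) - a.
  have oe : - e <= o by rewrite /o; lra.
  have oz : o <= - e - z by rewrite /o; lra.
  have [h1 h2] := gC (ltnW jn); have [h3 _] := gC jn.
  have step1 : `|g j (x + z) m - chain_value_ext j (x + z) l m| <=
      K0 * (`|o| * expR (k * `|o|)).
    have lxz : l - (x + z) = a + o by rewrite /o; ring.
    rewrite /chain_value_ext lxz.
    have -> : g j (x + z) m - (exit_low bp bm a (a + o) * g j (l - a) m +
        exit_high bp bm a (a + o) * g j.+1 l m) =
      (g j (x + z) m - g j (l - a) m)
      - (exit_low bp bm a (a + o) - 1) * g j (l - a) m
      - exit_high bp bm a (a + o) * g j.+1 l m by ring.
    have E1 := exit_low_approx bp0 bm0 a0 o; have E2 := exit_high_approx bp0 bm0 a0 o.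
    have e0' : `|o| <= `|o| * expR (k * `|o|).
      by rewrite ler_peMr// -expR0 ler_expR mulr_ge0// ltW.
    have E3 : `|g j (x + z) m - g j (l - a) m| <= C * (`|o| * expR (k * `|o|)).
      apply: le_trans (h2 _ _ _ _) _; rewrite subrr normr0 addr0.
      rewrite ler_wpM2l//; apply: le_trans e0'.
      by rewrite (_ : x + z - (l - a) = - o) ?normrN// /o; ring.
    apply: le_trans (ler_normB _ _) _.
    apply: le_trans (lerD (ler_normB _ _) (lexx _)) _.
    rewrite (normrM (exit_low _ _ _ _ - 1)) (normrM (exit_high _ _ _ _)).
    have F1 := ler_pM (normr_ge0 _) (normr_ge0 _) E1 (h1 (l - a) m).
    have F2 := ler_pM (normr_ge0 _) (normr_ge0 _) E2 (h3 l m).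
    apply: le_trans (lerD (lerD E3 F1) F2) _.
    by rewrite /K0; lra.
  apply: le_trans step1 _.
  have [ze|ez] := leP `|z| e.
    have oe1 : `|o| <= e.
      rewrite ler_norml oe/=; have := ler_norm (- z); rewrite normrN; lra.
    apply: (@le_trans _ _ (K1 * e)); last by rewrite lerDl mulr_ge0.
    have : `|o| * expR (k * `|o|) <= e * expR k.
      apply: ler_pM => //; rewrite ler_expR ler_piMr ?(ltW k0)//.
      exact: le_trans oe1 e1.
    move=> /(ler_wpM2l K00) h; apply: le_trans h _.
    have : 0 <= e * expR k by rewrite mulr_ge0 ?expR_ge0// ltW.
    move=> ee; have := mulr_ge0 K00 ee; have := mulr_ge0 C0 ee; rewrite /K1; lra.
  have oz1 : `|o| <= `|z|.
    rewrite ler_norml; have := ler_norm (- z); rewrite normrN => hz.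
    apply/andP; split; last by apply: le_trans hz; lra.
    by apply: le_trans oe; rewrite lerN2 ltW.
  apply: (@le_trans _ _ (K1 * tail)); last first.
    by rewrite lerDr mulr_ge0// ?mulr_ge0// ltW.
  apply: ler_pM => //.
    by rewrite /K1; have := ler_wpM2l K00 ek1; have := mulr_ge0 C0 (expR_ge0 k); lra.
  apply: le_trans (expB ez).
  rewrite (mulrDl k 1) mul1r expRD mulrC; apply: ler_pM => //; rewrite ?expR_ge0//.
    by rewrite ler_expR ler_wpM2l// ltW.
  by apply: le_trans oz1 _; have := expR_ge1Dx `|z|; lra.
- have [xzl|] := boolP (x + z <= l).
    rewrite (max_l xzl) (max_l (le_trans xzl lm)) /= subrr normr0.
    by rewrite addr_ge0 ?mulr_ge0 ?addr_ge0 ?(ltW e0)// le_max lexx.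
  rewrite -ltNge => xzl.
  (* The new running maximum is [x + z]; [gmax] restores the old global maximum [m], which [gup]
     keeps fixed. *)
  rewrite (max_r (ltW xzl)) chain_value_diag gmax//.
  set o := x + z - l; have o0 : 0 < o by rewrite subr_gt0.
  rewrite (max_r (ltW o0)) addr0.
  have := gup jn (ltW o0) lm; rewrite (_ : l + o = x + z); last by rewrite /o; ring.
  rewrite (_ : - o = l - (x + z)); last by rewrite /o; ring.
  move=> h.
  apply: le_trans (le_trans _ h) _.
    by rewrite le_eqVlt; apply/orP; left; apply/eqP; congr (`|_|); rewrite /chain_value_ext; ring.
  have oz : o <= z by rewrite /o; lra.
  have [ze|ez] := leP z e.
    apply: (@le_trans _ _ (K1 * e * o)); last by rewrite lerDl mulr_ge0.
    have -> : K1 * e * o = K1 * (e * o) by ring.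
    have : o ^+ 2 * expR (k * o) <= e * o * expR k.
      apply: ler_pM; rewrite ?expR_ge0 ?sqr_ge0//.
        by rewrite expr2 ler_wpM2r ?(ltW o0)// (le_trans oz).
      by rewrite ler_expR ler_piMr ?(ltW k0)// (le_trans oz)// (le_trans ze).
    move=> /(ler_wpM2l C0) h2; apply: le_trans h2 _.
    have : 0 <= e * o * expR k by rewrite !mulr_ge0 ?expR_ge0 ?(ltW e0) ?(ltW o0).
    move=> ee; have := mulr_ge0 K00 ee; have := mulr_ge0 C0 ee; rewrite /K1; lra.
  have zn : `|z| = z by rewrite gtr0_norm// (lt_trans e0).
  apply: (@le_trans _ _ (K1 * tail)); last first.
    by rewrite lerDr mulr_ge0 ?(ltW o0)// mulr_ge0// ltW.
  have := expB; rewrite zn => /(_ ez) h'.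
  apply: (@le_trans _ _ (C * (2 * expR ((k + 1) * z)))).
    rewrite ler_wpM2l// (mulrDl k 1) mul1r expRD mulrCA mulrC; apply: ler_pM.
    - by rewrite expR_ge0.
    - exact: sqr_ge0.
    - by rewrite ler_expR ler_wpM2l// ltW.
    have z0 : 0 <= z by rewrite ltW// (lt_trans e0).
    have := expR_ge1Dxn 1 z0; rewrite /= => hz.
    have : o ^+ 2 <= z ^+ 2 by rewrite ler_pXn2r// nnegrE ltW.
    move: hz; rewrite (_ : 2`!%:R = 2 :> R)//; lra.
  have K12 : 2 * C <= K1.
    by rewrite /K1; have := ler_wpM2l C0 ek1; have := mulr_ge0 K00 (expR_ge0 k); lra.
  rewrite mulrA (mulrC C); apply: ler_pM => //; rewrite ?expR_ge0//.
  by rewrite mulr_ge0.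
Qed.

End one_step.

(** * Exponential moments of the normal law *)

Section normal_exponential.
Context {R : realType}.
Notation mu := (@lebesgue_measure R).

Lemma ge0_integral_normal_prob (m s : R) (f : R -> \bar R) :
  (forall x, 0 <= f x)%E -> measurable_fun setT f ->
  (\int[normal_prob m s]_x f x = \int[mu]_x (f x * (normal_pdf m s x)%:E))%E.
Proof.
move=> f0 mf.
have mpdf : measurable_fun setT (fun x : R => (normal_pdf m s x)%:E).
  by apply/measurable_EFinP; exact: measurable_normal_pdf.
rewrite -(Radon_Nikodym_SigmaFinite.change_of_variables (normal_prob_dominates m s))//.
have i := Radon_Nikodym_SigmaFinite.f_integrable (normal_prob_dominates m s).
apply: ae_eq_integral => //.
- by apply: emeasurable_funM => //; exact: (measurable_int mu).
- exact: emeasurable_funM.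
- apply: ae_eqe_mul2l; apply: integral_ae_eq => // E _ mE.
  rewrite -Radon_Nikodym_SigmaFinite.f_integral//; exact: normal_prob_dominates.
Qed.

(** Completing the square: tilting the centred normal law of variance [h] by [expR (t * r)] gives
    mean [t * h]. *)
Lemma integral_expR_normal (h t : R) : 0 < h ->
  (\int[normal_prob 0 (Num.sqrt h)]_r (expR (t * r))%:E =
   (expR (t ^+ 2 * h / 2))%:E)%E.
Proof.
move=> h0; have s0 : Num.sqrt h != 0 by rewrite gt_eqF// sqrtr_gt0.
have cE : continuous (fun r : R => expR (t * r)).
  move=> r; apply: continuous_comp; last exact: continuous_expR.
  by apply: continuousM => //; exact: cst_continuous.
rewrite ge0_integral_normal_prob; last 2 first.
- by move=> r; rewrite lee_fin expR_ge0.
- by apply/measurable_EFinP; exact: continuous_measurable_fun.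
transitivity (\int[mu]_x ((expR (t ^+ 2 * h / 2))%:E *
    (normal_pdf (t * h) (Num.sqrt h) x)%:E))%E.
  apply: eq_integral.
  move=> x _; rewrite /normal_pdf (negbTE s0) /normal_fun -!EFinM; congr EFin.
  rewrite mulrCA [RHS]mulrCA -!expRD; congr (_ * expR _).
  by rewrite sqr_sqrtr ?ltW// mulr2n; field; rewrite gt_eqF// addr_gt0.
rewrite ge0_integralZl//=.
- by rewrite integral_normal_pdf mule1.
- by apply/measurable_EFinP; exact: measurable_normal_pdf.
- by move=> x _; rewrite lee_fin normal_pdf_ge0.
Qed.

Lemma integrable_expR_normal (h t : R) : 0 < h ->
  (normal_prob 0 (Num.sqrt h)).-integrable setT (fun r => (expR (t * r))%:E).
Proof.
move=> h0; apply/integrableP; split.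
  apply/measurable_EFinP; apply: continuous_measurable_fun => r.
  apply: continuous_comp; last exact: continuous_expR.
  by apply: continuousM => //; exact: cst_continuous.
under eq_integral do rewrite /= ger0_norm ?expR_ge0//.
by rewrite integral_expR_normal// ltry.
Qed.

(** A pair holds a coefficient and a rate. Coefficients of either sign are allowed; it is the whole
    sum that dominates the nonnegative [f]. *)
Lemma integral_le_expR_normal (h : R) (A : seq (R * R)) (f : R -> R) : 0 < h ->
  measurable_fun setT f -> (forall r, 0 <= f r) ->
  (forall r, f r <= \sum_(p <- A) p.1 * expR (p.2 * r)) ->
  (\int[normal_prob 0 (Num.sqrt h)]_r (f r)%:E <=
   (\sum_(p <- A) p.1 * expR (p.2 ^+ 2 * h / 2))%:E)%E.
Proof.
move=> h0 mf f0 fA.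
have AE : (normal_prob 0 (Num.sqrt h)).-integrable setT
      (fun r => (\sum_(p <- A) p.1 * expR (p.2 * r))%:E) /\
    (\int[normal_prob 0 (Num.sqrt h)]_r (\sum_(p <- A) p.1 * expR (p.2 * r))%:E =
      (\sum_(p <- A) p.1 * expR (p.2 ^+ 2 * h / 2))%:E)%E.
  elim: A {f mf f0 fA} => [|p A [IH1 IH2]].
    rewrite big_nil; under eq_fun do rewrite big_nil.
    by split; [exact: integrable0|rewrite integral0].
  have i1 : (normal_prob 0 (Num.sqrt h)).-integrable setT
      (fun r => (p.1%:E * (expR (p.2 * r))%:E)%E).
    by apply: integrableZl => //; exact: integrable_expR_normal.
  rewrite big_cons; split.
    apply: eq_integrable (integrableD _ i1 IH1) => // r _.
    by rewrite big_cons EFinD EFinM.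
  under eq_integral do rewrite big_cons EFinD EFinM.
  rewrite integralD// IH2 integralZl//; last exact: integrable_expR_normal.
  by rewrite integral_expR_normal// -EFinM -EFinD.
have [i <-] := AE; apply: ge0_le_integral => //.
- by move=> r _; rewrite lee_fin.
- by apply/measurable_EFinP.
- exact: measurable_int i.
- by move=> r _; rewrite lee_fin.
Qed.

End normal_exponential.

Section measurability.
Context {R : realType}.

(** [G y m] is the infimum over rational [r] of [G r m + C * |y - r|], a countable infimum of
    jointly measurable functions. *)
Lemma measurable_bounded_lipschitz C (G : R -> R -> R) : bounded_lipschitz C G ->
  measurable_fun setT (fun p : R * R => G p.1 p.2).
Proof.
move=> GC; have C0 := bounded_lipschitz_ge0 GC; have [h1 h2] := GC.
pose r (k : nat) : R := ratr (odflt 0 (unpickle k : option rat)).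
pose h (k : nat) (p : R * R) := G (r k) p.2 + C * `|p.1 - r k|.
have hG k p : G p.1 p.2 <= h k p.
  rewrite /h -lerBlDl; apply: le_trans (ler_norm _) _.
  by apply: le_trans (h2 _ _ _ _) _; rewrite subrr normr0 addr0.
have hlb p : has_lbound (range (h ^~ p)).
  by exists (G p.1 p.2) => _ [k _ <-].
have GE : (fun p : R * R => G p.1 p.2) = (fun p => infs (h ^~ p) 0).
  apply/funext => p; apply/eqP; rewrite eq_le; apply/andP; split.
    apply: lb_le_inf; first by exists (h 0%N p); exists 0%N.
    by move=> _ [k _ <-].
  apply/ler_addgt0Pr => e e0.
  have d0 : 0 < e / (2 * C + 1) by rewrite divr_gt0// ltr_wpDl// mulr_ge0.
  have : p.1 < p.1 + e / (2 * C + 1) by rewrite ltrDl.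
  move=> /rat_in_itvoo[q]; rewrite in_itv/= => /andP[q1 q2].
  apply: (@le_trans _ _ (h (pickle q) p)).
    by apply: ge_inf => //; [exact: has_lbound_sdrop|exists (pickle q)].
  have rq : r (pickle q) = ratr q by rewrite /r pickleK.
  rewrite /h rq.
  have dq : `|p.1 - ratr q| <= e / (2 * C + 1).
    by rewrite distrC ger0_norm ?subr_ge0 ?(ltW q1)//; lra.
  have := h2 (ratr q) p.1 p.2 p.2; rewrite subrr normr0 addr0 => h3.
  have h4 : G (ratr q) p.2 - G p.1 p.2 <= C * `|p.1 - ratr q|.
    by rewrite (distrC p.1); apply: le_trans (ler_norm _) h3.
  have h5 : 2 * C * `|p.1 - ratr q| <= e.
    apply: (@le_trans _ _ ((2 * C + 1) * (e / (2 * C + 1)))).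
      by apply: ler_pM => //; rewrite ?mulr_ge0// lerDl.
    by rewrite mulrC divfK// gt_eqF// ltr_wpDl// mulr_ge0.
  lra.
rewrite GE; apply: measurable_fun_infs => // k.
rewrite /h; apply: measurable_funD.
  apply: (measurableT_comp (f := G (r k))); last exact: measurable_snd.
  apply: continuous_measurable_fun; apply: (@lipschitz_continuous _ _ C) => x y.
  by apply: le_trans (h2 _ _ _ _) _; rewrite subrr normr0 add0r.
apply: measurable_funM; first exact: measurable_cst.
apply: measurableT_comp => //.
by apply: measurable_funB; [exact: measurable_fst|exact: measurable_cst].
Qed.

Lemma measurable_natnat_slices d1 d2 d3 (T : measurableType d1)
    (S : measurableType d2) (U : measurableType d3)
    (f : ((nat * nat) * T) * S -> U) :
  (forall i j, measurable_fun setT (fun p : T * S => f ((i, j, p.1), p.2))) ->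
  measurable_fun setT f.
Proof.
move=> mf _ B mB; rewrite setTI.
have -> : f @^-1` B = \bigcup_i \bigcup_j
    ((fun q : ((nat * nat) * T) * S => (q.1.1, (q.1.2, q.2))) @^-1`
     ([set (i, j)] `*` ((fun p : T * S => f ((i, j, p.1), p.2)) @^-1` B))).
  apply/seteqP; split => [[[[i j] t] s] /= fB|[[[i j] t] s] [i' _ [j' _ [/= [-> ->]]]]//].
  by exists i => //; exists j.
apply: bigcupT_measurable => i; apply: bigcupT_measurable => j.
rewrite -[X in measurable X]setTI.
have mq : measurable_fun setT (fun q : ((nat * nat) * T) * S => (q.1.1, (q.1.2, q.2))).
  apply: measurable_fun_pair.
    exact: (measurableT_comp measurable_fst measurable_fst).
  apply: measurable_fun_pair; last exact: measurable_snd.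
  exact: (measurableT_comp measurable_snd measurable_fst).
apply: mq => //; apply: measurableX; last by rewrite -[X in measurable X]setTI; exact: mf.
rewrite (_ : [set (i, j)] = [set i] `*` [set j]); first exact: measurableX.
by apply/seteqP; split => [[? ?] [-> ->]|[? ?] [/= -> ->]].
Qed.

Lemma measurable_natnat_slice d1 d3 (T : measurableType d1)
    (U : measurableType d3) (f : (nat * nat) * T -> U) :
  (forall i j, measurable_fun setT (fun t : T => f ((i, j), t))) ->
  measurable_fun setT f.
Proof.
move=> mf.
have h : measurable_fun setT (fun p : ((nat * nat) * T) * T => f p.1).
  apply: measurable_natnat_slices => i j.
  exact: (measurableT_comp (mf i j) measurable_fst).
apply: (measurableT_comp (f := fun p : ((nat * nat) * T) * T => f p.1)
  (g := fun s => (s, s.2))) => //.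
by apply: measurable_fun_pair => //; exact: measurable_snd.
Qed.

Lemma measurable_chain_step a' :
  measurable_fun setT (fun p : chain_state * R => chain_step a' p.1 p.2).
Proof.
apply: measurable_natnat_slices => -[|j] i.
  rewrite (_ : (fun p => _) = (fun p => ((0%N, i), p.1))).
    by apply: measurable_fun_pair => //; exact: measurable_fst.
  by apply/funext => -[[? [? ?]] ?].
pose x (p : (R * (R * R)) * R) := p.1.1.
pose l (p : (R * (R * R)) * R) := p.1.2.1.
pose m (p : (R * (R * R)) * R) := p.1.2.2.
have mx : measurable_fun setT x.
  exact: (measurableT_comp measurable_fst measurable_fst).
have ml : measurable_fun setT l.
  apply: (measurableT_comp measurable_fst).
  exact: (measurableT_comp measurable_snd measurable_fst).
have mm : measurable_fun setT m.
  apply: (measurableT_comp measurable_snd).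
  exact: (measurableT_comp measurable_snd measurable_fst).
have mxz : measurable_fun setT (fun p : (R * (R * R)) * R => x p + p.2).
  by apply: measurable_funD => //; exact: measurable_snd.
have mlz : measurable_fun setT (fun p : (R * (R * R)) * R => Num.max (l p) (x p + p.2)).
  exact: measurable_maxr.
have mmz : measurable_fun setT (fun p : (R * (R * R)) * R => Num.max (m p) (x p + p.2)).
  exact: measurable_maxr.
rewrite (_ : (fun p => _) = (fun p =>
   if a' <= Num.max (l p) (x p + p.2) - (x p + p.2) then
   ((j, i.+1), (x p + p.2, (x p + p.2, Num.max (m p) (x p + p.2)))) else
   ((j.+1, i.+1), (x p + p.2, (Num.max (l p) (x p + p.2), Num.max (m p) (x p + p.2)))))); last first.
  by apply/funext => -[[? [? ?]] ?].
apply: measurable_fun_ifT.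
- by apply: measurable_fun_ler => //; apply: measurable_funB.
- by do 3 apply: measurable_fun_pair => //.
- by do 3 apply: measurable_fun_pair => //.
Qed.

End measurability.

(** * Approximate super- and subharmonicity of the value function *)

Section superharmonic.
Context {R : realType}.
Variables (bp bm a mu sigma lam : R).
Hypotheses (bp0 : 0 < bp) (bm0 : bm < 0) (a0 : 0 < a) (lam0 : 0 < lam).
Hypothesis bpE : mu * bp + sigma ^+ 2 * bp ^+ 2 / 2 = lam.
Hypothesis bmE : mu * bm + sigma ^+ 2 * bm ^+ 2 / 2 = lam.
Local Notation k := (exit_rate bp bm a).
Variables (n : nat) (g : nat -> R -> R -> R) (C : R).
Hypothesis gbl : forall j, exists C', bounded_lipschitz C' (g j).
Hypothesis gC : forall j, (j <= n)%N -> bounded_lipschitz C (g j).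
Hypothesis gmax : forall j y m, (j < n)%N -> g j.+1 y (Num.max m y) = g j.+1 y m.
Hypothesis gup : forall j, (j < n)%N -> forall y m o, 0 <= o -> y <= m ->
  `|g j.+1 (y + o) m - exit_low bp bm a (- o) * g j (y - a) m -
    exit_high bp bm a (- o) * g j.+1 y m| <= C * (o ^+ 2 * expR (k * o)).
Local Notation value := (chain_value bp bm a g).

Lemma measurable_chain_value : measurable_fun setT value.
Proof.
apply: measurable_natnat_slice => -[|j] i.
  have [C' h] := gbl 0.
  apply: (@eq_measurable_fun _ _ _ _ _ (fun p : R * (R * R) => g 0 p.1 p.2.2)).
    by move=> [? [? ?]].
  apply: (measurableT_comp (f := fun p : R * R => g 0 p.1 p.2)
    (g := fun p : R * (R * R) => (p.1, p.2.2))).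
    exact: measurable_bounded_lipschitz h.
  apply: measurable_fun_pair; first exact: measurable_fst.
  exact: (measurableT_comp measurable_snd measurable_snd).
pose x (p : R * (R * R)) := p.1.
pose l (p : R * (R * R)) := p.2.1.
pose m (p : R * (R * R)) := p.2.2.
have mx : measurable_fun setT x by exact: measurable_fst.
have ml : measurable_fun setT l.
  exact: (measurableT_comp measurable_fst measurable_snd).
have mm : measurable_fun setT m.
  exact: (measurableT_comp measurable_snd measurable_snd).
have mexp c : measurable_fun setT (fun p => expR (c * (l p - x p))).
  apply: measurableT_comp; first exact: measurable_expR.
  by apply: measurable_funM => //; exact: measurable_funB.
apply: (@eq_measurable_fun _ _ _ _ _ (fun p : R * (R * R) =>
   exit_low bp bm a (l p - x p) * g j (l p - a) (m p) +
   exit_high bp bm a (l p - x p) * g j.+1 (l p) (m p))).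
  by move=> [? [? ?]].
have [C1 h1] := gbl j; have [C2 h2] := gbl j.+1.
apply: measurable_funD; apply: measurable_funM.
- apply: measurable_funM => //; apply: measurable_funB => //.
- apply: (measurableT_comp (f := fun p : R * R => g j p.1 p.2)
    (g := fun p : R * (R * R) => (l p - a, m p))).
    exact: measurable_bounded_lipschitz h1.
  by apply: measurable_fun_pair => //; exact: measurable_funB.
- apply: measurable_funM => //; apply: measurable_funB => //.
    by apply: measurable_funM.
  by apply: measurable_funM.
- apply: (measurableT_comp (f := fun p : R * R => g j.+1 p.1 p.2)
    (g := fun p : R * (R * R) => (l p, m p))).
    exact: measurable_bounded_lipschitz h2.
  by apply: measurable_fun_pair.
Qed.

(* Lyapunov function: its decrease along the chain pays for the overshoots of
   the running maximum and for each completed drawdown. *)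
Definition chain_weight (c0 : R) (s : chain_state) : R :=
  let: ((j, i), (x, (l, m))) := s in c0 + 2 * j%:R + expR (x - l).

(** The candidate supermartingale: [sg] is 1 or -1, for an upper or a lower bound, and [M] makes it
    nonnegative. It is used with [K] of order [e]. *)
Definition chain_super (c0 M K h sg : R) (s : chain_state) : R :=
  M + expR (- lam * h) ^+ s.1.2 * (sg * value s + K * chain_weight c0 s).

Lemma measurable_chain_super c0 M K h sg :
  measurable_fun setT (chain_super c0 M K h sg).
Proof.
have mw : measurable_fun setT (chain_weight c0).
  apply: measurable_natnat_slice => j i.
  apply: (@eq_measurable_fun _ _ _ _ _ (fun p : R * (R * R) =>
     c0 + 2 * j%:R + expR (p.1 - p.2.1))).
    by move=> [? [? ?]].
  apply: measurable_funD; first exact: measurable_cst.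
  apply: measurableT_comp; first exact: measurable_expR.
  apply: measurable_funB; first exact: measurable_fst.
  exact: (measurableT_comp measurable_fst measurable_snd).
apply: measurable_funD; first exact: measurable_cst.
apply: measurable_funM; last first.
  apply: measurable_funD; apply: measurable_funM => //.
  exact: measurable_chain_value.
by apply: measurable_natnat_slice => j i; exact: measurable_cst.
Qed.

Lemma chain_weight_ge0 c0 s : 0 <= c0 -> 0 <= chain_weight c0 s.
Proof.
by case: s => [[j i] [x [l m]]] c00; rewrite /= !addr_ge0 ?expR_ge0// mulr_ge0.
Qed.

(** A drawdown takes 2 off the counter term while the exponential returns to 1. A new maximum resets
    [expR (x + z - l)] to 1, a loss of at least [x + z - l]. *)
Lemma chain_weight_step a' c0 j i x l m z : 0 < a' -> x <= l ->
  chain_weight c0 (chain_step a' ((j.+1, i), (x, (l, m))) z) <=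
  c0 + 2 * j.+1%:R + expR (x - l) * expR z -
    (Num.max 0 (x + z - l) +
     (a' <= Num.max l (x + z) - (x + z))%R%:R).
Proof.
move=> a'0 xl; rewrite -expRD (_ : x - l + z = x + z - l); last by ring.
rewrite /chain_step; have -> : j.+1%:R = j%:R + 1 :> R by rewrite -natr1.
have e1 := expR_ge1Dx (x + z - l); have e0 := expR_gt0 (x + z - l).
case: ifPn => ph.
  have xzl : x + z < l.
    rewrite ltNge; apply/negP => h; move: ph; rewrite (max_r h) subrr => ph.
    by have := lt_le_trans a'0 ph; rewrite ltxx.
  rewrite (max_l (x := 0)) ?subr_le0 ?(ltW xzl)// /= subrr expR0; lra.
rewrite /chain_weight -natr1; have [xzl|] := boolP (x + z <= l).
  by rewrite (max_l xzl) (max_l (x := 0)) ?subr_le0//=; lra.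
rewrite -ltNge => xzl; rewrite (max_r (ltW xzl)) subrr expR0.
by rewrite (max_r (x := 0)) ?subr_ge0 ?(ltW xzl)//=; lra.
Qed.

(** [cc] is the growth rate of the mean of [expR X]. The discount on [c0] covers this growth and
    leaves [h] over, which will pay for the steps larger than [e]. *)
Lemma weight_discount c0 h d : 0 < h -> h <= 1 -> d <= 0 ->
  let cc := mu + sigma ^+ 2 / 2 in
  1 + `|cc| * expR `|cc| <= c0 * lam -> 0 <= c0 ->
  c0 + expR d * expR (cc * h) + h <= expR (lam * h) * (c0 + expR d).
Proof.
move=> h0 h1 d0 cc c0lam c00.
have e1 := expR_ge1Dx (lam * h).
have lamh : 0 <= lam * h by rewrite mulr_ge0// ltW.
have e2 : expR (cc * h) <= 1 + `|cc| * expR `|cc| * h.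
  have := normr_expR_sub1_le (cc * h); have := ler_norm (expR (cc * h) - 1).
  rewrite normrM (gtr0_norm h0) => A1 A2.
  have : `|cc| * h * expR (`|cc| * h) <= `|cc| * expR `|cc| * h.
    rewrite mulrAC ler_wpM2r ?(ltW h0)// ler_wpM2l// ler_expR.
    by rewrite ler_piMr.
  lra.
have ed1 : expR d <= 1 by rewrite expR_le1.
have ed0 := expR_gt0 d.
set X := `|cc| * expR `|cc| in e2 c0lam.
have X0 : 0 <= X by rewrite mulr_ge0// expR_ge0.
have A1 : expR d * expR (cc * h) <= expR d + X * h.
  apply: (@le_trans _ _ (expR d * (1 + X * h))); first by rewrite ler_wpM2l// ltW.
  have : expR d * (X * h) <= 1 * (X * h) by rewrite ler_wpM2r// mulr_ge0// ltW.
  lra.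
have A2 : (1 + lam * h) * (c0 + expR d) <= expR (lam * h) * (c0 + expR d).
  by rewrite ler_wpM2r// addr_ge0// ltW.
have A3 : (1 + X) * h <= c0 * lam * h by rewrite ler_wpM2r// ltW.
have A4 : 0 <= lam * h * expR d by rewrite mulr_ge0// ltW.
lra.
Qed.

Lemma chain_value_ext_exp j x l m :
  exists P N, forall z, chain_value_ext bp bm a g j (x + z) l m =
    P * expR (bp * z) + N * expR (bm * z).
Proof.
exists (expR (- bp * (l - x)) / exit_gap bp bm a *
   (expR (- bm * a) * g j.+1 l m - g j (l - a) m)).
exists (expR (- bm * (l - x)) / exit_gap bp bm a *
   (g j (l - a) m - expR (- bp * a) * g j.+1 l m)) => z.
rewrite /chain_value_ext /exit_low /exit_high.
rewrite (_ : - bm * (l - (x + z)) = - bm * (l - x) + bm * z); last by ring.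
rewrite (_ : - bp * (l - (x + z)) = - bp * (l - x) + bp * z); last by ring.
by rewrite !expRD; ring.
Qed.

(** By [bpE] and [bmE] the discounted mean of the extended value is exact, so only the errors of
    [chain_value_step_ex] remain. [chain_weight_step] matches those of overshoots and drawdowns; the
    tail, of mean at most [e * h] by assumption, is matched by the spare [h] of
    [weight_discount]. *)
Lemma chain_super_harmonic : exists M K c0, [/\ 0 <= M, 0 <= K, 0 <= c0,
  (forall e s, 0 < e -> chain_valid (a - e) n s -> `|value s| <= M) &
  forall e h t, 0 < e -> e <= 1 -> e < a -> 0 < h -> h <= 1 -> 0 <= t ->
  let u := k + 1 + t in
  expR (- t * e) * (expR ((mu * u + sigma ^+ 2 * u ^+ 2 / 2) * h) +
    expR ((- mu * u + sigma ^+ 2 * u ^+ 2 / 2) * h)) <= e * h ->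
  forall sg s, sg = 1 \/ sg = -1 -> chain_valid (a - e) n s ->
  0 <= chain_super c0 M (K * e) h sg s /\
  (\int[normal_prob 0%R (Num.sqrt h)]_r (chain_super c0 M (K * e) h sg
     (chain_step (a - e) s (mu * h + sigma * r)))%:E <=
     (chain_super c0 M (K * e) h sg s)%:E)%E ].
Proof.
have C0 : 0 <= C by have /bounded_lipschitz_ge0 := gC (leq0n n).
have gp := exit_gap_gt0 bp0 bm0 a0.
have [K K0 HK] := chain_value_step_ex bp0 bm0 a0 gC gmax gup.
pose S := expR (- bm * a) / exit_gap bp bm a + expR (- bp * a) / exit_gap bp bm a.
have S0 : 0 <= S by rewrite addr_ge0// divr_ge0 ?expR_ge0 ?(ltW gp).
pose M := C + 2 * C * S.
have M0 : 0 <= M by rewrite addr_ge0// !mulr_ge0.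
pose cc := mu + sigma ^+ 2 / 2.
pose c0 := (1 + `|cc| * expR `|cc|) / lam.
have c00 : 0 <= c0 by rewrite divr_ge0 ?(ltW lam0)// addr_ge0// mulr_ge0// expR_ge0.
have c0lam : c0 * lam = 1 + `|cc| * expR `|cc| by rewrite divfK// gt_eqF.
have vM e s' : 0 < e -> chain_valid (a - e) n s' -> `|value s'| <= M.
  move=> e0 vs'; have a'a : a - e <= a by rewrite gerBl ltW.
  by have := chain_value_bound bp0 bm0 a0 gC a'a vs'.
exists M, K, c0; split => // e h t e0 e1 ea h0 h1 t0 u tail sg s sgE vs.
have sg1 : `|sg| = 1 by case: sgE => ->; rewrite ?normrN normr1.
have eh0 : 0 < expR (- lam * h) by exact: expR_gt0.
have eh1 : expR (- lam * h) <= 1.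
  by rewrite expR_le1 mulNr oppr_le0 mulr_ge0// ltW.
have a'0 : 0 < a - e by rewrite subr_gt0.
have vb s' : chain_valid (a - e) n s' -> `|value s'| <= M by exact: vM.
have Ke0 : 0 <= K * e by rewrite mulr_ge0// ltW.
have sup0 s' : chain_valid (a - e) n s' -> 0 <= chain_super c0 M (K * e) h sg s'.
  move=> vs'; rewrite /chain_super mulrDr addrA addr_ge0//; last first.
    by rewrite mulr_ge0 ?exprn_ge0 ?(ltW eh0)// mulr_ge0// chain_weight_ge0.
  have A1 : `|expR (- lam * h) ^+ s'.1.2 * (sg * value s')| <= 1 * (1 * M).
    rewrite !normrM sg1 normrX (gtr0_norm eh0); apply: ler_pM => //.
    - by apply: exprn_ile1 => //; exact: ltW.
    - by rewrite ler_wpM2l// vb.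
  move: A1; rewrite ler_norml !mul1r => /andP[A1 _]; lra.
split; first exact: sup0.
case: s vs => [[[|j] i] [x [l m]]] vs.
  rewrite (_ : (fun r => _) = cst (chain_super c0 M (K * e) h sg (0%N, i, (x, (l, m))))%:E)//.
  by rewrite integral_cst//= /normal_prob integral_normal_pdf mule1.
have [jn xl lm lxa] := vs.
have [P [N PN]] := chain_value_ext_exp j x l m.
set q := expR (- lam * h) ^+ i.+1.
have q0 : 0 <= q by rewrite exprn_ge0// ltW.
(* The dominating function of [r]: the constant terms, the two harmonic exponentials, the
   exponential of the weight and the two tail exponentials. *)
pose A := [:: (M + q * (K * e) * (c0 + 2 * j.+1%:R), 0);
  (q * sg * P * expR (bp * (mu * h)), bp * sigma);
  (q * sg * N * expR (bm * (mu * h)), bm * sigma);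
  (q * (K * e) * expR (x - l) * expR (mu * h), sigma);
  (q * (K * expR (- t * e)) * expR (u * (mu * h)), u * sigma);
  (q * (K * expR (- t * e)) * expR (- u * (mu * h)), - u * sigma)].
have mstep : measurable_fun setT (fun r => chain_super c0 M (K * e) h sg
     (chain_step (a - e) (j.+1, i, (x, (l, m))) (mu * h + sigma * r))).
  apply: (measurableT_comp (f := chain_super c0 M (K * e) h sg)).
    exact: measurable_chain_super.
  apply: (measurableT_comp (f := fun p : chain_state * R => chain_step (a - e) p.1 p.2)
    (g := fun r => ((j.+1, i, (x, (l, m))), mu * h + sigma * r))).
    exact: measurable_chain_step.
  apply: measurable_fun_pair; first exact: measurable_cst.
  by apply: measurable_funD; [exact: measurable_cst|exact: measurable_funM].
apply: le_trans (integral_le_expR_normal h0 (A := A) mstep _ _) _.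
- by move=> r; apply: sup0; exact: chain_step_valid.
- move=> r; set z := mu * h + sigma * r.
  have hv := HK e t j i x l m z e0 e1 (ltW ea) t0 vs.
  have hw := @chain_weight_step (a - e) c0 j i x l m z a'0 xl.
  set s' := chain_step _ _ _ in hv hw *.
  have ->: chain_super c0 M (K * e) h sg s' =
      M + q * (sg * value s' + K * e * chain_weight c0 s').
    by rewrite /chain_super /q /s' /chain_step; case: ifP.
  rewrite /A !big_cons big_nil /= mul0r expR0 mulr1 addr0.
  have ez v : expR (v * (mu * h)) * expR (v * sigma * r) = expR (v * z).
    by rewrite -expRD /z; congr expR; ring.
  have ez1 : expR (mu * h) * expR (sigma * r) = expR z by rewrite -expRD.
  set o := Num.max 0 _ + _ in hv hw.
  have hv' : sg * value s' <= sg * (P * expR (bp * z) + N * expR (bm * z)) +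
     (K * e * o + K * expR (- t * e) * (expR (u * z) + expR (- u * z))).
    rewrite -PN -lerBlDl -mulrBr; apply: le_trans (ler_norm _) _.
    by rewrite normrM sg1 mul1r.
  have := lerD hv' (ler_wpM2l Ke0 hw) => /(ler_wpM2l q0); rewrite -(lerD2l M).
  move=> H; apply: le_trans H _; rewrite le_eqVlt; apply/orP; left; apply/eqP.
  rewrite -(ez bp) -(ez bm) -(ez u) -(ez (- u)) -ez1.
  clear.
  move: (expR (bp * (mu * h))) (expR (bp * sigma * r)) (expR (bm * (mu * h)))
    (expR (bm * sigma * r)) (expR (u * (mu * h))) (expR (u * sigma * r))
    (expR (- u * (mu * h))) (expR (- u * sigma * r)) (expR (mu * h))
    (expR (sigma * r)) (expR (- t * e)) (expR (x - l)) (c0 + 2 * j.+1%:R).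
  clearbody q o => *; ring.
rewrite lee_fin /A !big_cons big_nil /= expr0n/= !mul0r expR0 mulr1 addr0.
have ev v : expR (v * (mu * h)) * expR ((v * sigma) ^+ 2 * h / 2) =
    expR ((mu * v + sigma ^+ 2 * v ^+ 2 / 2) * h).
  by rewrite -expRD; congr expR; ring.
have ev1 : expR (mu * h) * expR (sigma ^+ 2 * h / 2) = expR (cc * h).
  by rewrite -expRD /cc; congr expR; ring.
rewrite [X in X <= _](_ : _ = M + q * (K * e) * (c0 + 2 * j.+1%:R) +
   (q * sg * (P * (expR (bp * (mu * h)) * expR ((bp * sigma) ^+ 2 * h / 2)) +
    N * (expR (bm * (mu * h)) * expR ((bm * sigma) ^+ 2 * h / 2))) +
   q * (K * e) * expR (x - l) * (expR (mu * h) * expR (sigma ^+ 2 * h / 2)) +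
   q * (K * expR (- t * e)) * (expR (u * (mu * h)) * expR ((u * sigma) ^+ 2 * h / 2) +
     expR (- u * (mu * h)) * expR ((- u * sigma) ^+ 2 * h / 2)))); last first.
  move: (expR (bp * (mu * h))) (expR ((bp * sigma) ^+ 2 * h / 2)) (expR (bm * (mu * h)))
    (expR ((bm * sigma) ^+ 2 * h / 2)) (expR (u * (mu * h))) (expR ((u * sigma) ^+ 2 * h / 2))
    (expR (- u * (mu * h))) (expR ((- u * sigma) ^+ 2 * h / 2)) (expR (mu * h))
    (expR (sigma ^+ 2 * h / 2)) (expR (- t * e)) (expR (x - l)) (c0 + 2 * j.+1%:R).
  by clearbody q => *; ring.
rewrite (ev bp) (ev bm) (ev u) (ev (- u)) ev1 bpE bmE.
have vE : value (j.+1, i, (x, (l, m))) = P + N.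
  by have := PN 0; rewrite addr0 !mulr0 expR0 !mulr1.
have qE : q * expR (lam * h) = expR (- lam * h) ^+ i.
  by rewrite /q exprSr -mulrA -expRD mulNr addNr expR0 mulr1.
have -> : chain_super c0 M (K * e) h sg (j.+1, i, (x, (l, m))) =
    M + q * expR (lam * h) * (sg * (P + N) + K * e * (c0 + 2 * j.+1%:R + expR (x - l))).
  by rewrite qE -vE.
have := weight_discount h0 h1 (d := x - l) _ (c0 := c0); rewrite subr_le0 -/cc => /(_ xl).
rewrite c0lam => /(_ (lexx _) c00) hd.
have hj : 2 * j.+1%:R <= expR (lam * h) * (2 * j.+1%:R) :> R.
  by rewrite ler_peMl ?mulr_ge0// -expR0 ler_expR mulr_ge0// ltW.
have := lerD hd hj => /(ler_wpM2l Ke0) /(ler_wpM2l q0) H1.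
have := ler_wpM2l K0 tail => /(ler_wpM2l q0) H2.
move: H1 H2; rewrite (_ : mu * - u + sigma ^+ 2 * (- u) ^+ 2 / 2 =
  - mu * u + sigma ^+ 2 * u ^+ 2 / 2); last by ring.
move: (expR ((mu * u + sigma ^+ 2 * u ^+ 2 / 2) * h))
  (expR ((- mu * u + sigma ^+ 2 * u ^+ 2 / 2) * h)) (expR (lam * h))
  (expR (x - l)) (expR (cc * h)) (expR (- t * e)) (2 * j.+1%:R) => T1 T2 E D F X Y.
clearbody q.
move=> H1 H2; lra.
Qed.

End superharmonic.

(** * Independent innovations *)

Section independence.
Context {R : realType} {d d1 d2 : measure_display} {T : measurableType d}
  {E : measurableType d1} {V : measurableType d2} (P : probability T R).
Local Open Scope ereal_scope.

Lemma measure_eq_rectangle (m1 m2 : {measure set (E * V) -> \bar R}) :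
  m1 setT < +oo ->
  (forall A B, measurable A -> measurable B -> m1 (A `*` B) = m2 (A `*` B)) ->
  forall X, measurable X -> m1 X = m2 X.
Proof.
move=> m1oo m12; pose C : set (set (E * V)) :=
  [set C | exists A, measurable A /\ exists B, measurable B /\ C = A `*` B].
have CI : setI_closed C.
  move=> /= _ _ [X1 [mX1 [X2 [mX2 ->]]]] [Y1 [mY1 [Y2 [mY2 ->]]]].
  rewrite -setXI; exists (X1 `&` Y1); split; first exact: measurableI.
  by exists (X2 `&` Y2); split => //; exact: measurableI.
move=> X mX; apply: (measure_unique C (fun _ => setT)) => //.
- rewrite measurable_prod_measurableType //; congr (<<s _ >>).
  rewrite predeqE; split => [[A mA [B mB <-]]|[A [mA [B [mB ->]]]]].
    by exists A; split => //; exists B.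
  by exists A => //; exists B.
- by move=> _; exists setT; split => //; exists setT; split => //; rewrite setXTT.
- by apply/seteqP; split => // x _; exists 0%N.
- by move=> _ [A [mA [B [mB ->]]]]; exact: m12.
Qed.

(** With [B = setT] the hypothesis says that [X] has law [nu]. The pair then has a product law, and
    Tonelli's theorem applies. *)
Lemma ge0_integral_indep (nu : probability V R) (Z : T -> E) (X : T -> V)
    (F : E * V -> \bar R) :
  measurable_fun setT Z -> measurable_fun setT X ->
  (forall B C, measurable B -> measurable C ->
    P (Z @^-1` B `&` X @^-1` C) = P (Z @^-1` B) * nu C) ->
  measurable_fun setT F -> (forall p, 0 <= F p) ->
  \int[P]_w F (Z w, X w) = \int[P]_w \int[nu]_r F (Z w, r).
Proof.
move=> mZ mX ind mF F0.
pose Z' : {RV P >-> E} := HB.pack Z (isMeasurableFun.Build _ _ _ _ _ mZ).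
have mZX : measurable_fun setT (fun w => (Z w, X w)) by exact: measurable_fun_pair.
pose ZX : {RV P >-> (E * V)%type} :=
  HB.pack (fun w => (Z w, X w)) (isMeasurableFun.Build _ _ _ _ _ mZX).
rewrite -(ge0_integral_distribution ZX mF F0).
rewrite (eq_measure_integral (distribution P Z' \x nu)); last first.
  move=> A mA _; apply/esym; apply: product_measure_unique => //.
rewrite (@fubini_tonelli1 _ _ E V R (distribution P Z') nu F mF F0).
rewrite (ge0_integral_distribution Z' (f := fubini_F nu F))//.
- exact: measurable_fun_fubini_tonelli_F.
- by move=> y; exact: integral_ge0.
Qed.

End independence.

Section markov_chain.
Context {R : realType} {d d1 d2 : measure_display} {T : measurableType d}
  {E : measurableType d1} {V : measurableType d2} (P : probability T R).
Variables (nu : probability V R) (xi : nat -> T -> V) (Phi : E -> V -> E) (s0 : E).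
Hypothesis mxi : forall j, measurable_fun setT (xi j).
Hypothesis xi_indep : forall N (B : nat -> set V), (forall i, measurable (B i)) ->
  P (\bigcap_(i in [set i | (i < N)%N]) xi i @^-1` B i) = (\prod_(i < N) nu (B i))%E.
Hypothesis mPhi : measurable_fun setT (fun p : E * V => Phi p.1 p.2).

Fixpoint driven_chain (N : nat) (w : T) : E :=
  if N is N'.+1 then Phi (driven_chain N' w) (xi N' w) else s0.

Lemma measurable_driven_chain N : measurable_fun setT (driven_chain N).
Proof.
elim: N => [|N IH] /=; first exact: measurable_cst.
apply: (measurableT_comp (f := fun p : E * V => Phi p.1 p.2)
  (g := fun w => (driven_chain N w, xi N w))) => //.
exact: measurable_fun_pair.
Qed.

Let future j N (C : nat -> set V) :=
  \bigcap_(i in [set i | (j <= i < N)%N]) xi i @^-1` C i.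

Let mfuture j N C : (forall i, measurable (C i)) -> measurable (future j N C).
Proof.
move=> mC; apply: bigcap_measurableType => // i _.
by rewrite -[X in measurable X]setTI; exact: mxi.
Qed.

(** The induction keeps all later innovations in the event. The state at [j + 1] is a function of
    the state at [j] and of [xi j]; on a rectangle in these two, the condition on [xi j] joins the
    future event and the induction hypothesis applies. *)
Lemma driven_chain_indep j : forall N (B : set E) (C : nat -> set V),
  (j <= N)%N -> measurable B -> (forall i, measurable (C i)) ->
  (P (driven_chain j @^-1` B `&` future j N C) =
   P (driven_chain j @^-1` B) * \prod_(j <= i < N) nu (C i))%E.
Proof.
elim: j => [|j IH] N B C jN mB mC.
  have -> : future 0 N C = \bigcap_(i in [set i | (i < N)%N]) xi i @^-1` C i by [].
  have [Bs|Bs] := pselect (B s0).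
    have -> : driven_chain 0 @^-1` B = setT by apply/seteqP; split.
    by rewrite setTI probability_setT mul1e xi_indep// big_mkord.
  have -> : driven_chain 0 @^-1` B = set0 by apply/seteqP; split.
  by rewrite set0I measure0 mul0e.
have mA := mfuture j.+1 N mC; set A := future _ _ _ in mA *.
have PA : P A = (\prod_(j.+1 <= i < N) nu (C i))%E.
  (* Without a condition on [xi j], the induction hypothesis gives the probability of the later
     event alone. *)
  pose C' i := if i == j then setT else C i.
  have mC' i : measurable (C' i) by rewrite /C'; case: ifP.
  have := IH N setT C' (ltnW jN) measurableT mC'.
  rewrite preimage_setT setTI probability_setT mul1e big_ltn//.
  have -> : nu (C' j) = 1%E by rewrite /C' eqxx probability_setT.
  rewrite mul1e.
  rewrite (eq_big_nat _ _ (F2 := fun i => nu (C i))).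
    move=> <-; congr (P _); apply/seteqP; split => w /= h i /= /andP[ji iN].
      rewrite /C'; case: eqP => // /eqP ij; apply: h => /=.
      by rewrite iN andbT ltn_neqAle eq_sym ij.
    have := h i; rewrite /= (ltnW ji) iN => /(_ isT).
    by rewrite /C' gtn_eqF.
  by move=> i /andP[ji _]; rewrite /C' gtn_eqF.
have PAfin : (0 <= fine (P A))%R by rewrite fine_ge0.
have PAE : P A = (fine (P A))%:E by rewrite fineK// fin_num_measure.
pose ZX w := (driven_chain j w, xi j w).
have mZX : measurable_fun setT ZX.
  by apply: measurable_fun_pair => //; exact: measurable_driven_chain.
(* Two measures for the pair of state and innovation: its law restricted to the future event, and
   its law scaled by the probability of that event. Equality on rectangles carries over to the
   preimage of [B] under [Phi]. *)
pose m1 : {measure set (E * V) -> \bar R} := pushforward (mrestr P mA) ZX.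
pose m2 : {measure set (E * V) -> \bar R} := mscale (NngNum PAfin) (pushforward P ZX).
have mPhiB : measurable ((fun p : E * V => Phi p.1 p.2) @^-1` B).
  by rewrite -[X in measurable X]setTI; exact: mPhi.
have M1 D : m1 mZX D = P (ZX @^-1` D `&` A) by [].
have M2 D : m2 mZX D = (P A * P (ZX @^-1` D))%E by rewrite [in RHS]PAE.
suff H : m1 mZX ((fun p : E * V => Phi p.1 p.2) @^-1` B) =
         m2 mZX ((fun p : E * V => Phi p.1 p.2) @^-1` B).
  by move: H; rewrite M1 M2 muleC PA.
apply: measure_eq_rectangle => //.
  rewrite M1; apply: le_lt_trans (probability_le1 P _) _; last by rewrite ltry.
  by rewrite preimage_setT setTI.
move=> X Y mX mY; rewrite M1 M2.
pose C' i := if i == j then Y else C i.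
have mC' i : measurable (C' i) by rewrite /C'; case: ifP.
have H1 := IH N X C' (ltnW jN) mX mC'.
have H2 := IH j.+1 X C' (leqnSn j) mX mC'.
have E1 : ZX @^-1` (X `*` Y) `&` A = driven_chain j @^-1` X `&` future j N C'.
  apply/seteqP; split => w.
    move=> [[/= hX hY] hA]; split => // i /= /andP[ji iN]; rewrite /C'.
    case: eqP => [->//|/eqP ij]; apply: hA => /=.
    by rewrite iN andbT ltn_neqAle eq_sym ij.
  move=> [/= hX hA]; split.
    split => //=; have := hA j; rewrite /= leqnn jN => /(_ isT).
    by rewrite /C' eqxx.
  move=> i /= /andP[ji iN]; have := hA i; rewrite /= (ltnW ji) iN => /(_ isT).
  by rewrite /C' gtn_eqF.
have E2 : ZX @^-1` (X `*` Y) = driven_chain j @^-1` X `&` future j j.+1 C'.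
  apply/seteqP; split => w.
    move=> [/= hX hY]; split => // i /= /andP[ji ij].
    have -> : i = j by apply/eqP; rewrite eqn_leq ji andbT -ltnS.
    by rewrite /C' eqxx.
  move=> [/= hX hA]; split => //=.
  by have := hA j; rewrite /= leqnn ltnSn => /(_ isT); rewrite /C' eqxx.
rewrite E1 E2 H1 H2 big_ltn// big_nat1 PA.
rewrite [RHS]muleC -muleA; congr (_ * (_ * _))%E.
by apply: eq_big_nat => i /andP[ji _]; rewrite /C' gtn_eqF.
Qed.

(** [I] is a set of states that the chain never leaves; positivity and superharmonicity are
    available only there. *)
Lemma driven_chain_supermartingale (I : E -> Prop) (F : E -> R) N :
  measurable_fun setT F -> I s0 -> (forall s v, I s -> I (Phi s v)) ->
  (forall s, I s -> 0 <= F s) ->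
  (forall s, I s -> (\int[nu]_v (F (Phi s v))%:E <= (F s)%:E)%E) ->
  (\int[P]_w (F (driven_chain N w))%:E <= (F s0)%:E)%E.
Proof.
move=> mF Is0 IPhi F0 FPhi.
have IN n w : I (driven_chain n w) by elim: n => //= n IH; exact: IPhi.
elim: N => [|N IH].
  by rewrite /= integral_cst//= probability_setT mule1.
(* [F'] is nonnegative off [I] as well, as Tonelli's theorem requires, and equals [F] along the
   chain. *)
apply: le_trans IH; pose F' s := Num.max 0 (F s).
have mF' : measurable_fun setT F' by exact: measurable_maxr.
have FE s : I s -> F' s = F s by move=> /F0 h; rewrite /F' max_r.
have F'0 s : 0 <= F' s by rewrite /F' le_max lexx.
have mFN : measurable_fun setT (fun w => F (driven_chain N w)).
  exact: (measurableT_comp mF (measurable_driven_chain N)).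
pose G (p : E * V) := (F' (Phi p.1 p.2))%:E.
have mG : measurable_fun setT G.
  apply/measurable_EFinP.
  exact: (measurableT_comp (f := F') (g := fun p : E * V => Phi p.1 p.2)).
have -> : (\int[P]_w (F (driven_chain N.+1 w))%:E =
    \int[P]_w G (driven_chain N w, xi N w))%E.
  by apply: eq_integral => w _ /=; rewrite /G /= FE//; exact: IPhi.
rewrite (ge0_integral_indep (nu := nu) (Z := driven_chain N) (X := xi N) (F := G))//=.
- apply: ge0_le_integral => //=.
  + by move=> w _; apply: integral_ge0 => r _; rewrite lee_fin.
  + apply: (measurableT_comp (f := fubini_F nu G)).
      by apply: measurable_fun_fubini_tonelli_F => // p; rewrite lee_fin.
    exact: measurable_driven_chain.
  + by apply/measurable_EFinP.
  + move=> w _; apply: le_trans (FPhi _ (IN N w)); rewrite le_eqVlt; apply/orP; left.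
    by apply/eqP/eq_integral => v _; rewrite /G /= FE//; exact: IPhi.
- exact: measurable_driven_chain.
- move=> B C mB mC.
  have := @driven_chain_indep N N.+1 B (fun _ => C) (leqnSn N) mB (fun _ => mC).
  rewrite big_nat1 => <-; congr (P _); apply/seteqP; split => w [hB hC]; split => //.
    move=> i /= /andP[ji ij].
    by have -> : i = N by apply/eqP; rewrite eqn_leq ji andbT -ltnS.
  by apply: (hC N); rewrite /= leqnn ltnSn.
- by move=> p; rewrite lee_fin.
Qed.

End markov_chain.

(** * Drawdowns of continuous paths *)

Section continuous_paths.
Context {R : realType}.
Variable f : R -> R.
Hypothesis cf : continuous f.

(** On the compact set of pairs with [e <= |f s - f t|] the distance [|s - t|] attains a positive
    minimum; half of it serves as [d]. *)
Lemma continuous_segment_unif (L e : R) : 0 < e ->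
  exists2 d, 0 < d & forall s t, 0 <= s <= L -> 0 <= t <= L -> `|s - t| <= d ->
    `|f s - f t| <= e.
Proof.
move=> e0.
have cfst : continuous (fun p : R * R => f p.1).
  by move=> p; apply: (@continuous_comp _ _ _ fst f); [exact: cvg_fst|exact: cf].
have csnd : continuous (fun p : R * R => f p.2).
  by move=> p; apply: (@continuous_comp _ _ _ snd f); [exact: cvg_snd|exact: cf].
pose g (p : R * R) := `|f p.1 - f p.2|.
have cg : continuous g.
  by move=> p; exact: (cvg_norm (cvgB (cfst p) (csnd p))).
pose A : set (R * R) := (`[0, L] `*` `[0, L]) `&` (g @^-1` `[e, +oo[).
have cA : compact A.
  apply: (@subclosed_compact _ A (`[0, L] `*` `[0, L])).
  - apply: closedI.
      apply: (@closedI _ (fst @^-1` `[0, L]) (snd @^-1` `[0, L])).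
        by apply: preimage_closed => [p _|]; [exact: cvg_fst|exact: interval_closed].
      by apply: preimage_closed => [p _|]; [exact: cvg_snd|exact: interval_closed].
    by apply: preimage_closed => [p _|]; [exact: cg|exact: interval_closed].
  - by apply: compact_setX; exact: segment_compact.
  - by move=> p [].
have [A0|/set0P/negP/negPn/eqP A0] := pselect (A !=set0); last first.
  exists 1 => // s t s0 t0 _; rewrite leNgt; apply/negP => est.
  suff : A (s, t) by rewrite A0.
  by split; [split; rewrite /= in_itv|rewrite /= in_itv/= andbT ltW].
have ch : continuous (fun p : R * R => - `|p.1 - p.2|).
  by move=> p; exact: (cvgN (cvg_norm (cvgB cvg_fst cvg_snd))).
have [c cA' cmax] := compact_EVT_max A0 cA (continuous_subspaceT ch).
have [_ /=] := set_mem cA'; rewrite /g in_itv/= andbT => ec.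
exists (`|c.1 - c.2| / 2).
  rewrite divr_gt0// normr_gt0 subr_eq0; apply/eqP => c12.
  by move: ec; rewrite c12 subrr normr0 leNgt e0.
move=> s t s0 t0 st; rewrite leNgt; apply/negP => est.
have : (s, t) \in A.
  by rewrite inE; split; [split; rewrite /= in_itv|rewrite /= in_itv/= andbT ltW].
move=> /cmax/=; rewrite lerN2 => h.
have : 0 < `|c.1 - c.2|.
  rewrite normr_gt0 subr_eq0; apply/eqP => c12.
  by move: ec; rewrite c12 subrr normr0 leNgt e0.
lra.
Qed.

(** The drop attains its maximum on a compact square, where [Num.min p.1 p.2] encodes the constraint
    [u <= t]. *)
Lemma drawdown_gap (s L a : R) : s <= L ->
  (forall u t, s <= u -> u <= t -> t <= L -> f u - f t < a) ->
  exists2 k, 0 < k & forall u t, s <= u -> u <= t -> t <= L -> f u - f t <= a - k.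
Proof.
move=> sL h.
have cfst : continuous (fun p : R * R => f (Num.min p.1 p.2)).
  move=> p; apply: (@continuous_comp _ _ _ (fun p : R * R => Num.min p.1 p.2) f).
    by apply: continuous_min; [exact: cvg_fst|exact: cvg_snd].
  exact: cf.
have csnd : continuous (fun p : R * R => f p.2).
  by move=> p; apply: (@continuous_comp _ _ _ snd f); [exact: cvg_snd|exact: cf].
have cg : continuous (fun p : R * R => f (Num.min p.1 p.2) - f p.2).
  by move=> p; exact: (cvgB (cfst p) (csnd p)).
have A0 : `[s, L]%classic `*` `[s, L]%classic !=set0.
  by exists (s, s); split; rewrite /= in_itv/= lexx.
have cA : compact (`[s, L]%classic `*` `[s, L]%classic).
  by apply: compact_setX; exact: segment_compact.
have [[u0 t0] cA' cmax] := compact_EVT_max A0 cA (continuous_subspaceT cg).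
have [/= + +] := set_mem cA'; rewrite !in_itv/= => /andP[su uL] /andP[st tL].
exists (a - (f (Num.min u0 t0) - f t0)).
  by rewrite subr_gt0 h ?le_min ?su// ge_min lexx orbT.
move=> u t su' ut tL'; have : (u, t) \in `[s, L]%classic `*` `[s, L]%classic.
  rewrite inE; split; rewrite /= in_itv/= ?su' ?tL' ?andbT/=.
    exact: le_trans ut tL'.
  exact: le_trans su' ut.
by move=> /cmax/=; rewrite (min_l ut); lra.
Qed.

Lemma running_sup_attained (s t : R) : s <= t ->
  exists2 u, s <= u <= t & running_sup f s t = f u /\
    forall v, s <= v <= t -> f v <= f u.
Proof.
move=> st; have [u + umax] := EVT_max st (continuous_subspaceT cf).
rewrite in_itv/= => sut; exists u => //.
have um v : s <= v <= t -> f v <= f u by move=> h; apply: umax; rewrite in_itv.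
split => //; rewrite /running_sup; apply/eqP; rewrite eq_le; apply/andP; split.
  apply: ge_sup; first by exists (f u), u => //=; rewrite in_itv.
  by move=> _ [v /= + <-]; rewrite in_itv/= => /um.
apply: ub_le_sup; last by exists u => //=; rewrite in_itv.
by exists (f u) => _ [v /= + <-]; rewrite in_itv/= => /um.
Qed.

Variable a : R.
Hypothesis a0 : 0 < a.
Local Notation tau := (drawdown_time a f).

Lemma drawdown_timeS k : tau k.+1 =
  ereal_inf [set t%:E | t in [set t : R | (tau k < t%:E)%E /\
    a <= running_sup f (fine (tau k)) t - f t]].
Proof. by []. Qed.

Lemma drawdown_time_le k : (tau k <= tau k.+1)%E.
Proof.
by rewrite drawdown_timeS; apply: le_ereal_inf_tmp => _ [t [h _] <-]; exact: ltW.
Qed.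

Lemma drawdown_time_ge0 k : (0 <= tau k)%E.
Proof. by elim: k => // k /le_trans; apply; exact: drawdown_time_le. Qed.

Lemma drawdown_time_fin k t : (tau k <= t%:E)%E -> tau k = (fine (tau k))%:E.
Proof.
move=> kt; rewrite fineK// ge0_fin_numE ?drawdown_time_ge0//.
exact: le_lt_trans kt (ltry _).
Qed.

Lemma drawdown_lt k s u t : tau k = s%:E -> (t%:E < tau k.+1)%E ->
  s <= u -> u <= t -> f u - f t < a.
Proof.
move=> ks tk su ut; rewrite ltNge; apply/negP => aut.
(* The infimum ranges over times strictly after [s]; at [t = s] the drop would be 0. *)
have st : s < t.
  rewrite lt_neqAle (le_trans su ut) andbT; apply/eqP => st.
  have : u = t by apply/eqP; rewrite eq_le ut -st su.
  by move=> ut'; move: aut; rewrite ut' subrr leNgt a0.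
move: tk; rewrite drawdown_timeS ltNge => /negP; apply; apply: ereal_inf_lbound.
exists t => //; split; first by rewrite ks lte_fin.
rewrite ks /=; apply: le_trans aut _; rewrite lerB//.
by have [v _ [-> ]] := running_sup_attained (ltW st); apply; rewrite su.
Qed.

(** If every drop ending at [T] were less than [a], continuity would keep the drops below [a] just
    after [T], against the definition of the infimum. *)
Lemma drawdown_attained k T : tau k.+1 = T%:E ->
  exists s u, [/\ tau k = s%:E, s <= u, u <= T & a <= f u - f T].
Proof.
move=> kT; have /drawdown_time_fin : (tau k <= T%:E)%E by rewrite -kT drawdown_time_le.
set s := fine _ => ks.
have sT : s <= T by rewrite -lee_fin -ks -kT drawdown_time_le.
have [u /andP[su uT] [_ umax]] := running_sup_attained sT.
exists s, u; split => //; rewrite leNgt; apply/negP => uTa.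
(* Half of the missing drop handles maxima reached up to [T]; [a / 3] handles those reached between
   [T] and [t], where [f] varies by less than [2 * e]. *)
pose e := Num.min ((a - (f u - f T)) / 2) (a / 3).
have e0 : 0 < e by rewrite lt_min !divr_gt0// subr_gt0.
have cfT : f x @[x --> T] --> f T by exact: cf.
have /(_ _ e e0) := (@cvgrPdist_lt _ R^o _ _ _ f (f T)).1 cfT.
move=> /nbhs_ballP[d /= d0 hd].
have : (tau k.+1 < (T + d)%:E)%E by rewrite kT lte_fin ltrDl.
rewrite drawdown_timeS => /ereal_inf_lt[_ [t [kt atk] <-]]; rewrite lte_fin => tTd.
have Tt : T <= t.
  by rewrite -lee_fin -kT drawdown_timeS; apply: ereal_inf_lbound; exists t.
move: kt atk; rewrite ks lte_fin => st /=.
have [v /andP[sv vt] [-> _]] := running_sup_attained (ltW st).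
have near w : T <= w <= t -> `|f T - f w| < e.
  move=> /andP[Tw wt]; apply: hd; rewrite /ball/= distrC ger0_norm ?subr_ge0//.
  by rewrite ltrBlDl (le_lt_trans wt).
have e1 : e <= (a - (f u - f T)) / 2 by rewrite ge_min lexx.
have e2 : e <= a / 3 by rewrite ge_min lexx orbT.
have ht : `|f T - f t| < e by apply: near; rewrite Tt lexx.
have := ler_norm (f T - f t); have a0' := a0.
have [vT|Tv] := leP v T.
  by have := umax v; rewrite sv vT => /(_ isT); lra.
have hv : `|f T - f v| < e by apply: near; rewrite (ltW Tv) vt.
have := ler_norm (f v - f T); rewrite distrC; lra.
Qed.

End continuous_paths.

(** * The chain along a fixed path *)

Section path_chain.
Context {R : realType}.
Variables (f : R -> R) (n : nat) (a' h : R).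
Hypotheses (f0 : f 0 = 0) (a'0 : 0 < a').

Fixpoint path_chain (N : nat) : @chain_state R :=
  if N is N'.+1 then
    chain_step a' (path_chain N') (f (N'.+1%:R * h) - f (N'%:R * h))
  else ((n, 0%N), (0, (0, 0))).

Definition phase N := (path_chain N).1.1.

Lemma phaseS N : phase N.+1 = phase N \/ phase N = (phase N.+1).+1.
Proof.
rewrite /phase /=; case: (path_chain N) => [[[|j] i] [x [l m]]]/=; first by left.
by case: ifP => _; [right|left].
Qed.

Lemma phase_noninc N M : (N <= M)%N -> (phase M <= phase N)%N.
Proof.
move=> /subnK <-; elim: (M - N)%N => // k IH; rewrite addSn.
by apply: leq_trans IH; have [->|->] := phaseS (k + N).
Qed.

Lemma path_chain_valid N : chain_valid a' n (path_chain N).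
Proof.
elim: N => [|N IH] /=; first by split => //; rewrite subrr.
exact: chain_step_valid.
Qed.

(** The invariant is stated at the counter [i], which equals [N] while drawdowns remain and then
    stays at the index where the last one was declared. *)
Lemma path_chain_inv N : let: ((j, i), (x, (l, m))) := path_chain N in
  [/\ [/\ (i <= N)%N, x = f (i%:R * h), (0 < j)%N -> i = N & phase i = j],
   (exists2 u, (u <= i)%N & l = f (u%:R * h) /\ phase u = j),
   (forall u, (u <= i)%N -> phase u = j -> f (u%:R * h) <= l),
   (exists2 u, (u <= i)%N & m = f (u%:R * h)) &
   (forall u, (u <= i)%N -> f (u%:R * h) <= m) /\
   (forall u, (u < i)%N -> (0 < phase u)%N)].
Proof.
elim: N => [|N].
  rewrite /=; split => //.
  - by rewrite mul0r f0.
  - by exists 0%N => //; rewrite mul0r f0.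
  - by move=> u; rewrite leqn0 => /eqP -> _; rewrite mul0r f0.
  - by exists 0%N => //; rewrite mul0r f0.
  - by split => // u; rewrite leqn0 => /eqP ->; rewrite mul0r f0.
have phN : phase N = (path_chain N).1.1 by [].
have phS : phase N.+1 = (path_chain N.+1).1.1 by [].
move: phN phS; rewrite /=.
case: (path_chain N) => [[[|j] i] [x [l m]]] /= phN phS.
  by move=> [[iN -> ij phi] H1 H2 H3 [H4 H5]]; split => //; split => //; exact: leqW.
move=> [[iN xE ij phi] [u ui [lE phu]] H2 [v vi mE] [H4 H5]].
have {}ij := ij isT; rewrite ij {iN i ij} in xE phi ui H2 vi H4 H5 phS *.
have -> : x + (f (N.+1%:R * h) - f (N%:R * h)) = f (N.+1%:R * h) by rewrite xE; ring.
have xxE : x + (f (N.+1%:R * h) - f (N%:R * h)) = f (N.+1%:R * h) by rewrite xE; ring.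
rewrite xxE in phS.
set y := f (N.+1%:R * h) in phS *.
have m1 : exists2 u, (u <= N.+1)%N & Num.max m y = f (u%:R * h).
  case: (leP m y) => _; first by exists N.+1.
  by exists v => //; exact: leqW.
have m2 : forall u, (u <= N.+1)%N -> f (u%:R * h) <= Num.max m y.
  move=> w; rewrite leq_eqVlt => /predU1P[->|wN]; first by rewrite le_max lexx orbT.
  by rewrite le_max H4.
have HP : forall w, (w < N.+1)%N -> (0 < phase w)%N.
  by move=> w; rewrite ltnS => wN; apply: leq_trans (phase_noninc wN); rewrite phN.
move: phS; case: ifPn => ph /= phS.
  split => //.
  - by exists N.+1.
  - move=> w; rewrite leq_eqVlt => /predU1P[->|wN]; first by rewrite lexx.
    move=> pw; have := phase_noninc (wN : (w <= N)%N); rewrite phN pw.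
    by rewrite ltnn.
split => //.
- case: (leP l y) => _; first by exists N.+1.
  by exists u => //; exact: leqW.
- move=> w; rewrite leq_eqVlt => /predU1P[-> _|wN pw]; first by rewrite le_max lexx orbT.
  by rewrite le_max H2.
Qed.

(** This trades the maximum stored in the state for a drop of [f] between two grid points of the
    same phase, a form that can be compared with the drawdown times. *)
Lemma phase_step N : (0 < phase N)%N ->
  (exists2 u, (u <= N)%N & phase u = phase N /\
     ((phase N.+1 < phase N)%N -> a' <= f (u%:R * h) - f (N.+1%:R * h))) /\
  (forall u, (u <= N)%N -> phase u = phase N ->
     a' <= f (u%:R * h) - f (N.+1%:R * h) -> (phase N.+1 < phase N)%N).
Proof.
have phN : phase N = (path_chain N).1.1 by [].
have phS : phase N.+1 = (path_chain N.+1).1.1 by [].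
move: phN phS (path_chain_inv N) => /=.
case: (path_chain N) => [[[|j] i] [x [l m]]] phN phS /=; first by rewrite phN.
move=> [[iN xE ij phi] [u ui [lE phu]] H2 [v vi mE] [H4 H5]] _.
have {}ij := ij isT; rewrite ij {iN i ij} in xE phi ui H2 vi H4 H5 phS phN *.
have xxE : x + (f (N.+1%:R * h) - f (N%:R * h)) = f (N.+1%:R * h) by rewrite xE; ring.
move: phS; rewrite /= xxE => phS; split.
  exists u => //; split; first by rewrite phu phN.
  move: phS; case: ifPn => [ph /= phS _|_ /= ->]; last by rewrite phN ltnn.
  move: ph; case: (leP l (f (N.+1%:R * h))) => [ly|ly]; last by rewrite lE.
  by rewrite subrr leNgt a'0.
move=> w wN pw aw; move: phS; case: ifPn => [ph /= -> |]; first by rewrite phN.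
rewrite -ltNge => H; exfalso; move: H; apply/negP; rewrite -leNgt.
apply: le_trans aw _; rewrite lerB// le_max H2 ?orTb//.
by rewrite pw phN.
Qed.

End path_chain.

Section chain_times.
Context {R : realType}.
Variables (f : R -> R) (a : R).
Hypotheses (cf : continuous f) (f0 : f 0 = 0) (a0 : 0 < a).
Local Notation tau := (drawdown_time a f).

(** No drawdown is declared too early, uniformly in the mesh. Between [tau k] and [L] every drop
    misses [a] by a margin [c]. By induction, grid points of the current phase precede [tau k] by
    less than [d]; moving them to [tau k] and allowing for the slack costs less than [c]. *)
Lemma phase_lower n k (L : R) : (k <= n)%N -> (L%:E < tau k)%E ->
  exists2 e0, 0 < e0 & forall e h N, 0 < e -> e < e0 -> e < a -> 0 < h ->
    N%:R * h <= L -> (n - k < phase f n (a - e) h N)%N.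
Proof.
elim: k L => [|k IH] L kn Lk.
  exists 1 => // e h N e0 e1 ea h0 NL.
  have := lt_le_trans Lk (lexx _); rewrite /= lte_fin => L0.
  by have := le_lt_trans NL L0; rewrite ltNge mulr_ge0// ltW.
have [Lk'|kL] := ltP L%:E (tau k).
  have [e0 e00 H] := IH L (ltnW kn) Lk'; exists e0 => // e h N e1 e2 ea h0 NL.
  apply: leq_ltn_trans (H e h N e1 e2 ea h0 NL).
  by rewrite leq_sub2l.
have ks := drawdown_time_fin kL; set s := fine _ in ks.
have sL : s <= L by rewrite -lee_fin -ks.
have s0 : 0 <= s by rewrite -lee_fin -ks drawdown_time_ge0.
have [c c0 gap] : exists2 c, 0 < c &
    forall u t, s <= u -> u <= t -> t <= L -> f u - f t <= a - c.
  apply: drawdown_gap => // u t su ut tL.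
  by apply: (drawdown_lt cf a0 ks _ su ut); apply: le_lt_trans Lk; rewrite lee_fin.
(* Two displacements of [f] and the slack each cost at most [c / 4]. *)
have c40 : 0 < c / 4 by rewrite divr_gt0.
have [d d0 unif] := continuous_segment_unif cf L c40.
have [e1 e10 H] : exists2 e1, 0 < e1 & forall e h N, 0 < e -> e < e1 -> e < a -> 0 < h ->
    N%:R * h <= s - d -> (n - k < phase f n (a - e) h N)%N.
  by apply: IH; [exact: ltnW|rewrite ks lte_fin gtrBl].
exists (Num.min e1 (c / 4)) => [|e h N e0]; first by rewrite lt_min e10.
rewrite lt_min => /andP[ee1 ec4] ea h0 NL; rewrite ltnNge; apply/negP => phN.
have a'0 : 0 < a - e by rewrite subr_gt0.
have ex : exists N0, (phase f n (a - e) h N0 <= n - k.+1)%N by exists N.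
have [M phM Mmin] := ex_minnP ex.
have MN : (M <= N)%N by exact: Mmin.
have ML : M%:R * h <= L by apply: le_trans NL; rewrite ler_wpM2r ?ler_nat// ltW.
case: M phM Mmin MN ML => [|M] phM Mmin MN ML.
  have phM' : (n <= n - k.+1)%N := phM.
  by move: kn phM'; clear; lia.
have phM1 : (n - k.+1 < phase f n (a - e) h M)%N.
  by rewrite ltnNge; apply/negP => /Mmin; rewrite ltnn.
have phME : phase f n (a - e) h M = (n - k)%N.
  have := phaseS f n (a - e) h M; move: phM phM1 kn.
  move: (phase _ _ _ _ M.+1) (phase _ _ _ _ M); clear; lia.
have phM0 : (0 < phase f n (a - e) h M)%N by rewrite phME subn_gt0.
have [[u uM [pu drop0]] _] := phase_step f0 a'0 phM0.
rewrite phME in drop0.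
have drop : a - e <= f (u%:R * h) - f (M.+1%:R * h) by apply: drop0; move: phM kn; move: (phase _ _ _ _ _); clear; lia.
have us : s - d < u%:R * h.
  rewrite ltNge; apply/negP => us; have := H e h u e0 ee1 ea h0 us.
  by rewrite pu phME ltnn.
have uML : u%:R * h <= M.+1%:R * h.
  by rewrite ler_wpM2r ?ler_nat ?(ltW h0)// (leq_trans uM).
have u0 : 0 <= u%:R * h by rewrite mulr_ge0// ltW.
(* Times before [s] are moved to [s], so that the margin applies. *)
pose u' := Num.max (u%:R * h) s; pose t' := Num.max (M.+1%:R * h) s.
have uu : `|f u' - f (u%:R * h)| <= c / 4.
  apply: unif; rewrite /u' ?u0 ?(le_trans uML)//.
    by rewrite le_max u0 /= ge_max sL (le_trans uML).
  by case: (leP (u%:R * h) s) => us'; rewrite ?subrr ?normr0 ?(ltW d0)// ger0_norm; lra.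
have tt : `|f t' - f (M.+1%:R * h)| <= c / 4.
  apply: unif; rewrite /t' ?(le_trans u0 uML)//.
    by rewrite le_max (le_trans u0 uML) /= ge_max sL ML.
  by case: (leP (M.+1%:R * h) s) => us'; rewrite ?subrr ?normr0 ?(ltW d0)// ger0_norm; lra.
have := gap u' t'; rewrite le_max lexx orbT => /(_ isT).
rewrite ge_max !le_max uML lexx orbT/= => /(_ isT).
rewrite ge_max ML sL => /(_ isT).
have := ler_norm (f t' - f (M.+1%:R * h)); have := ler_norm (f (u%:R * h) - f u').
rewrite (distrC (f (u%:R * h))); lra.
Qed.

(** A drop by [a] that ends at [T], with both ends rounded up to the grid, loses at most [e / 2] at
    each end, so it crosses level [a - e]. *)
Lemma phase_upper n k (T : R) : (k <= n)%N -> tau k = T%:E ->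
  forall e, 0 < e -> e < a -> exists2 h0, 0 < h0 & forall h N, 0 < h -> h < h0 ->
    T <= N%:R * h -> (phase f n (a - e) h N <= n - k)%N.
Proof.
elim: k T => [|k IH] T kn kT e e0 ea.
  by exists 1 => // h N _ _ _; rewrite subn0; have := phase_noninc f n (a - e) h (leq0n N).
have a'0 : 0 < a - e by rewrite subr_gt0.
have [s [u [ks su uT aut]]] := drawdown_attained cf a0 kT.
have s0 : 0 <= s by rewrite -lee_fin -ks drawdown_time_ge0.
have [h1 h10 H] := IH s (ltnW kn) ks e e0 ea.
have e20 : 0 < e / 2 by rewrite divr_gt0.
have [d d0 unif] := continuous_segment_unif cf (T + 1) e20.
exists (Num.min h1 (Num.min d 1)) => [|h N h0]; first by rewrite !lt_min h10 d0/=.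
rewrite !lt_min => /and3P[hh1 hd hh] TN.
have ceil v : 0 <= v -> exists i : nat, v <= i%:R * h < v + h.
  move=> v0; have : exists i : nat, v <= i%:R * h.
    exists (Num.bound (v / h)); rewrite -ler_pdivrMr//.
    by apply: ltW; apply: archi_boundP; rewrite divr_ge0// ltW.
  move=> ex; have [i vi imin] := ex_minnP ex; exists i; rewrite vi/=.
  case: i vi imin => [|i] vi imin; first by rewrite mul0r ltr_wpDl.
  rewrite -natr1 mulrDl mul1r ltrD2r ltNge; apply/negP => /imin.
  by rewrite ltnn.
have u0 : 0 <= u by exact: le_trans su.
have [M /andP[TM MT]] := ceil T (le_trans u0 uT).
have [i /andP[ui iu]] := ceil u u0.
have MN : (M <= N)%N.
  rewrite leqNgt; apply/negP => NM.
  have : N.+1%:R * h <= M%:R * h by rewrite ler_wpM2r ?ler_nat// ltW.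
  rewrite -natr1; lra.
apply: leq_trans (phase_noninc f n (a - e) h MN) _.
have dropE : a - e <= f (i%:R * h) - f (M%:R * h).
  have A1 : `|f (i%:R * h) - f u| <= e / 2.
    by apply: unif; rewrite ?ger0_norm; lra.
  have A2 : `|f (M%:R * h) - f T| <= e / 2.
    by apply: unif; rewrite ?ger0_norm; lra.
  have := ler_norm (f (M%:R * h) - f T); have := ler_norm (f u - f (i%:R * h)).
  rewrite (distrC (f u)); lra.
have iM : (i < M)%N.
  have : (i <= M)%N.
    rewrite leqNgt; apply/negP => Mi.
    have : M.+1%:R * h <= i%:R * h by rewrite ler_wpM2r ?ler_nat// ltW.
    rewrite -natr1; lra.
  rewrite leq_eqVlt => /predU1P[iM|//]; move: dropE; rewrite iM subrr.
  by rewrite leNgt a'0.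
have phi : (phase f n (a - e) h i <= n - k)%N.
  by apply: H => //; exact: le_trans ui.
case: M MN TM MT dropE iM => // M MN TM MT dropE iM.
(* If the drawdown were still pending at [M + 1], the phase would be constant from [i] to [M], and
   [phase_step] would make it fall at [M + 1]. *)
rewrite leqNgt; apply/negP => phM.
have h2 := phase_noninc f n (a - e) h (leqnSn M).
have h3 := phase_noninc f n (a - e) h (iM : (i <= M)%N).
have phM0 : (0 < phase f n (a - e) h M)%N by exact: leq_trans (leq_trans _ phM) h2.
have phiM : phase f n (a - e) h i = phase f n (a - e) h M.
  move: phM h2 h3 phi kn; move: (phase _ _ _ _ M.+1) (phase _ _ _ _ M) (phase _ _ _ _ i).
  by clear; lia.
have [_ /(_ i iM phiM dropE)] := phase_step f0 a'0 phM0.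
move: phM h2 h3 phi kn; move: (phase _ _ _ _ M.+1) (phase _ _ _ _ M) (phase _ _ _ _ i).
by clear; lia.
Qed.

End chain_times.

(** * Iterated limits of the chain *)

Section double_limit.
Context {R : realType}.
Local Open Scope ereal_scope.

Lemma limn_einf_ge (u : nat -> \bar R) x N :
  (forall n, (N <= n)%N -> x <= u n) -> x <= limn_einf u.
Proof.
move=> h; rewrite limn_einf_lim; apply: lime_ge; first exact: is_cvg_einfs.
near=> n; apply: le_ereal_inf_tmp => _ [m /= nm <-]; apply: h.
by apply: leq_trans nm; near: n; exists N.
Unshelve. all: by end_near. Qed.

Lemma limn_einf_le (u : nat -> \bar R) x N :
  (forall n, (N <= n)%N -> u n <= x) -> limn_einf u <= x.
Proof.
move=> h; rewrite limn_einf_lim; apply: lime_le; first exact: is_cvg_einfs.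
near=> n; apply: le_trans (h n _); last by near: n; exists N.
by apply: ereal_inf_lbound; exists n => /=.
Unshelve. all: by end_near. Qed.

(** An iterated limit, [q] first. Convergence in [q] for a fixed [p] is not demanded, since at a
    fixed positive slack the chain is only known to end up close to the target. *)
Definition dlim (u : nat -> nat -> R) (l : R) := forall e, (0 < e)%R ->
  exists p0, forall p, (p0 <= p)%N -> exists q0, forall q, (q0 <= q)%N ->
    (`|u p q - l| <= e)%R.

Lemma dlim_einf u l : dlim u l ->
  limn_einf (fun p => limn_einf (fun q => (u p q)%:E)) = l%:E.
Proof.
move=> ul; apply/eqP; rewrite eq_le; apply/andP; split; apply/lee_addgt0Pr => e e0.
  have [p0 H] := ul e e0; apply: (@limn_einf_le _ _ p0) => p /H[q0 {}H].
  apply: (@limn_einf_le _ _ q0) => q /H; rewrite -EFinD lee_fin.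
  by have := ler_norm (u p q - l); lra.
rewrite -leeBlDr//; have [p0 H] := ul e e0.
apply: (@limn_einf_ge _ _ p0) => p /H[q0 {}H].
apply: (@limn_einf_ge _ _ q0) => q /H; rewrite -EFinB lee_fin.
by have := ler_norm (l - u p q); rewrite distrC; lra.
Qed.

Lemma measurable_fun_limn_einf d (T : measurableType d) (f : nat -> T -> \bar R) :
  (forall n, measurable_fun setT (f n)) ->
  measurable_fun setT (fun x => limn_einf (f ^~ x)).
Proof.
move=> mf; rewrite /limn_einf.
apply: measurableT_comp => //.
apply: (measurable_fun_limn_esup (f := fun n x => - f n x)) => n.
exact: measurableT_comp.
Qed.

End double_limit.

Section chain_convergence.
Context {R : realType}.
Variables (f : R -> R) (a : R).
Hypotheses (cf : continuous f) (f0 : f 0 = 0) (a0 : 0 < a).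
Local Notation tau := (drawdown_time a f).

(* The mesh goes to 0 while mesh * steps goes to infinity; the chain declares a
   drawdown at level a - slack because it sees the path only on the grid. *)
Definition mesh (q : nat) : R := q.+1%:R ^- 2.
Definition steps (q : nat) : nat := (q.+1 ^ 3)%N.
Definition slack (p : nat) : R := Num.min 1 (a / 2) / p.+1%:R.

Lemma mesh_gt0 q : 0 < mesh q.
Proof. by rewrite invr_gt0 exprn_gt0. Qed.

Lemma mesh_le q : mesh q <= q.+1%:R^-1.
Proof.
by rewrite lef_pV2 ?posrE ?exprn_gt0// expr2 ler_peMr// ler1n.
Qed.

Lemma steps_mesh q : (steps q)%:R * mesh q = q.+1%:R.
Proof. by rewrite /steps natrX /mesh exprS mulfK// expf_neq0// pnatr_eq0. Qed.

Lemma inv_small (e : R) : 0 < e -> exists q0, forall q, (q0 <= q)%N -> q.+1%:R^-1 < e.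
Proof.
move=> e0; exists (Num.bound e^-1) => q h.
rewrite -[e]invrK ltf_pV2 ?posrE ?invr_gt0//.
apply: lt_trans (archi_boundP _) _; first by rewrite invr_ge0 ltW.
by rewrite ltr_nat ltnS.
Qed.

Lemma mesh_small (e : R) : 0 < e -> exists q0, forall q, (q0 <= q)%N -> mesh q < e.
Proof.
by move=> /inv_small[q0 h]; exists q0 => q /h; exact: le_lt_trans (mesh_le q).
Qed.

Lemma slack_gt0 p : 0 < slack p.
Proof. by rewrite divr_gt0// lt_min ltr01/= divr_gt0. Qed.

Lemma slack_le p : slack p <= p.+1%:R^-1.
Proof. by rewrite ler_pdivrMr// mulVf ?pnatr_eq0// ge_min lexx. Qed.

Lemma slack_le1 p : slack p <= 1.
Proof. by apply: le_trans (slack_le p) _; rewrite invf_le1// ler1n. Qed.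

Lemma slack_lt p : slack p < a.
Proof.
apply: (@le_lt_trans _ _ (a / 2)); last by have := a0; lra.
rewrite ler_pdivrMr// (@le_trans _ _ (a / 2))//; first by rewrite ge_min lexx orbT.
by rewrite ler_peMr ?ler1n// ltW// divr_gt0.
Qed.

Lemma slack_small (e : R) : 0 < e -> exists p0, forall p, (p0 <= p)%N -> slack p < e.
Proof.
by move=> /inv_small[p0 h]; exists p0 => p /h; exact: le_lt_trans (slack_le p).
Qed.

Definition chain_at n p q : chain_state :=
  path_chain f n (a - slack p) (mesh q) (steps q).

Lemma chain_late n (L : R) : (L%:E < tau n)%E ->
  exists p0, forall p, (p0 <= p)%N -> exists q0, forall q, (q0 <= q)%N ->
    L < (chain_at n p q).1.2%:R * mesh q.
Proof.
move=> Lt; have [e0 e00 H] := phase_lower cf f0 a0 (leqnn n) Lt.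
have [p0 Hp] := slack_small e00; exists p0 => p /Hp pe.
exists (Num.bound `|L|) => q Lq.
have LN : L < (steps q)%:R * mesh q.
  rewrite steps_mesh; apply: le_lt_trans (ler_norm _) _.
  apply: lt_trans (archi_boundP (normr_ge0 _)) _.
  by rewrite ltr_nat ltnS.
have ap0 : 0 < a - slack p by rewrite subr_gt0 slack_lt.
rewrite /chain_at; have := @path_chain_inv R f n (a - slack p) (mesh q) f0 (steps q).
case: (path_chain _ _ _ _ _) => [[j i] [x [l m]]] [[iN xE ij phi] _ _ _ _] /=.
have [j0|j0] := posnP j; last by rewrite ij.
rewrite ltNge; apply/negP => iL.
have := H (slack p) (mesh q) i (slack_gt0 p) pe (slack_lt p) (mesh_gt0 q) iL.
by rewrite phi j0 subnn ltnn.
Qed.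

Lemma chain_cvg n (T : R) : tau n = T%:E -> forall e, 0 < e ->
  exists p0, forall p, (p0 <= p)%N -> exists q0, forall q, (q0 <= q)%N ->
  let: ((j, i), (x, (l, m))) := chain_at n p q in
  [/\ j = 0%N, `|i%:R * mesh q - T| <= e, `|x - f T| <= e &
      `|m - running_sup f 0 T| <= e].
Proof.
move=> nT e e0.
have T0 : 0 <= T by rewrite -lee_fin -nT drawdown_time_ge0.
have [d d0 unif] := continuous_segment_unif cf (T + 1) e0.
pose d' := Num.min e (Num.min d 1).
have d'0 : 0 < d' by rewrite !lt_min e0 d0/=.
have d'e : d' <= e by rewrite ge_min lexx.
have d'd : d' <= d by rewrite !ge_min lexx orbT.
have d'1 : d' <= 1 by rewrite !ge_min lexx !orbT.
have Ld : ((T - d')%:E < tau n)%E by rewrite nT lte_fin gtrBl.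
have [p0 Hp] := chain_late Ld; exists p0 => p /Hp[q1 Hq].
have ap0 : 0 < a - slack p by rewrite subr_gt0 slack_lt.
have [h0 h00 HU] := phase_upper cf f0 a0 (leqnn n) nT (slack_gt0 p) (slack_lt p).
have [q2 Hq2] := mesh_small h00; have [q3 Hq3] := mesh_small d'0.
exists (maxn q1 (maxn q2 (maxn q3 (Num.bound (T + 1))))) => q.
rewrite !geq_max => /and4P[/Hq + /Hq2 mh0 /Hq3 md qT].
have m0 := mesh_gt0 q.
have TN : T + 1 <= (steps q)%:R * mesh q.
  rewrite steps_mesh; apply: ltW; apply: lt_trans (archi_boundP _) _; first by rewrite addr_ge0.
  by rewrite ltr_nat ltnS.
rewrite /chain_at.
have phN : path_chain f n (a - slack p) (mesh q) (steps q) =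
  path_chain f n (a - slack p) (mesh q) (steps q) by [].
have := @path_chain_inv R f n (a - slack p) (mesh q) f0 (steps q).
have : (phase f n (a - slack p) (mesh q) (steps q) <= n - n)%N.
  by apply: HU => //; lra.
rewrite {1}/phase; case: (path_chain _ _ _ _ _) => [[j i] [x [l m]]] /=.
rewrite subnn leqn0 => /eqP -> {j} [[iN xE _ phi] _ _ [v vi mE] [H4 H5]] iL.
(* The first grid index at or after [T] has phase 0 by [phase_upper], whereas all indices before [i]
   have positive phase; hence [i] does not exceed it. *)
have iU : i%:R * mesh q < T + mesh q.
  have ex : exists k : nat, T <= k%:R * mesh q.
    by exists (steps q); lra.
  have [k Tk kmin] := ex_minnP ex.
  have kT : k%:R * mesh q < T + mesh q.
    case: k Tk kmin => [|k] Tk kmin; first by rewrite mul0r ltr_wpDl.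
    rewrite -natr1 mulrDl mul1r ltrD2r ltNge; apply/negP => /kmin.
    by rewrite ltnn.
  apply: le_lt_trans kT; rewrite ler_wpM2r ?(ltW m0)// ler_nat leqNgt; apply/negP => ki.
  have := H5 k ki; have := HU (mesh q) k m0 mh0 Tk.
  by rewrite subnn leqn0 => /eqP ->.
have i0 : 0 <= i%:R * mesh q by rewrite mulr_ge0// ltW.
have iT : `|i%:R * mesh q - T| <= d' by rewrite ler_norml; apply/andP; split; lra.
have fiT : `|f (i%:R * mesh q) - f T| <= e.
  by apply: unif; rewrite ?(le_trans iT)//; apply/andP; split; lra.
have [s /andP[s0 sT] [-> smax]] := running_sup_attained cf T0.
split => //; first exact: le_trans iT d'e.
  by rewrite xE.
rewrite ler_norml; apply/andP; split.
  (* Lower bound: compare with the first grid point at or after the time [s] of the maximum, or with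
     the last grid point seen if that one precedes [s]. *)
  have [si|is'] := leP s (i%:R * mesh q); last first.
    have : `|f (i%:R * mesh q) - f s| <= e.
      apply: unif; first by apply/andP; split; lra.
        by apply/andP; split; lra.
      by apply: le_trans d'd; rewrite ler_norml; apply/andP; split; lra.
    have := H4 i (leqnn i); have := ler_norm (f s - f (i%:R * mesh q)).
    by rewrite distrC; lra.
  have ex : exists k : nat, s <= k%:R * mesh q by exists i.
  have [k sk kmin] := ex_minnP ex.
  have ki : (k <= i)%N by exact: kmin.
  have kT : k%:R * mesh q <= i%:R * mesh q by rewrite ler_wpM2r ?(ltW m0)// ler_nat.
  have ks : k%:R * mesh q < s + mesh q.
    case: k sk kmin {ki kT} => [|k] Tk kmin; first by rewrite mul0r ltr_wpDl.
    rewrite -natr1 mulrDl mul1r ltrD2r ltNge; apply/negP => /kmin.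
    by rewrite ltnn.
  have : `|f (k%:R * mesh q) - f s| <= e.
    apply: unif; first by apply/andP; split; lra.
      by apply/andP; split; lra.
    by apply: le_trans d'd; rewrite ler_norml; apply/andP; split; lra.
  have := H4 k ki; have := ler_norm (f s - f (k%:R * mesh q)).
  by rewrite distrC; lra.
(* Upper bound: if the maximum over the grid is reached after [T], it is reached within [d] of
   [T]. *)
have v0 : 0 <= v%:R * mesh q by rewrite mulr_ge0// ltW.
have vU : v%:R * mesh q <= i%:R * mesh q by rewrite ler_wpM2r ?(ltW m0)// ler_nat.
rewrite mE; have [vT|Tv] := leP (v%:R * mesh q) T.
  by have := smax (v%:R * mesh q); rewrite v0 vT => /(_ isT); lra.
have : `|f (v%:R * mesh q) - f T| <= e.
  apply: unif; first by apply/andP; split; lra.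
    by apply/andP; split; lra.
  by apply: le_trans d'd; rewrite ler_norml; apply/andP; split; lra.
have := smax T; rewrite T0 lexx => /(_ isT).
by have := ler_norm (f (v%:R * mesh q) - f T); lra.
Qed.

End chain_convergence.

Section chain_functional.
Context {R : realType}.
Variables (f : R -> R) (a lam : R).
Hypotheses (cf : continuous f) (f0 : f 0 = 0) (a0 : 0 < a) (lam0 : 0 < lam).
Local Notation tau := (drawdown_time a f).
Variables (bp bm : R) (n : nat) (g : nat -> R -> R -> R) (C M : R).
Hypothesis gC : bounded_lipschitz C (g 0).
Hypothesis gM : forall p s, chain_valid (a - slack a p) n s -> `|chain_value bp bm a g s| <= M.

Definition chain_functional (h : R) (s : chain_state) : R :=
  expR (- lam * h) ^+ s.1.2 * chain_value bp bm a g s.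

Lemma chain_functional_fin T : tau n = T%:E ->
  dlim (fun p q => chain_functional (mesh q) (chain_at f a n p q))
       (expR (- lam * T) * g 0 (f T) (running_sup f 0 T)).
Proof.
move=> nT e e0.
have C0 := bounded_lipschitz_ge0 gC; have [h1 h2] := gC.
have T0 : 0 <= T by rewrite -lee_fin -nT drawdown_time_ge0.
pose B := lam * expR lam * C + 2 * C + 1.
have lC0 : 0 <= lam * expR lam * C by rewrite !mulr_ge0 ?expR_ge0// ltW.
have B0 : 0 < B by rewrite /B; lra.
pose d := Num.min 1 (e / B).
have d0 : 0 < d by rewrite lt_min ltr01 divr_gt0.
have [p0 H] := chain_cvg cf f0 a0 nT d0.
exists p0 => p /H[q0 {}H]; exists q0 => q /H {H}.
rewrite /chain_functional.
case: (chain_at _ _ _ _ _) => [[j i] [x [l m]]] [-> iT xT mT] /=.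
rewrite -expRM_natl mulrC; set s := i%:R * mesh q in iT.
rewrite (_ : i%:R * (- lam * mesh q) = - lam * s); last by rewrite /s; ring.
have s0 : 0 <= s by rewrite mulr_ge0// ltW// mesh_gt0.
set S := running_sup f 0 T in mT *.
have d1 : d <= 1 by rewrite ge_min lexx.
have dB : B * d <= e by rewrite mulrC -ler_pdivlMr// ge_min lexx orbT.
have E1 : `|expR (- lam * s) - expR (- lam * T)| <= lam * expR lam * d.
  have -> : expR (- lam * s) - expR (- lam * T) =
      expR (- lam * T) * (expR (- lam * (s - T)) - 1).
    by rewrite mulrBr -expRD mulr1; congr (expR _ - _); ring.
  rewrite normrM (ger0_norm (expR_ge0 _)).
  have eT : expR (- lam * T) <= 1 by rewrite expR_le1 mulNr oppr_le0 mulr_ge0// ltW.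
  have := @normr_expRM_sub1_le R (- lam) lam (s - T).
  rewrite normrN (gtr0_norm lam0) => /(_ (lexx _)) K.
  apply: (@le_trans _ _ (1 * (lam * (d * expR lam)))).
    apply: ler_pM => //; apply: le_trans K _.
    rewrite ler_wpM2l ?(ltW lam0)//; apply: ler_pM => //.
    by rewrite ler_expR ler_piMr ?(ltW lam0)// (le_trans iT).
  by rewrite mul1r mulrA mulrAC.
have -> : g 0 x m * expR (- lam * s) - expR (- lam * T) * g 0 (f T) S =
  (expR (- lam * s) - expR (- lam * T)) * g 0 x m +
  expR (- lam * T) * (g 0 x m - g 0 (f T) S) by ring.
apply: le_trans (ler_normD _ _) _; rewrite !normrM (ger0_norm (expR_ge0 _)).
have A1 : `|expR (- lam * s) - expR (- lam * T)| * `|g 0 x m| <= lam * expR lam * d * C.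
  exact: ler_pM.
have A2 : expR (- lam * T) * `|g 0 x m - g 0 (f T) S| <= 1 * (C * (d + d)).
  apply: ler_pM => //.
    by rewrite expR_le1 mulNr oppr_le0 mulr_ge0// ltW.
  by apply: le_trans (h2 _ _ _ _) _; rewrite ler_wpM2l// lerD.
move: dB; rewrite /B; lra.
Qed.

Lemma chain_functional_infty : tau n = +oo%E ->
  dlim (fun p q => chain_functional (mesh q) (chain_at f a n p q)) 0.
Proof.
move=> ny e e0.
have M0 : 0 <= M.
  by apply: le_trans (gM (path_chain_valid f n (mesh 0) _ 0) (p := 0%N)); rewrite // subr_gt0 slack_lt.
(* Past time [L] the discounted value is at most [e], because
   [expR (lam * L) >= lam * L = M / e]. *)
pose L := M / (lam * e).
have [|p0 H] := @chain_late R f a cf f0 a0 n L; first by rewrite ny ltry.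
exists p0 => p /H[q0 {}H]; exists q0 => q /H Li; rewrite subr0 /chain_functional.
have v : chain_valid (a - slack a p) n (chain_at f a n p q).
  by apply: path_chain_valid; rewrite subr_gt0 slack_lt.
rewrite normrM normrX (ger0_norm (expR_ge0 _)) -expRM_natl.
apply: (@le_trans _ _ (expR (- (lam * L)) * M)).
  apply: ler_pM => //; [|exact: gM v].
  rewrite ler_expR mulNr mulrN lerN2 (mulrCA _%:R); apply: ler_wpM2l; exact: ltW.
have L0 : 0 <= lam * L by rewrite mulr_ge0 ?(ltW lam0)// divr_ge0// mulr_ge0// ltW.
rewrite expRN ler_pdivrMl ?expR_gt0//.
have -> : M = lam * L * e by rewrite /L; field; rewrite !gt_eqF.
by rewrite ler_wpM2r ?(ltW e0)//; have := expR_ge1Dx (lam * L); lra.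
Qed.

End chain_functional.

Section half_line.
Context {R : realType}.
Variables (F : R -> R) (a : R).

(** Brownian paths are continuous on the half-line only. Composition with [Num.max 0] makes them
    continuous on the whole line, as the lemmas on paths assume, and preserves the drawdown
    times. *)
Lemma continuous_extend0 : {within `[0, +oo[, continuous F} ->
  continuous (fun t : R => F (Num.max 0 t)).
Proof.
move=> /continuous_within_itvcyP[cF F0].
have F0' e : 0 < e -> exists2 d, 0 < d & forall x, 0 <= x -> x < d -> `|F 0 - F x| < e.
  move=> e0; have := (@cvgrPdist_lt _ R^o _ _ _ F (F 0)).1 F0 e e0.
  rewrite near_withinE => /(_ _) /nbhs_ballP[d /= d0 hd]; exists d => // x x0 xd.
  have [->|xn] := eqVneq x 0; first by rewrite subrr normr0.
  apply: hd; last by rewrite lt_neqAle eq_sym xn.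
  by rewrite /ball/= sub0r normrN ger0_norm.
move=> t; apply/(@cvgrPdist_lt _ R^o) => e e0.
have [t0|t0|t0] := ltgtP 0 t.
- have cFt : F x @[x --> t] --> F t by apply: cF; rewrite in_itv/= andbT.
  have := (@cvgrPdist_lt _ R^o _ _ _ F (F t)).1 cFt e e0.
  move=> /(_ _) /nbhs_ballP[d /= d0 hd]; apply/nbhs_ballP; exists (Num.min d t) => /=.
    by rewrite lt_min d0.
  move=> y; rewrite /ball/= lt_min => /andP[yd yt].
  have y0 : 0 < y by have := ler_norm (t - y); lra.
  by rewrite (max_r (ltW y0)); exact: hd.
- apply/nbhs_ballP; exists (- t) => /=; first by rewrite oppr_gt0.
  move=> y; rewrite /ball/= => yt.
  have y0 : y < 0 by have := ler_norm (y - t); rewrite distrC; lra.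
  by rewrite (max_l (ltW y0)) subrr normr0.
- have [d d0 hd] := F0' e e0; apply/nbhs_ballP; exists d => //= y.
  rewrite /ball/= -t0 sub0r normrN ?maxxx => yd; apply: hd; first by rewrite le_max lexx.
  by rewrite gt_max d0 (le_lt_trans (ler_norm y)).
Qed.

Let f (t : R) := F (Num.max 0 t).

Lemma running_sup_extend0 s t : 0 <= s -> running_sup f s t = running_sup F s t.
Proof.
move=> s0; rewrite /running_sup; congr sup; apply/seteqP; split => _ [u /= + <-];
  rewrite in_itv/= => /andP[su ut]; exists u; rewrite /= ?in_itv/= ?su ?ut//;
  by rewrite /f max_r// (le_trans s0).
Qed.

Lemma drawdown_time_extend0 n : drawdown_time a f n = drawdown_time a F n.
Proof.
elim: n => // n IH; rewrite /= IH; congr ereal_inf; congr image.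
have n0 : (0 <= drawdown_time a F n)%E.
  rewrite -IH; elim: (n) => // k /le_trans; apply.
  by rewrite drawdown_timeS; apply: le_ereal_inf_tmp => _ [t [h _] <-]; exact: ltW.
apply/seteqP; split => t [nt]; rewrite ?running_sup_extend0 ?fine_ge0// => h; split => //.
  have t0 : 0 <= t by rewrite -lee_fin (le_trans n0 (ltW nt)).
  by move: h; rewrite /f max_r.
have t0 : 0 <= t by rewrite -lee_fin (le_trans n0 (ltW nt)).
by rewrite running_sup_extend0 ?fine_ge0// /f max_r.
Qed.

End half_line.

(** * Brownian motion *)

Section brownian_drawdown.
Context {R : realType} {d : measure_display} {T : measurableType d}
  (P : probability T R) (W : R -> {RV P >-> R}) (mu sigma a lam : R).
Hypotheses (bmW : brownian_motion W) (sigma0 : 0 < sigma) (a0 : 0 < a) (lam0 : 0 < lam).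
Local Notation X := (drifted W mu sigma).
Local Notation bp := (beta_plus mu sigma lam).
Local Notation bm := (beta_minus mu sigma lam).
Local Notation bb := (b_const mu sigma a lam).
Local Notation cc := (c_const mu sigma a lam).

Let disc_ge0 : 0 <= mu ^+ 2 + 2 * lam * sigma ^+ 2.
Proof. by rewrite addr_ge0 ?sqr_ge0// mulr_ge0 ?sqr_ge0// mulr_ge0// ltW. Qed.

Let sqrt_disc : `|mu| < Num.sqrt (mu ^+ 2 + 2 * lam * sigma ^+ 2).
Proof.
rewrite -sqrtr_sqr ltr_sqrt; last first.
  rewrite ltr_wpDl ?sqr_ge0// mulr_gt0 ?exprn_gt0// mulr_gt0//.
by rewrite ltrDl !mulr_gt0 ?exprn_gt0.
Qed.

Lemma beta_plus_gt0 : 0 < bp.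
Proof.
apply: divr_gt0; last by rewrite exprn_gt0.
by have := sqrt_disc; have := ler_norm mu; lra.
Qed.

Lemma beta_minus_lt0 : bm < 0.
Proof.
rewrite /beta_minus pmulr_llt0 ?invr_gt0 ?exprn_gt0//.
by have := sqrt_disc; have := ler_norm (- mu); rewrite normrN; lra.
Qed.

Lemma beta_plusE : mu * bp + sigma ^+ 2 * bp ^+ 2 / 2 = lam.
Proof.
have s0 : sigma != 0 by rewrite gt_eqF.
have h := sqr_sqrtr disc_ge0; rewrite /beta_plus; set s := Num.sqrt _ in h *.
have -> : mu * ((- mu + s) / sigma ^+ 2) + sigma ^+ 2 * ((- mu + s) / sigma ^+ 2) ^+ 2 / 2
  = (s ^+ 2 - mu ^+ 2) / (2 * sigma ^+ 2) by field.
by rewrite h; field.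
Qed.

Lemma beta_minusE : mu * bm + sigma ^+ 2 * bm ^+ 2 / 2 = lam.
Proof.
have s0 : sigma != 0 by rewrite gt_eqF.
have h := sqr_sqrtr disc_ge0; rewrite /beta_minus; set s := Num.sqrt _ in h *.
have -> : mu * ((- mu - s) / sigma ^+ 2) + sigma ^+ 2 * ((- mu - s) / sigma ^+ 2) ^+ 2 / 2
  = (s ^+ 2 - mu ^+ 2) / (2 * sigma ^+ 2) by field.
by rewrite h; field.
Qed.

Lemma b_const_gt0 : 0 < bb.
Proof. exact: exit_b_gt0 beta_plus_gt0 beta_minus_lt0 a0. Qed.

Lemma c_const_gt0 : 0 < cc.
Proof. exact: exit_c_gt0 beta_plus_gt0 beta_minus_lt0 a0. Qed.

Definition bm_increment (h : R) (i : nat) (w : T) : R :=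
  W (i.+1%:R * h) w - W (i%:R * h) w.

Lemma measurable_bm_increment h i : measurable_fun setT (bm_increment h i).
Proof. exact: measurable_funB. Qed.

Lemma bm_increment_indep h : 0 < h -> forall N (B : nat -> set R),
  (forall i, measurable (B i)) ->
  P (\bigcap_(i in [set i | (i < N)%N]) bm_increment h i @^-1` B i) =
  (\prod_(i < N) normal_prob 0%R (Num.sqrt h) (B i))%E.
Proof.
move=> h0 N B mB.
have := @bm_independent_increments _ _ _ _ _ bmW N (fun i => i%:R * h).
rewrite mul0r => /(_ (lexx _)) H0.
have ht : {homo (fun i : nat => i%:R * h) : i j / (i <= j)%N >-> i <= j}.
  by move=> i j ij; rewrite ler_wpM2r ?ler_nat// ltW.
have H := H0 ht (fun i : 'I_N => B i) (fun i => mB i).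
transitivity (P (\bigcap_(i in [set: 'I_N])
    (W (i.+1%:R * h) \- W (i%:R * h)) @^-1` B i)).
  congr (P _); apply/seteqP; split => w hw i /= iN; first exact: (hw i (ltn_ord i)).
  exact: (hw (Ordinal iN) Logic.I).
rewrite H; apply: eq_bigr => i _.
have := @bm_gaussian_increments _ _ _ _ _ bmW (i%:R * h) (i.+1%:R * h).
rewrite mulr_ge0 ?(ltW h0)// ltr_pM2r// ltr_nat ltnSn => /(_ isT isT _ (mB i)).
rewrite -[in X in normal_prob _ (Num.sqrt X)]natr1.
by rewrite mulrDl mul1r addrAC subrr add0r.
Qed.

Definition bm_chain (n p q : nat) : T -> @chain_state R :=
  driven_chain (bm_increment (mesh q))
    (fun s r => chain_step (a - slack a p) s (mu * mesh q + sigma * r))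
    ((n, 0%N), (0, (0, 0))) (steps q).

Lemma measurable_drift_step (e h : R) : measurable_fun setT
  (fun p : @chain_state R * R => chain_step e p.1 (mu * h + sigma * p.2)).
Proof.
apply: (measurableT_comp (f := fun p : @chain_state R * R => chain_step e p.1 p.2)
   (g := fun p : @chain_state R * R => (p.1, mu * h + sigma * p.2))).
  exact: measurable_chain_step.
apply: measurable_fun_pair; first exact: measurable_fst.
apply: measurable_funD; first exact: measurable_cst.
by apply: measurable_funM; [exact: measurable_cst|exact: measurable_snd].
Qed.

Lemma measurable_bm_chain n p q : measurable_fun setT (bm_chain n p q).
Proof.
apply: measurable_driven_chain => [i|]; first exact: measurable_bm_increment.
exact: measurable_drift_step.
Qed.

Definition half_path (w : T) (t : R) : R := X w (Num.max 0 t).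
Local Notation path := half_path.

(** The chain has two readings: driven by independent Gaussian increments, for expectations, and
    sampled from a single path, for the limit. *)
Lemma bm_chain_path n p q w :
  bm_chain n p q w = chain_at (path w) a n p q.
Proof.
rewrite /bm_chain /chain_at; elim: (steps q) => // N IH.
rewrite [LHS]/= IH [RHS]/=; congr (chain_step _ _ _).
have hq : 0 < mesh q :> R by exact: mesh_gt0.
rewrite /half_path !max_r ?mulr_ge0 ?(ltW hq)// /drifted /bm_increment -natr1; ring.
Qed.

Definition bm_regular (w : T) :=
  W 0 w = 0 /\ {within `[0, +oo[, continuous (fun t : R => W t w)}.

Lemma bm_regular_ae : exists N, [/\ measurable N, P N = 0%E & ~` N `<=` bm_regular].
Proof.
have [A1 [mA1 PA1 sA1]] := bm_start bmW; have [A2 [mA2 PA2 sA2]] := bm_continuous bmW.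
exists (A1 `|` A2); split; first exact: measurableU.
  apply/eqP; rewrite eq_le measure_ge0 andbT.
  apply: le_trans (measureU2 P mA1 mA2) _.
  by rewrite [X in (X + _)%E]PA1 [X in (_ + X)%E]PA2 adde0.
move=> w /not_orP[w1 w2]; split; apply: contrapT => h.
  by apply: w1; exact: sA1.
by apply: w2; exact: sA2.
Qed.

Lemma path_regular w : bm_regular w -> continuous (path w) /\ path w 0 = 0.
Proof.
move=> [w0 cw]; split; last first.
  by rewrite /half_path maxxx /drifted w0 !mulr0 addr0.
have c1 : {within `[0, +oo[, continuous (fun t : R => mu * t)}.
  by apply: continuous_subspaceT => x; apply: cvgM; [exact: cvg_cst|exact: cvg_id].
have c2 : {within `[0, +oo[, continuous (fun t : R => sigma * W t w)}.
  by move=> t; apply: cvgM; [exact: cvg_cst|exact: cw].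
by apply: continuous_extend0 => t; exact: (cvgD (c1 t) (c2 t)).
Qed.

End brownian_drawdown.

(** * Passage to the limit in expectation *)

Section dlim_version.
Context {R : realType} {d : measure_display} {T : measurableType d}.

(** Lower limits exist at every [w], so this is defined and measurable on the whole space and equals
    the limit wherever [dlim] holds. *)
Definition dlim_version (u : nat -> nat -> T -> R) (w : T) : R :=
  fine (limn_einf (fun p => limn_einf (fun q => (u p q w)%:E))).

Lemma measurable_dlim_version u : (forall p q, measurable_fun setT (u p q)) ->
  measurable_fun setT (dlim_version u).
Proof.
move=> mu; apply: measurableT_comp; first exact: fine_measurable.
apply: (measurable_fun_limn_einf (f := fun p w => limn_einf (fun q => (u p q w)%:E))) => p.
by apply: (measurable_fun_limn_einf (f := fun q w => (u p q w)%:E)) => q; apply/measurable_EFinP.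
Qed.

Lemma dlim_versionE u w l : dlim (fun p q => u p q w) l -> dlim_version u w = l.
Proof. by rewrite /dlim_version => /dlim_einf ->. Qed.

(* Fatou's lemma, applied once for each of the two limits. *)
Lemma fatou_dlim (P : probability T R) (u : nat -> nat -> T -> R) (v : T -> R) (c : R) N :
  (forall p q, measurable_fun setT (u p q)) -> measurable_fun setT v ->
  (forall p q w, 0 <= u p q w) ->
  measurable N -> P N = 0%E -> (forall w, ~ N w -> dlim (fun p q => u p q w) (v w)) ->
  (forall e, 0 < e -> exists p0, forall p, (p0 <= p)%N -> exists q0, forall q, (q0 <= q)%N ->
    (\int[P]_w (u p q w)%:E <= (c + e)%:E)%E) ->
  (\int[P]_w (v w)%:E <= c%:E)%E.
Proof.
move=> mu mv u0 mN PN uv uc.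
have mI p : measurable_fun setT (fun w => limn_einf (fun q => (u p q w)%:E)).
  by apply: (measurable_fun_limn_einf (f := fun q w => (u p q w)%:E)) => q; apply/measurable_EFinP.
have I0 p w : (0 <= limn_einf (fun q => (u p q w)%:E))%E.
  by apply: (@limn_einf_ge _ _ _ 0) => q _; rewrite lee_fin.
have -> : (\int[P]_w (v w)%:E =
    \int[P]_w limn_einf (fun p => limn_einf (fun q => (u p q w)%:E)))%E.
  apply: ae_eq_integral => //.
  - by apply/measurable_EFinP.
  - exact: (measurable_fun_limn_einf (f := fun p w => limn_einf (fun q => (u p q w)%:E))).
  - exists N; split => // w /= h; apply: contrapT => Nw; apply: h => _.
    by rewrite (dlim_einf (uv w Nw)).
apply/lee_addgt0Pr => e e0; have [p0 H] := uc e e0.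
apply: le_trans (fatou _ measurableT mI (fun p w _ => I0 p w)) _.
apply: (@limn_einf_le _ _ _ p0) => p /H[q0 {}H].
apply: le_trans (fatou _ measurableT (f := fun q w => (u p q w)%:E) _ _) _.
- by move=> q; apply/measurable_EFinP.
- by move=> q w _; rewrite lee_fin.
by apply: (@limn_einf_le _ _ _ q0) => q /H.
Qed.

End dlim_version.

Section drawdown_law.
Context {R : realType} {d : measure_display} {T : measurableType d}
  (P : probability T R) (W : R -> {RV P >-> R}) (mu sigma a lam : R).
Hypotheses (bmW : brownian_motion W) (sigma0 : 0 < sigma) (a0 : 0 < a) (lam0 : 0 < lam).
Local Notation X := (drifted W mu sigma).
Local Notation bp := (beta_plus mu sigma lam).
Local Notation bm := (beta_minus mu sigma lam).
Local Notation op := (drawdown_op (c_const mu sigma a lam) (b_const mu sigma a lam) a).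
Variable n : nat.
Local Notation tau := (fun w => drawdown_time a (X w) n).

Let bp0 : 0 < bp. Proof. exact: beta_plus_gt0. Qed.
Let bm0 : bm < 0. Proof. exact: beta_minus_lt0. Qed.

Definition discounted_value G p q (w : T) : R :=
  chain_functional a lam bp bm (fun j => iter j op G) (mesh q) (bm_chain W mu sigma a n p q w).

(** With [t = q.+1] the mesh is [t ^- 2], so the exponents stay below [B], while [expR (t * e)]
    exceeds [(t * e) ^ 3 / 6]. Comparison with [e * t ^- 2] leaves [t > 12 * expR B / e ^ 4], whose
    right-hand side is [D]. *)
Lemma tail_condition (u e k : R) : 0 < e -> 0 <= k -> exists q0, forall q, (q0 <= q)%N ->
  expR (- q.+1%:R * e) *
    (expR ((u * (k + q.+1%:R) + sigma ^+ 2 * (k + q.+1%:R) ^+ 2 / 2) * mesh q) +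
    expR ((- u * (k + q.+1%:R) + sigma ^+ 2 * (k + q.+1%:R) ^+ 2 / 2) * mesh q)) <=
  e * mesh q.
Proof.
move=> e0 k0.
pose B := `|u| * (k + 1) + sigma ^+ 2 * (k + 1) ^+ 2 / 2.
pose D := 12 * expR B / e ^+ 4.
exists (Num.bound D) => q Dq; set t : R := q.+1%:R.
have t1 : 1 <= t by rewrite ler1n.
have t0 : 0 < t by rewrite ltr0n.
have hE : mesh q = t ^- 2 by [].
have Dt : D < t.
  apply: lt_trans (archi_boundP _) _; last by rewrite ltr_nat ltnS.
  by rewrite divr_ge0 ?exprn_ge0 ?(ltW e0)// mulr_ge0// expR_ge0.
set v := k + t; have v0 : 0 <= v by rewrite addr_ge0// ltW.
have vt : v / t <= k + 1.
  rewrite ler_pdivrMr// /v mulrDl mul1r lerD2r ler_peMr//.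
have vh : v * mesh q <= k + 1.
  rewrite hE expr2 invfM mulrA; apply: le_trans vt.
  by rewrite ler_pdivrMr// ler_peMr// divr_ge0// ltW.
have vvh : v ^+ 2 * mesh q <= (k + 1) ^+ 2.
  rewrite hE -exprVn -exprMn ler_pXn2r// ?nnegrE ?addr_ge0//.
  by rewrite divr_ge0// ltW.
have m0 : 0 < mesh q :> R by exact: mesh_gt0.
have bnd u' : `|u'| = `|u| ->
    expR ((u' * v + sigma ^+ 2 * v ^+ 2 / 2) * mesh q) <= expR B.
  move=> uu; rewrite ler_expR mulrDl; apply: lerD.
    rewrite -uu -mulrA; apply: (@le_trans _ _ (`|u'| * (v * mesh q))).
      by rewrite ler_wpM2r ?ler_norm// mulr_ge0// ltW.
    by rewrite ler_wpM2l.
  rewrite [X in X <= _](_ : _ = sigma ^+ 2 * (v ^+ 2 * mesh q) / 2); last by ring.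
  by rewrite ler_pM2r// ler_wpM2l// sqr_ge0.
have b1 := bnd u erefl; have b2 := bnd (- u) (normrN u).
apply: (@le_trans _ _ (expR (- t * e) * (2 * expR B))).
  by rewrite ler_wpM2l ?expR_ge0//; lra.
have te0 : 0 <= t * e by rewrite mulr_ge0// ltW.
have := expR_ge1Dxn 2 te0; rewrite (_ : 3`!%:R = 6 :> R)// => h3.
have te3 : 0 < (t * e) ^+ 3 by rewrite exprn_gt0// mulr_gt0.
have e3 : (t * e) ^+ 3 / 6 <= expR (t * e) by lra.
rewrite mulNr expRN ler_pdivrMl ?expR_gt0//.
apply: (@le_trans _ _ ((t * e) ^+ 3 / 6 * (e * mesh q))); last first.
  by rewrite ler_wpM2r// mulr_ge0 ?ltW.
have -> : (t * e) ^+ 3 / 6 * (e * mesh q) = t * e ^+ 4 / 6.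
  by rewrite hE; field; rewrite gt_eqF.
have : D * e ^+ 4 <= t * e ^+ 4 by rewrite ler_wpM2r ?(ltW Dt)// exprn_ge0// ltW.
by rewrite /D divfK ?gt_eqF ?exprn_gt0//; lra.
Qed.

(** [sg = 1] bounds the expectation from above and [sg = -1] from below. The shift by [M] provides
    the nonnegativity that Fatou's lemma needs. *)
Lemma drawdown_expectation_sg G C sg v N : bounded_lipschitz C G -> sg = 1 \/ sg = -1 ->
  measurable_fun setT v -> measurable N -> P N = 0%E ->
  (forall w, ~ N w -> dlim (fun p q => discounted_value G p q w) (v w)) ->
  exists M, (\int[P]_w (M + sg * v w)%:E <= (M + sg * iter n op G 0 0)%:E)%E.
Proof.
move=> GC sgE mv mN PN Hv.
have [D HD] := iter_drawdown_op_bounds bp0 bm0 a0 n GC.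
have gbl j : exists C', bounded_lipschitz C' (iter j op G).
  have [D' HD'] := iter_drawdown_op_bounds bp0 bm0 a0 j GC.
  by exists D'; have [] := HD' j (leqnn j).
pose g j := iter j op G.
have gC j : (j <= n)%N -> bounded_lipschitz D (g j) by move=> /HD[].
have gmax j y m : (j < n)%N -> g j.+1 y (Num.max m y) = g j.+1 y m.
  by move=> _; have [C' h] := gbl j; exact: drawdown_op_max h.
have gup j : (j < n)%N -> forall y m o, 0 <= o -> y <= m ->
  `|g j.+1 (y + o) m - exit_low bp bm a (- o) * g j (y - a) m -
    exit_high bp bm a (- o) * g j.+1 y m| <= D * (o ^+ 2 * expR (exit_rate bp bm a * o)).
  by move=> /ltnW /HD[].
have [M [K [c0 [M0 K0 c00 HM HS]]]] := chain_super_harmonic bp0 bm0 a0 lam0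
  (beta_plusE mu sigma0 lam0) (beta_minusE mu sigma0 lam0) gbl gC gmax gup.
exists M.
pose s0 : @chain_state R := ((n, 0%N), (0, (0, 0))).
have vs0 p : chain_valid (a - slack a p) n s0.
  by split => //; rewrite subrr subr_gt0 slack_lt.
have stepv p q s r : chain_valid (a - slack a p) n s ->
    chain_valid (a - slack a p) n (chain_step (a - slack a p) s (mu * mesh q + sigma * r)).
  by apply: chain_step_valid; rewrite subr_gt0 slack_lt.
have vbm p q w : chain_valid (a - slack a p) n (bm_chain W mu sigma a n p q w).
  by rewrite /bm_chain; elim: (steps q) => [|i IH]; [exact: vs0|exact: stepv].
have valM p q w : `|discounted_value G p q w| <= 1 * M.
  rewrite normrM; apply: ler_pM => //; last exact: HM (slack_gt0 a0 p) (vbm p q w).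
  rewrite ger0_norm ?exprn_ge0 ?expR_ge0// exprn_ile1 ?expR_ge0//.
  by rewrite expR_le1 mulNr oppr_le0 mulr_ge0// ltW// mesh_gt0.
have sg1 : `|sg| = 1 by case: sgE => ->; rewrite ?normrN normr1.
have mval : measurable_fun setT (fun s => chain_value bp bm a g s).
  exact: measurable_chain_value.
have mdv p q : measurable_fun setT (discounted_value G p q).
  apply: (measurableT_comp (f := chain_functional a lam bp bm g (mesh q))); last first.
    exact: measurable_bm_chain.
  apply: measurable_funM => //.
  by apply: measurable_natnat_slice => j i; exact: measurable_cst.
(* The Lyapunov term of the initial state, the only error that survives the mesh; it vanishes with
   the slack. *)
pose Q p := K * slack a p * chain_weight c0 s0.
apply: (fatou_dlim (u := fun p q w => M + sg * discounted_value G p q w) (N := N)) => //.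
- move=> p q; apply: measurable_funD; first exact: measurable_cst.
  by apply: measurable_funM; [exact: measurable_cst|exact: mdv].
- by apply: measurable_funD; [exact: measurable_cst|apply: measurable_funM].
- move=> p q w; have : `|sg * discounted_value G p q w| <= M.
    by rewrite normrM sg1 mul1r -[M]mul1r.
  by rewrite ler_norml => /andP[+ _]; lra.
- move=> w /Hv H e e0; have [p0 {}H] := H e e0; exists p0 => p /H[q0 {}H].
  exists q0 => q /H; rewrite -[X in X <= _]mul1r -sg1 -normrM; congr (`|_| <= _); ring.
move=> e e0.
have w0 : 0 <= chain_weight c0 s0 by exact: chain_weight_ge0.
have eK : 0 < e / (K * chain_weight c0 s0 + 1) by rewrite divr_gt0// ltr_wpDl// mulr_ge0.
have [p0 Hp] := slack_small a eK; exists p0 => p /Hp ps.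
have sl0 : 0 < slack a p by exact: slack_gt0.
have Qe : Q p <= e.
  have : (K * chain_weight c0 s0 + 1) * slack a p <= e.
    by rewrite mulrC -ler_pdivlMr ?ltW// ltr_wpDl// mulr_ge0.
  rewrite /Q; lra.
have k10 : 0 <= exit_rate bp bm a + 1.
  by rewrite addr_ge0// ltW// exit_rate_gt0.
have [q0 Hq] := tail_condition mu sl0 k10; exists q0 => q /Hq tail.
have m0 : 0 < mesh q :> R by exact: mesh_gt0.
have m1 : mesh q <= 1 :> R.
  by apply: (@le_trans _ _ q.+1%:R^-1); [exact: mesh_le|rewrite invf_le1// ler1n].
have HF := HS (slack a p) (mesh q) q.+1%:R sl0 (slack_le1 _ p) (slack_lt a0 p) m0 m1
  (ler0n _ _) tail sg.
pose F := chain_super bp bm a lam g c0 M (K * slack a p) (mesh q) sg.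
have mF : measurable_fun setT F by exact: measurable_chain_super.
have super : (\int[P]_w (F (bm_chain W mu sigma a n p q w))%:E <= (F s0)%:E)%E.
  apply: (@driven_chain_supermartingale R _ _ _ T _ _ P
    (normal_prob 0 (Num.sqrt (mesh q))) (bm_increment W (mesh q))
    (fun s r => chain_step (a - slack a p) s (mu * mesh q + sigma * r)) s0
    _ _ _ (chain_valid (a - slack a p) n) F (steps q)) => //.
  - by move=> i; exact: measurable_bm_increment.
  - exact: bm_increment_indep.
  - exact: measurable_drift_step.
  - by move=> s r; exact: stepv.
  - by move=> s vs; have [] := HF s sgE vs.
  - by move=> s vs; have [] := HF s sgE vs.
have FE : F s0 = M + sg * g n 0 0 + Q p.
  by rewrite /F /chain_super expr0 mul1r chain_value_diag// /Q; ring.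
apply: le_trans (le_trans _ super) _; last by rewrite FE lee_fin lerD2l.
apply: ge0_le_integral => //=.
- move=> w _; rewrite lee_fin; have : `|sg * discounted_value G p q w| <= M.
    by rewrite normrM sg1 mul1r -[M]mul1r.
  by rewrite ler_norml => /andP[+ _]; lra.
- apply/measurable_EFinP; apply: measurable_funD; first exact: measurable_cst.
  by apply: measurable_funM; [exact: measurable_cst|exact: mdv].
- by apply/measurable_EFinP; apply: (measurableT_comp mF); exact: measurable_bm_chain.
move=> w _; rewrite lee_fin /F /chain_super lerD2l /discounted_value /chain_functional.
rewrite mulrCA mulrDr lerDl mulr_ge0 ?exprn_ge0 ?expR_ge0//.
by rewrite mulr_ge0 ?chain_weight_ge0// mulr_ge0// ltW.
Qed.

Let value_bounded G C : bounded_lipschitz C G -> exists M, forall p s,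
  chain_valid (a - slack a p) n s -> `|chain_value bp bm a (fun j => iter j op G) s| <= M.
Proof.
move=> GC; have [D HD] := iter_drawdown_op_bounds bp0 bm0 a0 n GC.
have gC j : (j <= n)%N -> bounded_lipschitz D (iter j op G) by move=> /HD[].
eexists => p s vs; apply: (chain_value_bound bp0 bm0 a0 gC _ vs).
by rewrite gerBl ltW// slack_gt0.
Qed.

Let dlim_regular G C w : bounded_lipschitz C G -> bm_regular W w ->
  dlim (fun p q => discounted_value G p q w)
    (if tau w is s%:E then expR (- lam * s) * G (X w s) (running_sup (X w) 0 s) else 0).
Proof.
move=> GC rw; have [cf f0] := path_regular mu sigma rw.
have [M HM] := value_bounded GC.
have tE : drawdown_time a (half_path W mu sigma w) n = tau w.
  exact: drawdown_time_extend0.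
have -> : (fun p q => discounted_value G p q w) = (fun p q =>
    chain_functional a lam bp bm (fun j => iter j op G) (mesh q)
      (chain_at (half_path W mu sigma w) a n p q)).
  by apply/funext => p; apply/funext => q; rewrite /discounted_value bm_chain_path.
have := drawdown_time_ge0 (half_path W mu sigma w) a n; rewrite tE.
case: (tau w) tE => [s sE s0| sE _|//].
  have := @chain_functional_fin R _ a lam cf f0 a0 lam0 bp bm n (fun j => iter j op G) C GC s sE.
  by rewrite running_sup_extend0// /half_path max_r.
exact: (@chain_functional_infty R _ a lam cf f0 a0 lam0 bp bm n (fun j => iter j op G) M HM sE).
Qed.

(** [T1], [Z1] and [M1] are measurable stand-ins for the discount, the position and the maximum at
    [tau]. Off the null set, [T1] is 0 where [tau = +oo], which fits integrals weighted by [T1]. *)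
Theorem drawdown_versions : exists T1 Z1 M1 : T -> R,
  [/\ measurable_fun setT T1 /\ measurable_fun setT Z1, measurable_fun setT M1,
    (forall w, 0 <= T1 w <= 1),
    (exists N, [/\ measurable N, P N = 0%E & forall w, ~ N w ->
      expeR (- (lam%:E * tau w)) = (T1 w)%:E /\
      (tau w <> +oo%E -> Z1 w = X w (fine (tau w)) /\
        M1 w = running_sup (X w) 0 (fine (tau w)))]) &
    forall G C, bounded_lipschitz C G ->
      (\int[P]_w (T1 w * G (Z1 w) (M1 w))%:E = (iter n op G 0 0)%:E)%E].
Proof.
have one : bounded_lipschitz (1 : R) (fun _ _ => 1).
  by split => *; rewrite ?normr1// subrr normr0 mul1r addr_ge0.
have mbm p q : measurable_fun setT (bm_chain W mu sigma a n p q).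
  exact: measurable_bm_chain.
(* For the constant function 1 the discounted value tends to the discount itself; the clipping in
   [T1] makes its bounds hold on the null set too. *)
pose T0 := dlim_version (discounted_value (fun _ _ => 1)).
pose T1 w := Num.min 1 (Num.max 0 (T0 w)).
pose Z1 := dlim_version (fun p q w => (bm_chain W mu sigma a n p q w).2.1).
pose M1 := dlim_version (fun p q w => (bm_chain W mu sigma a n p q w).2.2.2).
have mT0 : measurable_fun setT T0.
  apply: measurable_dlim_version => p q.
  apply: (measurableT_comp (f := chain_functional a lam bp bm _ (mesh q))) => //.
  apply: measurable_funM.
    by apply: measurable_natnat_slice => j i; exact: measurable_cst.
  apply: measurable_chain_value => j.
  have [D' HD'] := iter_drawdown_op_bounds bp0 bm0 a0 j one.
  by exists D'; have [] := HD' j (leqnn j).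
have mT1 : measurable_fun setT T1.
  by apply: measurable_minr; [exact: measurable_cst|exact: measurable_maxr].
have mZ1 : measurable_fun setT Z1.
  apply: measurable_dlim_version => p q.
  apply: (measurableT_comp (f := fun s : @chain_state R => s.2.1)) => //.
  exact: (measurableT_comp measurable_fst measurable_snd).
have mM1 : measurable_fun setT M1.
  apply: measurable_dlim_version => p q.
  apply: (measurableT_comp (f := fun s : @chain_state R => s.2.2.2)) => //.
  apply: (measurableT_comp measurable_snd).
  exact: (measurableT_comp measurable_snd measurable_snd).
have T01 w : 0 <= T1 w <= 1.
  by rewrite /T1 le_min ler01 le_max lexx /= ge_min lexx.
have [N [mN PN regN]] := bm_regular_ae bmW.
have T1E w : bm_regular W w -> T1 w = if tau w is s%:E then expR (- lam * s) else 0.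
  move=> rw; rewrite /T1 /T0 (dlim_versionE (dlim_regular one rw)).
  have := drawdown_time_ge0 (half_path W mu sigma w) a n.
  rewrite drawdown_time_extend0; case: (tau w) => [s|_|//]; last by rewrite maxxx min_r// ler01.
  rewrite lee_fin mulr1 => s0; rewrite max_r ?expR_ge0// min_r//.
  by rewrite expR_le1 mulNr oppr_le0 mulr_ge0// ltW.
have ZM w s : bm_regular W w -> tau w = s%:E ->
    Z1 w = X w s /\ M1 w = running_sup (X w) 0 s.
  move=> rw ts; have [cf f0] := path_regular mu sigma rw.
  have tE : drawdown_time a (half_path W mu sigma w) n = s%:E.
    by rewrite drawdown_time_extend0.
  have s0 : 0 <= s by rewrite -lee_fin -tE drawdown_time_ge0.
  have cv := chain_cvg cf f0 a0 tE.
  split; apply: dlim_versionE => e e0; have [p0 H] := cv e e0; exists p0 => p /H[q0 {}H];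
    exists q0 => q /H; rewrite bm_chain_path; case: (chain_at _ _ _ _ _) => [[j i] [x [l m]]] [_ _];
    rewrite running_sup_extend0// /half_path max_r//.
exists T1, Z1, M1; split => //.
  exists N; split => // w Nw; have rw := regN _ Nw; rewrite T1E//; split; last first.
    move=> tn; have := drawdown_time_ge0 (half_path W mu sigma w) a n.
    rewrite drawdown_time_extend0; case tE : (tau w) tn => [s| |]//= _ _.
    exact: ZM.
  have := drawdown_time_ge0 (half_path W mu sigma w) a n.
  rewrite drawdown_time_extend0; case: (tau w) => [s _||//].
    by rewrite -EFinM -EFinN /= mulNr.
  by move=> _; rewrite gt0_muley ?lte_fin.
move=> G C GC; pose v w := T1 w * G (Z1 w) (M1 w).
have mv : measurable_fun setT v.
  apply: measurable_funM => //.
  apply: (measurableT_comp (f := fun p : R * R => G p.1 p.2) (g := fun w => (Z1 w, M1 w))).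
    exact: measurable_bounded_lipschitz GC.
  exact: measurable_fun_pair.
have Hv w : ~ N w -> dlim (fun p q => discounted_value G p q w) (v w).
  move=> Nw; have rw := regN _ Nw; have := dlim_regular GC rw.
  rewrite /v T1E//; case tE : (tau w) => [s||]; rewrite ?mul0r//.
  by have [-> ->] := ZM _ _ rw tE.
have C0 := bounded_lipschitz_ge0 GC; have [GC1 _] := GC.
have vC w : `|v w| <= C.
  rewrite /v normrM -[C]mul1r; have /andP[t0 t1] := T01 w.
  by apply: ler_pM => //; rewrite ger0_norm.
have iv : P.-integrable setT (EFin \o v).
  have := finite_measure_integrable_cst P C measurableT.
  apply: le_integrable => //; first by apply/measurable_EFinP.
  by move=> w _ /=; rewrite lee_fin (ger0_norm C0).
have vE : (\int[P]_w (v w)%:E = (fine (\int[P]_w (v w)%:E))%:E)%E.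
  by rewrite fineK//; exact: integrable_fin_num.
have lin M sg : (\int[P]_w (M + sg * v w)%:E =
    (M + sg * fine (\int[P]_w (v w)%:E))%:E)%E.
  under eq_integral do rewrite EFinD EFinM.
  rewrite integralD//; last 2 first.
  - exact: finite_measure_integrable_cst.
  - exact: integrableZl.
  rewrite integral_cst//= probability_setT mule1 integralZl// EFinD EFinM.
  by rewrite -vE.
(* The two signs give the two inequalities of the equality. *)
have [M HM] := drawdown_expectation_sg GC (or_introl erefl) mv mN PN Hv.
have [M' HM'] := drawdown_expectation_sg GC (or_intror erefl) mv mN PN Hv.
move: HM HM'; rewrite !lin !lee_fin vE => h1 h2; congr EFin; lra.
Qed.

End drawdown_law.

(** * Iterates on a barrier *)

(** The conjugate of [drawdown_op]. Extended real values suit the unbounded functions that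
    conjugation creates, handled by monotone convergence and Tonelli's theorem. *)
Definition shift_op {R : realType} (a : R) (F : R -> R -> \bar R) (y m : R) :=
  (\int[lebesgue_measure]_(v in `[y, +oo[) F (v - a)%R (Num.max m v))%E.

Section shift_op.
Context {R : realType}.
Notation mu := (@lebesgue_measure R).
Variable a : R.
Notation S := (shift_op a).
Implicit Type F : R -> R -> \bar R.

Definition ge0_measurable2 F :=
  measurable_fun setT (fun p : R * R => F p.1 p.2) /\ forall y m, (0 <= F y m)%E.

Lemma integral_ray (h : R -> \bar R) y :
  (\int[mu]_(v in `[y, +oo[) h v = \int[mu]_v if (y <= v)%R then h v else 0)%E.
Proof.
rewrite integral_mkcond; apply: eq_integral => v _; rewrite /patch.
by congr (if _ then _ else _); rewrite mem_setE in_itv/= andbT.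
Qed.

Lemma measurable_shift_kernel F m : ge0_measurable2 F ->
  measurable_fun setT (fun v : R => F (v - a) (Num.max m v)).
Proof.
move=> [mF _].
apply: (measurableT_comp (f := fun p : R * R => F p.1 p.2)
   (g := fun v : R => (v - a, Num.max m v))) => //.
by apply: measurable_fun_pair; [exact: measurable_funB|exact: measurable_maxr].
Qed.

Lemma shift_op_measurable F : ge0_measurable2 F -> ge0_measurable2 (S F).
Proof.
move=> [mF F0]; split=> [|y m]; last exact: integral_ge0.
pose f (u : (R * R) * R) := if (u.1.1 <= u.2)%R then F (u.2 - a) (Num.max u.1.2 u.2) else 0%E.
have mf : measurable_fun setT f.
  apply: measurable_fun_ifT => //.
    apply: measurable_fun_ler => //.
    exact: (measurableT_comp measurable_fst measurable_fst).
  apply: (measurableT_comp (f := fun p : R * R => F p.1 p.2)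
     (g := fun u : (R * R) * R => (u.2 - a, Num.max u.1.2 u.2))) => //.
  apply: measurable_fun_pair; first exact: measurable_funB.
  apply: measurable_maxr => //.
  exact: (measurableT_comp measurable_snd measurable_fst).
have f0 u : (0 <= f u)%E by rewrite /f; case: ifP.
have := measurable_fun_fubini_tonelli_F (m2 := mu) f mf f0.
congr measurable_fun; apply/funext => p.
by rewrite /shift_op integral_ray.
Qed.

Lemma iter_shift_op_measurable k F : ge0_measurable2 F ->
  ge0_measurable2 (iter k S F).
Proof. by move=> FF; elim: k => // k; exact: shift_op_measurable. Qed.

Lemma shift_op_cvg (F : nat -> R -> R -> \bar R) (L : R -> R -> \bar R) :
  (forall j, ge0_measurable2 (F j)) ->
  (forall y m, nondecreasing_seq (fun j => F j y m)) ->
  (forall y m, F j y m @[j --> \oo] --> L y m) ->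
  (forall y m, nondecreasing_seq (fun j => S (F j) y m)) /\
  (forall y m, S (F j) y m @[j --> \oo] --> S L y m).
Proof.
move=> mF ndF FL; split=> y m.
  move=> i j ij; apply: ge0_le_integral => //=.
  - by move=> v _; have [_] := mF i.
  - by apply: measurable_funTS; exact: measurable_shift_kernel.
  - by apply: measurable_funTS; exact: measurable_shift_kernel.
  - by move=> v _; exact: ndF.
have -> : S L y m = (\int[mu]_(v in `[y, +oo[) limn (fun j => F j (v - a)%R (Num.max m v)))%E.
  by apply: eq_integral => v _; apply/esym/cvg_lim => //; exact: FL.
apply: (@cvg_monotone_convergence _ _ _ mu `[y, +oo[ _ (fun j v => F j (v - a)%R (Num.max m v))) => //.
- by move=> j; apply: measurable_funTS; exact: measurable_shift_kernel.
- by move=> j v _; have [_] := mF j.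
Qed.

(** Monotone convergence at each iteration; it leads from Lipschitz functions to indicators. *)
Lemma iter_shift_op_cvg k (F : nat -> R -> R -> \bar R) (L : R -> R -> \bar R) :
  (forall j, ge0_measurable2 (F j)) ->
  (forall y m, nondecreasing_seq (fun j => F j y m)) ->
  (forall y m, F j y m @[j --> \oo] --> L y m) ->
  forall y m, iter k S (F j) y m @[j --> \oo] --> iter k S L y m.
Proof.
move=> mF ndF FL.
suff : (forall y m, nondecreasing_seq (fun j => iter k S (F j) y m)) /\
  (forall y m, iter k S (F j) y m @[j --> \oo] --> iter k S L y m) by case.
elim: k => // k [IH1 IH2].
by apply: (shift_op_cvg (F := fun j => iter k S (F j)) _ IH1 IH2) => j;
  exact: iter_shift_op_measurable.
Qed.

Lemma lebesgue_measure_translate s (A : set R) : measurable A ->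
  pushforward mu (fun v : R => (v + s)%R : measurableTypeR R) A = mu A.
Proof.
have ms : measurable_fun setT (fun v : R => (v + s)%R : measurableTypeR R).
  exact: measurable_funD.
move=> mA; apply/esym/(lebesgue_measure_unique) => //= _ [[u v]] _ <-.
rewrite /pushforward /=.
have -> : (fun z : R => z + s) @^-1` `]u, v] = `]u - s, v - s]%classic.
  by apply/seteqP; split => z /=; rewrite !in_itv/= ltrBlDr lerBrDr.
rewrite !lebesgue_measure_itv/= !lte_fin ltrBlDr subrK.
by case: ifPn => // _; rewrite -!EFinB; congr EFin; ring.
Qed.

Lemma integral_translate (h : R -> \bar R) s :
  measurable_fun setT h -> (forall v, (0 <= h v)%E) ->
  (\int[mu]_v h v = \int[mu]_v h (v + s)%R)%E.
Proof.
move=> mh h0.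
have ms : measurable_fun setT (fun v : R => (v + s)%R : measurableTypeR R).
  exact: measurable_funD.
transitivity (\int[pushforward mu (fun v : R => (v + s)%R : measurableTypeR R)]_v h v)%E.
  by apply: eq_measure_integral => A mA _; exact/esym/lebesgue_measure_translate.
by rewrite ge0_integral_pushforward.
Qed.

End shift_op.

Section drawdown_shift.
Context {R : realType}.
Notation mu := (@lebesgue_measure R).
Variables (a b c : R).

(** Each application turns [expR (- b * v)] into [expR (- b * (v - a))], which costs a factor
    [expR (- b * a)] besides [c]. *)
Lemma iter_drawdown_shift k C G : 0 < c -> 0 < b ->
  bounded_lipschitz C G ->
  forall y m, iter k (shift_op a) (fun y m => (expR (- b * y) * G y m)%:E) y m =
    (expR (- b * y) * iter k (drawdown_op c b a) G y m / (c * expR (- b * a)) ^+ k)%:E.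
Proof.
move=> c0 b0 GC.
have itC j : exists D, bounded_lipschitz D (iter j (drawdown_op c b a) G).
  by elim: j => [|j [D HD]]; eexists; [exact: GC|exact: drawdown_op_lipschitz HD].
elim: k => [y m|k IH y m]; first by rewrite expr0 divr1.
rewrite iterS /shift_op.
under eq_integral do rewrite IH.
have [D HD] := itC k; set H := iter k _ G in HD *.
have iH := @integrable_kernel R b a b0 D H m y HD.
rewrite [RHS](_ : _ = ((expR (b * a) / (c * expR (- b * a)) ^+ k)%:E *
   \int[mu]_(v in `[y, +oo[) (expR (- b * v) * H (v - a) (Num.max m v))%:E)%E).
  rewrite -integralZl//.
  apply: eq_integral => v _; rewrite -EFinM; congr EFin.
  have -> : - b * (v - a) = - b * v + b * a by ring.
  by rewrite expRD; ring.
have -> : (\int[mu]_(v in `[y, +oo[) (expR (- b * v) * H (v - a) (Num.max m v))%:E =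
  (\int[mu]_(v in `[y, +oo[) (expR (- b * v) * H (v - a) (Num.max m v)))%:E)%E.
  by rewrite /Rintegral fineK//; exact: integrable_fin_num.
rewrite -EFinM iterS -/H /drawdown_op; congr EFin.
rewrite exprS !mulNr !expRN.
move: (expR_gt0 (b * y)) (expR_gt0 (b * a)) => e1 e2.
by field; rewrite ?expf_neq0 ?mulf_neq0 ?invr_neq0 ?gt_eqF//.
Qed.

End drawdown_shift.

(** * Abel polynomials and truncated powers *)

Section polynomial_integrals.
Context {R : realType}.
Notation mu := (@lebesgue_measure R).
Variable a : R.

Lemma integral_horner (p : {poly R}) (x y : R) : x <= y ->
  (\int[mu]_(v in `[x, y]) (p^`().[v])%:E = (p.[y] - p.[x])%:E)%E.
Proof.
rewrite le_eqVlt => /predU1P[->|xy]; first by rewrite set_itv1 integral_set1 subrr.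
rewrite EFinB; apply: continuous_FTC2 => //.
- exact/continuous_subspaceT/continuous_horner.
- split; first by move=> v _; exact: derivable_horner.
  + by apply: cvg_at_right_filter; exact: continuous_horner.
  + by apply: cvg_at_left_filter; exact: continuous_horner.
- by move=> v _; rewrite -derivE.
Qed.

(* The Abel polynomials u (u + m a)^(m-1) / m!; the case m = 0 is 1 also at u = 0. *)
Definition abel (m : nat) (u : R) : R :=
  if m is k.+1 then u * (u + m%:R * a) ^+ k / m`!%:R else 1.

(** For [k = 0] this is the indicator of the closed half-line, in accordance with the indicator in
    the density. *)
Definition pos_power (k : nat) (u : R) : R := if 0 <= u then u ^+ k / k`!%:R else 0.

Lemma abel_ge0 m u : 0 <= a -> 0 <= u -> 0 <= abel m u.
Proof.
move=> a0 u0; case: m => [|m]; first exact: ler01.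
by rewrite /abel mulr_ge0 ?invr_ge0 ?ler0n// mulr_ge0 ?exprn_ge0 ?addr_ge0 ?mulr_ge0 ?ler0n.
Qed.

Lemma pos_power_ge0 k u : 0 <= pos_power k u.
Proof.
by rewrite /pos_power; case: ifP => // u0; rewrite mulr_ge0 ?exprn_ge0 ?invr_ge0 ?ler0n.
Qed.

Lemma measurable_abel m : measurable_fun setT (abel m).
Proof.
case: m => [|m]; first exact: measurable_cst.
apply: measurable_funM; last exact: measurable_cst.
apply: measurable_funM => //.
by apply: measurable_funX; apply: measurable_funD.
Qed.

Lemma measurable_pos_power k : measurable_fun setT (pos_power k).
Proof.
apply: measurable_fun_ifT => //.
- exact: measurable_fun_ler.
- by apply: measurable_funM => //; exact: measurable_funX.
Qed.

(* The derivative of abel (m + 1) is u |-> abel m (u + a). *)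
Lemma integral_abel m (x y : R) : y <= x ->
  (\int[mu]_(v in `[y, x]) (abel m (x - v + a))%:E = (abel m.+1 (x - y))%:E)%E.
Proof.
move=> yx.
(* An antiderivative in [v]: minus the Abel polynomial of degree [m + 1] at [x - v], so that it
   vanishes at [v = x]. *)
pose p : {poly R} := (('X - x%:P) * ((x + m.+1%:R * a)%:P - 'X) ^+ m) * ((m.+1)`!%:R^-1)%:P.
have f0 k : k`!%:R != 0 :> R by rewrite pnatr_eq0 -lt0n fact_gt0.
have -> : abel m.+1 (x - y) = p.[x] - p.[y].
  rewrite /p !hornerE subrr !mul0r sub0r -mulNr -mulNr opprB /abel.
  by congr (_ * _ ^+ _ / _); ring.
rewrite -integral_horner//; apply: eq_integral => v _; congr EFin.
rewrite /p derivM derivC mulr0 addr0 derivM derivB derivX derivC subr0 mul1r.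
rewrite deriv_exp derivB derivC derivX sub0r !hornerE.
rewrite hornerMn !hornerE.
case: m {p} => [|m]; first by rewrite expr0 mulr0n mulr0 addr0 invr1 mulr1.
rewrite /= /abel.
rewrite (factS m.+1) natrM invfM exprS.
have := f0 m.+1; move: (m.+1)`!%:R => F F0.
have e1 : m.+2%:R = m.+1%:R + 1 :> R by rewrite -natr1.
have e2 : m.+2%:R != 0 :> R by rewrite pnatr_eq0.
have -> : x + m.+2%:R * a - v = x - v + a + m.+1%:R * a by rewrite e1; ring.
move: (_ ^+ m) => w; rewrite -[-1 * w *+ _]mulr_natr.
rewrite e1 in e2; rewrite e1; move: (m.+1%:R) e2 => K e2.
by field; rewrite F0.
Qed.

Lemma integral_pos_power k (s y : R) :
  (\int[mu]_(v in `[y, +oo[) (pos_power k (s - v))%:E = (pos_power k.+1 (s - y))%:E)%E.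
Proof.
rewrite [LHS](_ : _ = \int[mu]_(v in `[y, s]) ((s - v) ^+ k / k`!%:R)%:E)%E; last first.
  rewrite integral_mkcond [RHS]integral_mkcond; apply: eq_integral => v _.
  rewrite /patch !mem_setE !in_itv/= andbT /pos_power subr_ge0.
  by case: (y <= v) => //=; case: ifP.
rewrite /pos_power subr_ge0; case: ifPn => [ys|]; last first.
  by rewrite -ltNge => sy; rewrite set_itv_ge ?integral_set0// -leNgt bnd_simp.
pose p : {poly R} := - (s%:P - 'X) ^+ k.+1 * ((k.+1)`!%:R^-1)%:P.
have f0 m : m`!%:R != 0 :> R by rewrite pnatr_eq0 -lt0n fact_gt0.
have -> : (s - y) ^+ k.+1 / (k.+1)`!%:R = p.[s] - p.[y].
  by rewrite /p !hornerE subrr expr0n/=; ring.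
rewrite -integral_horner//; apply: eq_integral => v _; congr EFin.
rewrite /p derivM derivC mulr0 addr0 derivN deriv_exp derivB derivC derivX sub0r !hornerE.
rewrite hornerMn !hornerE /= factS natrM invfM.
have := f0 k; move: (_`!%:R) => F F0.
have e2 : k.+1%:R != 0 :> R by rewrite pnatr_eq0.
move: (_ ^+ k) => w; rewrite -[-1 * w *+ _]mulr_natr.
by move: (k.+1%:R) e2 => K K0; field; rewrite F0.
Qed.

End polynomial_integrals.

Section barrier.
Context {R : realType}.
Notation mu := (@lebesgue_measure R).
Variables (a x : R) (f : R -> R).
Hypotheses (a0 : 0 < a) (mf : measurable_fun setT f) (f0 : forall z, 0 <= f z).
Notation S := (shift_op a).

Definition barrier (y m : R) : \bar R := if x < m then (f y)%:E else 0%E.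

Lemma barrier_measurable : ge0_measurable2 barrier.
Proof.
split=> [|y m]; last by rewrite /barrier; case: ifP => // _; rewrite lee_fin.
apply: measurable_fun_ifT => //; first exact: measurable_fun_ltr.
apply/measurable_EFinP.
exact: (measurableT_comp mf measurable_fst).
Qed.

Lemma measurable_barrier_density k s :
  measurable_fun setT (fun z => f z * pos_power k (z + s)).
Proof.
apply: measurable_funM => //.
apply: (measurableT_comp (f := pos_power k)); first exact: measurable_pos_power.
exact: measurable_funD.
Qed.

Lemma barrier_density_ge0 k z s : 0 <= f z * pos_power k s.
Proof. by rewrite mulr_ge0// pos_power_ge0. Qed.

(** Once [m] exceeds [x] the barrier is passed for good, and each application is an integration over
    a ray; repeated integration produces the truncated powers. *)
Lemma shift_op_above k y m : x < m ->
  iter k.+1 S barrier y m =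
  (\int[mu]_z (f z * pos_power k (z + (k.+1%:R * a - y)))%:E)%E.
Proof.
elim: k y m => [|k IH] y m xm; rewrite iterS /shift_op integral_ray.
  rewrite (@integral_translate R _ a); last 2 first.
  - have [mS _] := barrier_measurable.
    apply: measurable_fun_ifT => //; first exact: measurable_fun_ler.
    exact: (measurable_shift_kernel a m barrier_measurable).
  - by move=> v; case: ifP => // _; have [_] := barrier_measurable.
  apply: eq_integral => z _; rewrite /= /barrier lt_max xm/= addrK /pos_power mul1r.
  by rewrite addrA subr_ge0; case: ifP => _; rewrite ?mulr0// expr0 fact0 invr1 !mulr1.
pose g (p : R * R) : \bar R := if y <= p.1 then
  (f p.2 * pos_power k (p.2 + (k.+2%:R * a - p.1)))%:E else 0%E.
have mg : measurable_fun setT g.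
  apply: measurable_fun_ifT => //; first exact: measurable_fun_ler.
  apply/measurable_EFinP; apply: measurable_funM; first exact: measurableT_comp.
  apply: (measurableT_comp (f := pos_power k)); first exact: measurable_pos_power.
  by apply: measurable_funD => //; exact: measurable_funB.
have g0 p : (0 <= g p)%E.
  by rewrite /g; case: ifP => // _; rewrite lee_fin barrier_density_ge0.
rewrite [LHS](_ : _ = \int[mu]_v \int[mu]_z g (v, z))%E; last first.
  apply: eq_integral => v _; rewrite /g /=; case: ifP => _; last by rewrite integral0.
  apply: etrans (IH (v - a) (Num.max m v) _) _; first by rewrite lt_max xm.
  apply: eq_integral => z _; congr (_ * pos_power k (_ + _))%:E.
  by rewrite -(natr1 k.+1); ring.
rewrite fubini_tonelli//; apply: eq_integral => z _.
have -> : (f z * pos_power k.+1 (z + (k.+2%:R * a - y)))%:E = ((f z)%:E *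
    \int[mu]_(v in `[y, +oo[) (pos_power k (z + k.+2%:R * a - v))%:E)%E.
  by rewrite integral_pos_power -EFinM addrA.
rewrite -ge0_integralZl_EFin//; last 2 first.
- by move=> v _; rewrite lee_fin pos_power_ge0.
- apply/measurable_EFinP/measurable_funTS.
  apply: (measurableT_comp (f := pos_power k)); first exact: measurable_pos_power.
  exact: measurable_funB.
by rewrite integral_ray; apply: eq_integral => v _; rewrite /g/= addrA.
Qed.

Lemma shift_op_above_const k y m m' : x < m -> x < m' ->
  iter k S barrier y m = iter k S barrier y m'.
Proof.
case: k => [|k] xm xm'; first by rewrite /= /barrier xm xm'.
by rewrite !shift_op_above.
Qed.

(* A first maximum v <= x leaves the global maximum below x and moves the
   distance to x from x - y to x - v + a; beyond x the barrier is forgotten. *)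
Lemma shift_op_below k y m : y <= x -> m <= x ->
  iter k S barrier y m =
  (\sum_(i < k) (abel a i (x - y))%:E * iter (k - i) S barrier x (x + 1)%R)%E.
Proof.
elim: k y m => [|k IH] y m yx mx; first by rewrite big_ord0 /= /barrier ltNge mx.
have mk := measurable_shift_kernel a m (iter_shift_op_measurable a k barrier_measurable).
(* [x + 1] stands for any global maximum above [x], by [shift_op_above_const]. *)
have x1 : x < x + 1 by rewrite ltrDl.
have J0 i : (0 <= iter i S barrier x (x + 1)%R)%E.
  by have [] := @iter_shift_op_measurable _ a i _ barrier_measurable.
have -> : iter k.+1 S barrier y m =
    (\int[mu]_(v in `[y, x]) iter k S barrier (v - a)%R (Num.max m v) +
     \int[mu]_(v in `]x, +oo[) iter k S barrier (v - a)%R (Num.max m v))%E.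
  rewrite -ge0_integral_setU//.
  - rewrite iterS /shift_op; congr (integral _ _ _).
    by rewrite -itv_bndbnd_setU// bnd_simp.
  - exact: measurable_funTS.
  - by move=> v _; have [] := @iter_shift_op_measurable _ a k _ barrier_measurable.
  - rewrite disj_set2E; apply/eqP/seteqP; split => // v [] /=.
    by rewrite !in_itv/= andbT => /andP[_ h]; rewrite ltNge h.
(* The term [i = 0] is the part [v > x], where the barrier is passed at once; the other terms come
   from [v <= x] and the induction hypothesis, by [integral_abel]. *)
rewrite big_ord_recl subn0 addeC; congr (_ + _)%E.
  rewrite [abel _ _ _]/= mul1e iterS /shift_op.
  rewrite -integral_itv_obnd_cbnd; last first.
    apply: measurable_funTS.
    exact: (measurable_shift_kernel a (x + 1) (iter_shift_op_measurable a k barrier_measurable)).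
  apply: eq_integral => v; rewrite inE/= in_itv/= andbT => xv.
  by apply: shift_op_above_const; rewrite lt_max ?xv ?orbT// x1.
transitivity (\int[mu]_(v in `[y, x]) \sum_(i < k)
    ((abel a i (x - v + a))%:E * iter (k - i) S barrier x (x + 1)%R))%E.
  apply: eq_integral => v; rewrite inE/= in_itv/= => /andP[yv vx].
  rewrite IH; last 2 first.
  - by rewrite lerBlDr (le_trans vx)// lerDl ltW.
  - by rewrite ge_max mx.
  by apply: eq_bigr => i _; congr ((abel _ _ _)%:E * _)%E; ring.
have mab i : measurable_fun `[y, x] (fun v => (abel a i (x - v + a))%:E).
  apply/measurable_EFinP/measurable_funTS.
  apply: (measurableT_comp (f := abel a i)); first exact: measurable_abel.
  by apply: measurable_funD => //; exact: measurable_funB.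
have ab0 i v : `[y, x]%classic v -> (0 <= (abel a i (x - v + a))%:E)%E.
  rewrite /= in_itv/= => /andP[_ vx].
  by rewrite lee_fin abel_ge0 ?(ltW a0)// addr_ge0 ?subr_ge0// ltW.
rewrite ge0_integral_sum//; last 2 first.
- by move=> i; apply: emeasurable_funM; [exact: mab|exact: measurable_cst].
- by move=> i v vyx; apply: mule_ge0 => //; exact: ab0.
apply: eq_bigr => i _.
rewrite ge0_integralZr//; [|exact: mab|by move=> v; exact: ab0].
by rewrite integral_abel// /bump leq0n add1n subSS.
Qed.

Lemma shift_op_barrier n : 0 <= x ->
  iter n S barrier 0 0 = (\int[mu]_z (f z * \sum_(i < n)
    (abel a i x * pos_power (n - i).-1 (z + ((n - i)%:R * a - x))))%:E)%E.
Proof.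
move=> x0; have x1 : x < x + 1 by rewrite ltrDl.
rewrite shift_op_below// subr0.
under [RHS]eq_integral do rewrite mulr_sumr -sumEFin.
rewrite ge0_integral_sum//; last 2 first.
- move=> i; apply/measurable_EFinP; apply: measurable_funM => //.
  apply: measurable_funM; first exact: measurable_cst.
  apply: (measurableT_comp (f := pos_power _)); first exact: measurable_pos_power.
  exact: measurable_funD.
- move=> i z _; rewrite lee_fin mulr_ge0// mulr_ge0 ?pos_power_ge0//.
  by rewrite abel_ge0// ltW.
apply: eq_bigr => i _.
under [RHS]eq_integral do rewrite mulrCA EFinM.
rewrite ge0_integralZl_EFin//; last 3 first.
- by move=> z _; rewrite lee_fin barrier_density_ge0.
- by apply/measurable_EFinP; exact: measurable_barrier_density.
- by rewrite abel_ge0// ltW.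
have ni : (0 < n - i)%N by rewrite subn_gt0.
by rewrite -{1}(prednK ni) shift_op_above// (prednK ni).
Qed.

End barrier.

(** * The law at the n-th drawdown *)

Section ramp.
Context {R : realType}.
Implicit Types (j : nat) (u v : R).

(** An increasing Lipschitz approximation of the indicator of [0 < u]; it vanishes at 0, as the
    strict inequality requires. *)
Definition ramp j u : R := Num.min 1 (Num.max 0 (j%:R * u)).

Lemma ramp01 j u : 0 <= ramp j u <= 1.
Proof. by rewrite /ramp le_min ler01 le_max lexx /= ge_min lexx. Qed.

Lemma ramp_lipschitz j u v : `|ramp j u - ramp j v| <= j%:R * `|u - v|.
Proof.
have -> : j%:R * `|u - v| = `|j%:R * u - j%:R * v|.
  by rewrite -mulrBr normrM ger0_norm.
rewrite /ramp; move: (j%:R * u) (j%:R * v) => p q.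
have := ler_norm (p - q); have := ler_norm (q - p); rewrite distrC.
move: `|p - q| => D h1 h2; rewrite ler_norml.
rewrite /Order.min /Order.max.
by case: (ltP 0 p) => ?; case: (ltP 0 q) => ?; do 2?[case: (ltP 1 p) => ?];
  do 2?[case: (ltP 1 q) => ?]; rewrite ?ltr10; apply/andP; split; lra.
Qed.

Lemma ramp_nd u : nondecreasing_seq (ramp^~ u).
Proof.
move=> i j ij; have ijR : i%:R <= j%:R :> R by rewrite ler_nat.
rewrite /ramp le_min ge_min lexx /= ge_min; apply/orP; right.
have [u0|u0] := leP 0 u.
  by rewrite ge_max le_max lexx /= le_max ler_wpM2r ?orbT.
by rewrite ge_max le_max lexx /= le_max mulr_ge0_le0// ltW.
Qed.

Lemma ramp_cvg u : ramp j u @[j --> \oo] --> ((0 < u)%R%:R : R).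
Proof.
apply: cvg_near_cst; have [u0|u0] := ltP 0 u; last first.
  by near=> j; rewrite /ramp max_l ?min_r// mulr_ge0_le0.
exists (Num.bound u^-1) => // j /= Mj; rewrite /ramp.
have h : 1 <= j%:R * u.
  rewrite -ler_pdivrMr// mul1r (le_trans (ltW (archi_boundP _)))//; first by rewrite invr_ge0 ltW.
  by rewrite ler_nat.
by rewrite max_r ?min_l//; apply: le_trans h.
Unshelve. all: by end_near. Qed.

End ramp.

Section density.
Context {R : realType}.
Variables (mu sigma a lam : R).
Notation c := (c_const mu sigma a lam).
Notation b := (b_const mu sigma a lam).

(** The term [i = 0] contains [x * x^-1], which equals [abel a 0 x = 1] because [x] is nonzero. *)
Lemma drawdown_densityE n x z : 0 < x -> 0 < a ->
  drawdown_density mu sigma a lam n x z =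
  (c * expR (- b * a)) ^+ n * (expR (- b * z) * \sum_(i < n)
    (abel a i x * pos_power (n - i).-1 (z + ((n - i)%:R * a - x)))).
Proof.
move=> x0 a0; rewrite /drawdown_density; move: c b => c' b'; rewrite exprMn -expRM_natl mulrA.
congr (_ * _).
  by rewrite -mulrA -expRD; congr (_ * expR _); ring.
apply: eq_bigr => i _; rewrite /pos_power.
have -> : z + ((n - i)%:R * a - x) = z - x + (n - i)%:R * a by ring.
case: ifP => _; last by rewrite !mulr0 mul0r.
rewrite mulr1 natrM invfM (subnAC n 1 i) subn1.
have -> : x * (x + i%:R * a) ^ (i%:Z - 1) = abel a i x * i`!%:R.
  case: (i : nat) => [|k].
    by rewrite mul0r addr0 sub0r fact0 mulr1 /abel exprN1 mulfV// gt_eqF.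
  rewrite -addn1 PoszD addrK /abel addn1 divfK// pnatr_eq0 -lt0n fact_gt0//.
have f0 k : k`!%:R != 0 :> R by rewrite pnatr_eq0 -lt0n fact_gt0.
by field; rewrite !f0.
Qed.

End density.

Section limit_law.
Context {R : realType} {d : measure_display} {T : measurableType d}
  (P : probability T R).
Variables (mu sigma a lam x : R) (n : nat) (T1 Z1 M1 : T -> R).
Notation c := (c_const mu sigma a lam).
Notation b := (b_const mu sigma a lam).
Notation op := (drawdown_op c b a).
Notation leb := (@lebesgue_measure R).
Hypotheses (sigma0 : 0 < sigma) (a0 : 0 < a) (lam0 : 0 < lam) (x0 : 0 < x).
Hypotheses (mT : measurable_fun setT T1) (mZ : measurable_fun setT Z1)
  (mM : measurable_fun setT M1) (T01 : forall w, 0 <= T1 w <= 1).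
Hypothesis law : forall G C, bounded_lipschitz C G ->
  (\int[P]_w (T1 w * G (Z1 w) (M1 w))%:E = (iter n op G 0 0)%:E)%E.

(** For increasing Lipschitz approximations of the indicators, one side of [law] converges
    monotonically under [P] and the other through the iterates of [shift_op]. *)
Lemma discounted_law (phi_ : nat -> R -> R) (phi : R -> R) :
  measurable_fun setT phi ->
  (forall j z, 0 <= phi_ j z <= 1) ->
  (forall j y z, `|phi_ j y - phi_ j z| <= j%:R * `|y - z|) ->
  (forall z, nondecreasing_seq (phi_^~ z)) ->
  (forall z, phi_ j z @[j --> \oo] --> phi z) ->
  (\int[P]_w (T1 w * (phi (Z1 w) * (x < M1 w)%R%:R))%:E =
   \int[leb]_z (phi z * drawdown_density mu sigma a lam n x z)%:E)%E.
Proof.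
move=> mphi phi01 phiL phind phicvg.
have b0 := b_const_gt0 mu sigma0 a0 lam0; have c0 := c_const_gt0 mu sigma0 a0 lam0.
have phi0 z : 0 <= phi z.
  rewrite -(cvg_lim _ (phicvg z))//; apply: limr_ge; first by apply/cvg_ex; exists (phi z).
  by apply: nearW => j; have /andP[] := phi01 j z.
pose G j y m := phi_ j y * ramp j (m - x).
have G0 j y m : 0 <= G j y m.
  by have /andP[? _] := phi01 j y; have /andP[? _] := ramp01 j (m - x); rewrite mulr_ge0.
have Gnd y m : nondecreasing_seq (fun j => G j y m).
  move=> i j ij; have /andP[p1 _] := phi01 i y; have /andP[p2 _] := ramp01 i (m - x).
  by apply: ler_pM => //; [exact: phind|exact: ramp_nd].
have GL j : bounded_lipschitz (1 + j%:R) (G j).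
  split=> [y m|y y' m m'].
    rewrite ger0_norm//; have /andP[p1 p2] := phi01 j y; have /andP[p3 p4] := ramp01 j (m - x).
    by apply: (@le_trans _ _ (1 * 1)); [exact: ler_pM|rewrite mulr1 lerDl].
  have h1 := phiL j y y'; have h2 := ramp_lipschitz j (m - x) (m' - x).
  have -> : G j y m - G j y' m' = (phi_ j y - phi_ j y') * ramp j (m - x) +
      phi_ j y' * (ramp j (m - x) - ramp j (m' - x)) by rewrite /G; ring.
  apply: le_trans (ler_normD _ _) _; rewrite !normrM.
  have /andP[p1 p2] := phi01 j y'; have /andP[p3 p4] := ramp01 j (m - x).
  rewrite (ger0_norm p1) (ger0_norm p3) mulrDr.
  have e : m - x - (m' - x) = m - m' by ring.
  rewrite e in h2.
  have n1 := normr_ge0 (y - y'); have n2 := normr_ge0 (m - m').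
  apply: lerD.
    apply: (@le_trans _ _ (j%:R * `|y - y'| * 1)); first exact: ler_pM.
    by rewrite mulr1 ler_wpM2r// lerDr.
  apply: (@le_trans _ _ (1 * (j%:R * `|m - m'|))); first exact: ler_pM.
  by rewrite mul1r ler_wpM2r// lerDr.
have Gcvg y m : G j y m @[j --> \oo] --> phi y * (x < m)%R%:R.
  by rewrite -subr_gt0; apply: cvgM; [exact: phicvg|exact: ramp_cvg].
have mG j : measurable_fun setT (fun p : R * R => G j p.1 p.2).
  exact: measurable_bounded_lipschitz (GL j).
have cE (u : nat -> R) (l : R) : u j @[j --> \oo] --> l -> (u j)%:E @[j --> \oo] --> l%:E.
  by move=> ul; apply/fine_cvgP; split; [exact: nearW|].
have lim1 : (\int[P]_w (T1 w * G j (Z1 w) (M1 w))%:E)%E @[j --> \oo] -->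
    (\int[P]_w (T1 w * (phi (Z1 w) * (x < M1 w)%R%:R))%:E)%E.
  have -> : (\int[P]_w (T1 w * (phi (Z1 w) * (x < M1 w)%R%:R))%:E)%E =
      (\int[P]_w limn (fun j => (T1 w * G j (Z1 w) (M1 w))%:E))%E.
    apply: eq_integral => w _; apply/esym/cvg_lim => //; apply: cE.
    by apply: cvgM; [exact: cvg_cst|exact: Gcvg].
  apply: (@cvg_monotone_convergence _ _ _ P setT _ (fun j w => (T1 w * G j (Z1 w) (M1 w))%:E)) => //.
  - move=> j; apply/measurable_EFinP; apply: measurable_funM => //.
    apply: (measurableT_comp (f := fun p : R * R => G j p.1 p.2) (g := fun w => (Z1 w, M1 w))) => //.
    exact: measurable_fun_pair.
  - by move=> j w _; rewrite lee_fin mulr_ge0//; have /andP[] := T01 w.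
  - move=> w _ i j ij; rewrite lee_fin ler_wpM2l//; first by have /andP[] := T01 w.
    exact: Gnd.
have mexp : measurable_fun setT (fun z : R => expR (- b * z)).
  by apply: continuous_measurable_fun; exact: continuous_expRNM.
pose f z := expR (- b * z) * phi z.
have mf : measurable_fun setT f.
  exact: measurable_funM.
have f0 z : 0 <= f z by rewrite mulr_ge0// expR_ge0.
pose F j y m := (expR (- b * y) * G j y m)%:E.
have FF j : ge0_measurable2 (F j).
  split=> [|y m]; last by rewrite lee_fin mulr_ge0// expR_ge0.
  apply/measurable_EFinP; apply: measurable_funM; last exact: mG.
  exact: (measurableT_comp mexp measurable_fst).
have e0 : 0 < c * expR (- b * a) by rewrite mulr_gt0// expR_gt0.
have lim2 := @iter_shift_op_cvg R a n F (barrier x f) FF.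
have {}lim2 : iter n (shift_op a) (F j) 0 0 @[j --> \oo] -->
    iter n (shift_op a) (barrier x f) 0 0.
  apply: lim2.
  - by move=> y m i j ij; rewrite lee_fin ler_wpM2l ?expR_ge0//; exact: Gnd.
  - move=> y m; rewrite [barrier x f y m](_ : _ = (expR (- b * y) * (phi y * (x < m)%R%:R))%:E).
      by apply: cE; apply: cvgM; [exact: cvg_cst|exact: Gcvg].
    by rewrite /barrier /f; case: ifP => _; rewrite ?mulr0 ?mulr1.
have lim3 : (\int[P]_w (T1 w * G j (Z1 w) (M1 w))%:E)%E @[j --> \oo] -->
    (((c * expR (- b * a)) ^+ n)%:E * iter n (shift_op a) (barrier x f) 0%R 0%R)%E.
  apply: cvg_trans (cvgeZl _ lim2) => //; apply: near_eq_cvg; apply: nearW => j.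
  rewrite (law (GL j)) (iter_drawdown_shift a n c0 b0 (GL j)) -EFinM mulr0 expR0 mul1r.
  by congr EFin; rewrite mulrC divfK// expf_neq0// gt_eqF.
rewrite -(cvg_lim _ lim1)// (cvg_lim _ lim3)//.
rewrite shift_op_barrier// ?(ltW x0)// -ge0_integralZl_EFin//.
- by apply: eq_integral => z _; rewrite -EFinM drawdown_densityE// /f; congr EFin; ring.
- move=> z _; rewrite lee_fin mulr_ge0// sumr_ge0// => i _.
  by rewrite mulr_ge0 ?pos_power_ge0// abel_ge0// ltW.
- apply/measurable_EFinP; apply: measurable_funM => //.
  apply: measurable_sum => i; apply: measurable_funM; first exact: measurable_cst.
  apply: (measurableT_comp (f := pos_power _)); first exact: measurable_pos_power.
  exact: measurable_funD.
- by rewrite exprn_ge0// ltW.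
Qed.

End limit_law.

(** * Null sets and passage to Borel sets *)

Section null_set.
Import HBNNSimple.
Context {R : realType} {d : measure_display} {T : measurableType d}.
Variable P : {measure set T -> \bar R}.

(* The event in the theorem need not be measurable, so the almost-everywhere
   lemmas for measurable integrands do not apply to it. *)
Lemma le_integral_off_null (N : set T) (g h : T -> \bar R) :
  measurable N -> P N = 0%E -> (forall w, 0 <= g w)%E -> (forall w, 0 <= h w)%E ->
  (forall w, ~ N w -> g w = h w) -> (\int[P]_w g w <= \int[P]_w h w)%E.
Proof.
move=> mN PN g0 h0 gh; rewrite !ge0_integralTE//.
apply: ge_ereal_sup => _ [s sg <-].
(* The integral is a supremum over simple functions. Each simple [s <= g] is restricted to the
   complement of [N]: the integral does not change and the restriction lies below [h]. *)
have mNC := measurableC mN.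
have projE w : proj_nnsfun s mNC w = s w * \1_(~` N) w by [].
apply: (@le_trans _ _ (sintegral P (proj_nnsfun s mNC))).
  rewrite -!integralT_nnsfun.
  rewrite (@ge0_negligible_integral _ _ _ P setT N)//; last 2 first.
  - exact/measurable_EFinP.
  - by move=> w _; rewrite lee_fin.
  rewrite setTD integral_mkcond; apply: ge0_le_integral => //.
  - by move=> w _; rewrite erestrict_ge0// => ? _; rewrite lee_fin.
  - by apply/(measurable_restrictT _ mNC)/measurable_funTS/measurable_EFinP.
  - exact/measurable_EFinP.
  move=> w _; rewrite projE indicE /patch; case: ifP => wN; rewrite lee_fin ?mulr1//.
  by rewrite mulr_ge0.
apply: ereal_sup_ubound; exists (proj_nnsfun s mNC) => // w.
rewrite projE indicE; have [wN|wN] := pselect (N w).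
  by rewrite memNset ?mulr0//; apply.
by rewrite mem_set// mulr1 -gh.
Qed.

Lemma eq_integral_off_null (N : set T) (g h : T -> \bar R) :
  measurable N -> P N = 0%E -> (forall w, 0 <= g w)%E -> (forall w, 0 <= h w)%E ->
  (forall w, ~ N w -> g w = h w) -> (\int[P]_w g w = \int[P]_w h w)%E.
Proof.
move=> mN PN g0 h0 gh; apply/eqP; rewrite eq_le; apply/andP.
by split; apply: (le_integral_off_null mN PN) => // w /gh.
Qed.

End null_set.

Section transfer.
Context {R : realType} {d : measure_display} {T : measurableType d}.
Variables (P : probability T R) (Z h : T -> R) (dens : R -> R).
Notation leb := (@lebesgue_measure R).
Hypotheses (mZ : measurable_fun setT Z) (mh : measurable_fun setT h)
  (h01 : forall w, 0 <= h w <= 1)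
  (md : measurable_fun setT dens) (d0 : forall z, 0 <= dens z).
Hypotheses (rayE : forall y, (\int[P]_(w in Z @^-1` `]y, +oo[) (h w)%:E =
    \int[leb]_(z in `]y, +oo[) (dens z)%:E)%E)
  (allE : (\int[P]_w (h w)%:E = \int[leb]_z (dens z)%:E)%E).

(** Open rays form a system closed under intersection that generates the Borel sets, so a Dynkin
    argument applies; [allE] serves the complements. *)
Lemma transfer_density (A : set R) : measurable A ->
  (\int[P]_(w in Z @^-1` A) (h w)%:E = \int[leb]_(z in A) (dens z)%:E)%E.
Proof.
have h0 w : (0 <= (h w)%:E)%E by have /andP[] := h01 w; rewrite lee_fin.
have d0' z : (0 <= (dens z)%:E)%E by rewrite lee_fin.
have mZA (B : set R) : measurable B -> measurable (Z @^-1` B).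
  by move=> mB; rewrite -[_ @^-1` _]setTI; exact: mZ.
have mh' D : measurable_fun D (EFin \o h) by apply: measurable_funTS; apply/measurable_EFinP.
have md' D : measurable_fun D (EFin \o dens) by apply: measurable_funTS; apply/measurable_EFinP.
have mE : @measurable _ (measurableTypeR R) = <<s @RGenOInfty.G R >>.
  exact: RGenOInfty.measurableE.
move=> mA; have : <<s @RGenOInfty.G R >> A by rewrite -mE.
move: A {mA}; apply: (dynkin_induction mE).
- move=> _ _ [y ->] [z ->]; exists (Num.max y z); apply/seteqP; split => u /=.
    by rewrite !in_itv/= !andbT gt_max => -[-> ->].
  by rewrite !in_itv/= !andbT gt_max => /andP[-> ->].
- by rewrite preimage_setT.
- by move=> _ [y ->]; exact: rayE.
- move=> A mA AE.
  (* Finiteness allows the integral over [A] to be cancelled from the total. *)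
  have PA : (\int[P]_(w in Z @^-1` A) (h w)%:E \is a fin_num)%E.
    rewrite ge0_fin_numE; last exact: integral_ge0.
    apply: (@le_lt_trans _ _ (\int[P]_(w in Z @^-1` A) 1%:E)%E).
      apply: ge0_le_integral => //; first exact: mZA.
      by move=> w _; rewrite lee_fin; have /andP[] := h01 w.
    rewrite integral_cst ?mul1e; last exact: mZA.
    by apply: le_lt_trans (probability_le1 P (mZA _ mA)) _; rewrite ltry.
  have e1 := @ge0_integral_setU _ _ _ P (Z @^-1` A) (Z @^-1` (~` A)) (mZA _ mA)
    (mZA _ (measurableC mA)) (EFin \o h) (mh' _) (fun w _ => h0 w).
  have e2 := @ge0_integral_setU _ _ _ leb A (~` A) mA (measurableC mA) (EFin \o dens)
    (md' _) (fun z _ => d0' z).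
  rewrite -preimage_setU !setUv preimage_setT in e1 e2.
  have dA : [disjoint A & ~` A] by rewrite disj_set2E setICr.
  have dZ : [disjoint Z @^-1` A & Z @^-1` (~` A)].
    by rewrite disj_set2E -preimage_setI setICr preimage_set0.
  move: (e1 dZ) (e2 dA); rewrite /= allE => -> ; rewrite -AE.
  move: PA; case: (integral _ _ _) => // r _.
  by case: (integral _ _ _) => [u||]; case: (integral _ _ _) => [v||] //= [] /addrI ->.
- move=> F mF tF FE; rewrite preimage_bigcup ge0_integral_bigcup//; last 2 first.
  - by move=> i; exact: (mZA _ (mF i)).
  - by move=> i j _ _ [w [wi wj]]; apply: tF => //; exists (Z w).
  rewrite [RHS]ge0_integral_bigcup//; last exact: md'.
  by apply: eq_eseriesr => i _; exact: FE.
Qed.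

End transfer.

(* The left-hand side is E[e^(-lambda tau); M_tau > x, X_tau \in A]; the
   integrand is expeR -oo = 0 where tau = +oo. *)
Theorem theorem4p2 (R : realType) (d : measure_display) (T : measurableType d)
    (P : probability T R) (W : R -> {RV P >-> R}) (mu sigma a lambda x : R)
    (n : nat) (A : set R) :
  brownian_motion W ->
  0 < sigma -> 0 < a -> 0 < lambda -> (0 < n)%N -> 0 < x ->
  measurable A ->
  let X := drifted W mu sigma in
  let tau := fun w : T => drawdown_time a (X w) n in
  let U := [set w : T | x < running_sup (X w) 0 (fine (tau w)) /\
                        A (X w (fine (tau w)))] in
  (\int[P]_(w in U) expeR (- (lambda%:E * tau w)) =
   \int[lebesgue_measure]_(y in A)
      (drawdown_density mu sigma a lambda n x y)%:E)%E.
Proof.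
move=> bmW sigma0 a0 lam0 n0 x0 mA X tau U.
have [T1 [Z1 [M1 [[mT mZ] mM T01 [N [mN PN HN]] law]]]] :=
  drawdown_versions mu bmW sigma0 a0 lam0 n.
pose h w := T1 w * (x < M1 w)%R%:R.
pose dens := drawdown_density mu sigma a lambda n x.
have b01 (q : bool) : 0 <= (q%:R : R) <= 1 by case: q; rewrite ?ler01 ?lexx.
have h01 w : 0 <= h w <= 1.
  have /andP[t0 t1] := T01 w; have /andP[u0 u1] := b01 (x < M1 w).
  rewrite mulr_ge0//=; apply: (@le_trans _ _ (1 * 1)); last by rewrite mulr1.
  exact: ler_pM.
have densE z := drawdown_densityE mu sigma lambda n z x0 a0.
have c0 := c_const_gt0 mu sigma0 a0 lam0.
have dens0 z : 0 <= dens z.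
  rewrite /dens densE mulr_ge0//; first by rewrite exprn_ge0// mulr_ge0 ?expR_ge0 ?(ltW c0).
  apply: mulr_ge0; rewrite ?expR_ge0// sumr_ge0// => i _.
  by rewrite mulr_ge0 ?pos_power_ge0// abel_ge0// ltW.
have mdens : measurable_fun setT dens.
  rewrite /dens (funext densE).
  apply: measurable_funM => //; apply: measurable_funM.
    by apply: continuous_measurable_fun; exact: continuous_expRNM.
  apply: measurable_sum => i; apply: measurable_funM; first exact: measurable_cst.
  apply: (measurableT_comp (f := pos_power _)); first exact: measurable_pos_power.
  exact: measurable_funD.
have mb (f g : T -> R) : measurable_fun setT f -> measurable_fun setT g ->
    measurable_fun setT (fun w => (f w < g w)%R%:R : R).
  move=> mf mg; rewrite (_ : (fun w => _) = (fun w => if f w < g w then 1 else 0)); last first.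
    by apply/funext => w; case: ifP.
  by apply: measurable_fun_ifT => //; exact: measurable_fun_ltr.
have mh : measurable_fun setT h by apply: measurable_funM => //; exact: mb.
have dl := @discounted_law R _ T P mu sigma a lambda x n T1 Z1 M1 sigma0 a0 lam0 x0
  mT mZ mM T01 law.
have rayE y : (\int[P]_(w in Z1 @^-1` `]y, +oo[) (h w)%:E =
    \int[lebesgue_measure]_(z in `]y, +oo[) (dens z)%:E)%E.
  have := dl (fun j z => ramp j (z - y)) (fun z => (0 < z - y)%R%:R) _ _ _ _ _.
  move=> H; rewrite integral_mkcond [RHS]integral_mkcond.
  transitivity (\int[P]_w (T1 w * ((0 < Z1 w - y)%R%:R * (x < M1 w)%R%:R))%:E)%E.
    apply: eq_integral => w _; rewrite /patch subr_gt0 /h.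
    have -> : (w \in Z1 @^-1` `]y, +oo[) = (y < Z1 w).
      by apply/idP/idP; rewrite inE/= in_itv/= andbT.
    by case: ifP => _; rewrite ?mul1r// mul0r mulr0.
  rewrite H.
  - apply: eq_integral => z _; rewrite /patch mem_setE in_itv/= andbT subr_gt0.
    by case: ifP => _; rewrite ?mul1r// mul0r.
  - rewrite (_ : (fun z => _) = (fun w => if y < w then 1 else 0)); last first.
      by apply/funext => w; rewrite subr_gt0; case: ifP.
    by apply: measurable_fun_ifT => //; exact: measurable_fun_ltr.
  - by move=> j z; exact: ramp01.
  - move=> j u v; apply: le_trans (ramp_lipschitz _ _ _) _.
    by have -> : u - y - (v - y) = u - v by ring.
  - by move=> z; exact: ramp_nd.
  - by move=> z; exact: ramp_cvg.
have allE : (\int[P]_w (h w)%:E = \int[lebesgue_measure]_z (dens z)%:E)%E.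
  have H := dl (fun _ _ => 1) (fun _ => 1) _ _ _ _ _.
  transitivity (\int[P]_w (T1 w * (1 * (x < M1 w)%R%:R))%:E)%E.
    by apply: eq_integral => w _; rewrite mul1r.
  rewrite H.
  - by apply: eq_integral => z _; rewrite mul1r.
  - exact: measurable_cst.
  - by move=> *; rewrite ler01 lexx.
  - by move=> *; rewrite subrr normr0 mulr_ge0.
  - by move=> z i j _.
  - by move=> z; exact: cvg_cst.
rewrite -(transfer_density mZ mh h01 mdens dens0 rayE allE mA).
rewrite integral_mkcond [RHS]integral_mkcond.
have h0 w : 0 <= h w by have /andP[] := h01 w.
apply: (eq_integral_off_null mN PN).
- by move=> w; apply: erestrict_ge0 => v _; exact: expeR_ge0.
- by move=> w; apply: erestrict_ge0 => v _; rewrite lee_fin.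
move=> w /HN[TE ZM]; rewrite /patch TE.
(* Where [tau] is infinite, membership in [U] refers to the default [fine +oo = 0], but the
   integrand and [T1] are both 0. *)
have [tn|/ZM[ZE ME]] := pselect (tau w = +oo%E).
  have T0 : T1 w = 0.
    by move: TE; rewrite -/(tau w) tn gt0_muley ?lte_fin//= => -[].
  by rewrite /h T0 mul0r; case: ifP; case: ifP.
have -> : (w \in U) = (x < M1 w) && (w \in Z1 @^-1` A).
  rewrite /U ME -/(tau w); apply/idP/idP.
    by rewrite inE => -[-> ?]; rewrite inE /preimage /= ZE.
  by move=> /andP[h1]; rewrite !inE /preimage /= ZE.
by rewrite /h; case: (x < M1 w); case: (w \in _); rewrite /= ?mulr1 ?mulr0.
Qed.
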